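(* Let $r\ge2$. Let $\overline M_r^{\mathbb C}$ be the set of isomorphism classes of stable curves with $r$ input marked points, equipped with the atlas consisting of the charts $\varphi_T\colon X_T\to\overline M_r^{\mathbb C}$ for all sliced stable rooted trees $T\in K_r^{\mathbb C}$ (all defined in the context). Then $\overline M_r^{\mathbb C}$ is a smooth proper complex variety.
   Context: **Trees.** A rooted tree is oriented toward its root $\rho_{\rm root}$; $\mathrm{in}(\rho)$ is the set of incoming neighbors of $\rho$; $\rho$ is interior if $\mathrm{in}(\rho)\ne\emptyset$; $V_{\rm int}(T)$ is the set of interior vertices. $T$ is stable if every interior vertex has at least 2 incoming neighbors. $K_r^{\mathbb C}$ is the set of isomorphism classes of stable rooted trees with $r$ labeled leaves $\lambda_1,\dots,\lambda_r$. $T_\rho$ is the set of vertices whose path to the root passes through $\rho$. $[\rho,\sigma]$ is the path from $\rho$ to $\sigma$; $[\rho,\sigma[$, $]\rho,\sigma]$, $]\rho,\sigma[$ omit the indicated endpoints. **Stable curves.** A stable curve with $r$ input marked points is a stable rooted tree $T$ with $r$ labeled leaves, together with, for each $\rho\in V_{\rm int}(T)$, pairwise distinct numbers $x_{\rho\sigma}\in\mathbb C$, $\sigma\in\mathrm{in}(\rho)$. Two such are isomorphic if there are an isomorphism of labeled rooted trees and, for each $\rho\in V_{\rm int}(T)$, an affine map $\phi_\rho\in\mathbb C\rtimes\mathbb C^*$ of $\mathbb C$, carrying one set of numbers to the other. $\overline M_r^{\mathbb C}$ is the set of isomorphism classes. **Slices.** A slice of $T$ is a pair of functions $s_0,s_1\colon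 V_{\rm int}(T)\to V(T)$ with $s_0(\rho)\ne s_1(\rho)$ both in $\mathrm{in}(\rho)$. **Local models.** Let $T$ be sliced. Let $\Delta$ denote the big diagonal (tuples with two equal entries). Consider $$Y_T=\prod_{\rho\in V_{\rm int}(T)}\bigl((\mathbb C\setminus\{0,1\})^{\mathrm{in}(\rho)\setminus\{s_0(\rho),s_1(\rho)\}}\setminus\Delta\bigr)\times\mathbb C^{V_{\rm int}(T)\setminus\{\rho_{\rm root}\}}\subset\mathbb C^{r-2},$$ with elements written $((\mathbf x_\rho),\mathbf b)$. Set $\tilde x_{\rho\sigma}=x_{\rho\sigma}$ for $\sigma\in\mathrm{in}(\rho)\setminus\{s_0(\rho),s_1(\rho)\}$ and $\tilde x_{\rho,s_i(\rho)}=i$ for $i=0,1$; for $\sigma\in T_\rho\setminus\{\rho\}$ set $\tilde x_{\rho\sigma}=\tilde x_{\rho\tau}$, where $\tau$ is the first vertex after $\rho$ on the path from $\rho$ to $\sigma$. For $\rho\in V_{\rm int}(T)$, $\sigma\in T_\rho\setminus\{\rho\}$ put $$p_{\rho\sigma}=\sum_{\tau\in[\rho,\sigma[}\Bigl(\tilde x_{\tau\sigma}\prod_{\upsilon\in]\rho,\tau]}b_\upsilon\Bigr).$$ For $i<j$ let $q_{ij}$ be the polynomial with $p_{\rho_{\rm root}\lambda_i}-p_{\rho_{\rm root}\lambda_j}=q_{ij}\cdot\prod_\rho b_\rho^{a_\rho}$ and $b_\rho\nmid q_{ij}$ for all $\rho$. Then $X_T=Y_T\setminus\bigcup_{i<j}Z(q_{ij})$,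 where $Z$ denotes the zero locus. **Charts.** For $((\mathbf x_\rho),\mathbf b)\in X_T$, let $T'$ be the tree obtained from $T$ by contracting the outgoing edge of each $\rho\in V_{\rm int}(T)\setminus\{\rho_{\rm root}\}$ with $b_\rho\neq0$. Then $V_{\rm int}(T')$ is identified with $\{\rho_{\rm root}\}\cup\{\rho:b_\rho=0\}$, and $\mathrm{in}_{T'}(\rho)$ with the set of $\sigma\in T_\rho\setminus\{\rho\}$ that are leaves or have $b_\sigma=0$, such that $b_\tau\ne0$ for all $\tau\in]\rho,\sigma[$. The chart is $\varphi_T((\mathbf x_\rho),\mathbf b)=\bigl(T',(p_{\rho\sigma})_{\rho\in V_{\rm int}(T'),\sigma\in\mathrm{in}_{T'}(\rho)}\bigr)$. **Variety structure.** A subset of $\overline M_r^{\mathbb C}$ is open iff its preimage under every $\varphi_T$ is Zariski-open. The assertion that the atlas makes it a variety means that the charts are homeomorphisms onto open sets covering the space, that the transition maps $\varphi_{T_2}^{-1}\circ\varphi_{T_1}$ are morphisms on their domains, and that the resulting space is irreducible and separated. *)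

(* Defs.v *)
From HB Require Import structures.
From mathcomp Require Import all_boot all_order all_algebra.
From mathcomp Require Import complex.
From mathcomp Require Import boolp classical_sets cardinality reals.
From mathcomp Require Import mpoly.

Set Implicit Arguments.
Unset Strict Implicit.
Unset Printing Implicit Defensive.

Import GRing.Theory.

Local Open Scope ring_scope.
Local Open Scope classical_set_scope.

(* -------------------------------------------------------------------- *)
(** * Quasi-affine sets, over an algebraically closed field K            *)

Section Zariski.
Variable K : closedFieldType.
Implicit Types I J : finType.

(* Affine space with coordinates indexed by the finite type I is [I -> K];
   its polynomial functions are the elements of [{mpoly K[#|I|]}], the
   variable number [enum_rank i] being the coordinate i. *)
Definition coordX I (i : I) : {mpoly K[#|I|]} := 'X_(enum_rank i).

Definition peval I (P : {mpoly K[#|I|]}) (v : I -> K) : K :=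
  P.@[fun k => v (enum_val k)].

Definition zeros I (S : set {mpoly K[#|I|]}) : set (I -> K) :=
  [set v | forall P, S P -> peval P v = 0].

Definition zclosed I (F : set (I -> K)) : Prop := exists S, F = zeros S.

Definition zopen I (U : set (I -> K)) : Prop := zclosed (~` U).

Definition zopen_in I (X U : set (I -> K)) : Prop :=
  exists2 O, zopen O & U = X `&` O.

Definition quasi_affine I (X : set (I -> K)) : Prop :=
  exists F O, [/\ zclosed F, zopen O & X = F `&` O].

Definition regular_fun I (D : set (I -> K)) (f : (I -> K) -> K) : Prop :=
  forall v, D v -> exists (U : set (I -> K)) (P Q : {mpoly K[#|I|]}),
    [/\ zopen U, U v
      & forall w, D w -> U w -> peval Q w != 0 /\ f w = peval P w / peval Q w].

Definition regular_map I J (D : set (I -> K)) (E : set (J -> K))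
    (f : (I -> K) -> (J -> K)) : Prop :=
  (forall v, D v -> E (f v)) /\ (forall j, regular_fun D (fun v => f v j)).

(* Jacobian criterion: near v, the set X is cut out by c equations whose
   differentials at v are linearly independent. *)
Definition smooth_at I (X : set (I -> K)) (v : I -> K) : Prop :=
  exists (c : nat) (f : 'I_c -> {mpoly K[#|I|]}) (U : set (I -> K)),
    [/\ zopen U, U v, X `&` U = zeros (range f) `&` U
      & \rank (\matrix_(i < c, k < #|I|) peval (mderiv k (f i)) v) = c].

End Zariski.

(* -------------------------------------------------------------------- *)
(** * Varieties given by an atlas                                         *)

(* The underlying space is the subset [carrier] of [pt]; the values of
   [chart j] outside [dom j] are irrelevant. *)
Record atlas (K : closedFieldType) := Atlas {
  pt : Type;
  carrier : set pt;
  idx : Type;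
  coords : idx -> finType;
  dom : forall j : idx, set (coords j -> K);
  chart : forall j : idx, (coords j -> K) -> pt
}.

Arguments carrier {K} a.
Arguments dom {K a} j.
Arguments chart {K a} j v.

Section Atlas.
Variable K : closedFieldType.
Implicit Types A B : atlas K.

Definition aopen A (U : set (pt A)) : Prop :=
  U `<=` carrier A /\
  forall j : idx A, zopen_in (dom j) (dom j `&` (chart j @^-1` U)).

Definition aclosed A (F : set (pt A)) : Prop :=
  F `<=` carrier A /\ aopen (carrier A `\` F).

Definition overlap A (j k : idx A) : set (coords j -> K) :=
  [set v | dom j v /\ (chart k @` dom k) (chart j v)].

Arguments overlap {A} j k.

(* Continuity of the charts is built into [aopen].  The map [t] in the last
   clause is the transition map [chart k]^-1 \o [chart j]. *)
Definition prevariety A : Prop :=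
  [/\ forall j : idx A, quasi_affine (dom j),
      forall (j : idx A) v, dom j v -> carrier A (chart j v),
      forall m, carrier A m -> exists j : idx A, (chart j @` dom j) m,
      forall j : idx A,
        (forall v w, dom j v -> dom j w -> chart j v = chart j w -> v = w) /\
        (forall U, zopen_in (dom j) U -> aopen (chart j @` U))
    & forall j k : idx A, exists t : (coords j -> K) -> (coords k -> K),
        regular_map (overlap j k) (dom k) t /\
        forall v, overlap j k v -> chart k (t v) = chart j v].

Definition irreducible A : Prop :=
  carrier A !=set0 /\
  forall F G, aclosed F -> aclosed G -> carrier A `<=` F `|` G ->
    carrier A `<=` F \/ carrier A `<=` G.

Definition prod_atlas A B : atlas K := @Atlas K
  (pt A * pt B)
  (carrier A `*` carrier B)
  (idx A * idx B)
  (fun j => (coords j.1 + coords j.2)%type : finType)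
  (fun j => [set v : coords j.1 + coords j.2 -> K |
     dom j.1 (v \o inl) /\ dom j.2 (v \o inr)])
  (fun j (v : coords j.1 + coords j.2 -> K) =>
     (chart j.1 (v \o inl), chart j.2 (v \o inr))).

Definition separated A : Prop :=
  @aclosed (prod_atlas A A) [set m | carrier A m.1 /\ m.1 = m.2].

Definition is_variety A : Prop :=
  [/\ prevariety A, irreducible A & separated A].

Definition is_smooth A : Prop :=
  forall (j : idx A) v, dom j v -> smooth_at (dom j) v.

Definition finite_type A : Prop :=
  exists2 s : set (idx A), finite_set s &
    carrier A `<=` \bigcup_(j in s) (chart j @` dom j).

Definition universally_closed A : Prop :=
  forall B, prevariety B ->
    forall F, @aclosed (prod_atlas A B) F -> aclosed (snd @` F).

Definition is_proper A : Prop :=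
  [/\ separated A, finite_type A & universally_closed A].

End Atlas.

(* -------------------------------------------------------------------- *)
(** * Rooted trees                                                        *)

(* The vertices are numbered, as every finite tree is isomorphic to a tree on
   some 'I_n; [par v] is the endpoint of the unique edge going out of v, when
   v is not the root. *)
Record rtree := RTree {
  nvert : nat;
  root : 'I_nvert;
  par : 'I_nvert -> 'I_nvert;
  par_root : par root = root;
  par_reach : forall v, fconnect par v root
}.

Coercion vert (T : rtree) : finType := 'I_(nvert T).

Section Tree.
Variable T : rtree.
Implicit Types u v w : T.

Definition incoming v : {set T} := [set u | (u != root T) && (par u == v)]%SET.

Definition interior v : bool := incoming v != finset.set0.

Definition subtree v : {set T} := [set u | fconnect (@par T) u v]%SET.

(* The path [v, u], for u in [subtree v]. *)
Definition tpath v u : {set T} := [set w in subtree v | u \in subtree w]%SET.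

(* The first vertex after v on the path from v to u, for u in
   [subtree v :\ v]. *)
Definition first_step v u : T :=
  odflt u [pick w in incoming v | u \in subtree w].

Lemma subtree_anti u v : u \in subtree v -> v \in subtree u -> u = v.
Proof.
rewrite !inE => /iter_findex uv /iter_findex vu.
have iter_root n : iter n (@par T) (root T) = root T.
  by elim: n => //= n ->; apply: par_root.
have /iter_findex := par_reach u; set N := findex (@par T) u (root T) => uN.
move: uv vu; set a := findex (@par T) u v.
set b := findex (@par T) v u => uv vu.
have [ab0|ab_gt0] := posnP (b + a).
  by move: ab0 uv => /eqP; rewrite addn_eq0 => /andP[_ /eqP->].
have period k : iter (k * (b + a)) (@par T) u = u.
  by elim: k => // k IHk; rewrite mulSn iterD IHk iterD uv vu.
have u_root : u = root T.
  rewrite -(period N) -(@subnK N (N * (b + a))) ?leq_pmulr // iterD uN.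
  exact: iter_root.
by rewrite -uv u_root iter_root.
Qed.

End Tree.

(* Contraction of the outgoing edges of the vertices where [keep] fails. *)
Section Contraction.
Variables (T : rtree) (keep : pred T) (keep_root : keep (root T)).

Definition contr_incoming (v : T) : {set T} :=
  [set u in subtree v :\ v | keep u &
     [forall w in tpath v u :\ v :\ u, ~~ keep w]]%SET.

(* The vertices of the contraction are those in [keep]; [enum_val] maps them
   to T. *)
Definition contr_root : 'I_#|keep| := enum_rank_in keep_root (root T).

Definition contr_par (u : 'I_#|keep|) : 'I_#|keep| :=
  odflt contr_root [pick v | enum_val u \in contr_incoming (enum_val v)].

Fact contr_par_root : contr_par contr_root = contr_root.
Proof.
rewrite /contr_par; case: pickP => //= v.
rewrite enum_rankK_in // !inE => /andP[/andP[neq rv]].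
by case/eqP: neq; apply: subtree_anti; rewrite inE // par_reach.
Qed.

Fact contr_par_reach v : fconnect contr_par v contr_root.
Proof.
pose anc (u : T) := [set w | u \in subtree w]%SET.
have [n] := ubnP #|anc (enum_val v)|; elim: n v => // n IHn v.
rewrite ltnS => anc_n; apply: connect_trans (fconnect1 _ v) _.
rewrite /contr_par; case: pickP => [w|_] /=; last exact: connect0.
rewrite !inE => /andP[/andP[neq vw] _]; apply: IHn; apply: leq_trans anc_n.
apply: proper_card; apply/properP; split.
  by apply/fintype.subsetP=> z; rewrite !inE; apply: connect_trans.
exists (enum_val v); rewrite !inE ?connect0 //; apply: contraNN neq => wv.
by apply/eqP; apply: subtree_anti; rewrite inE.
Qed.

Definition contraction : rtree := RTree contr_par_root contr_par_reach.

End Contraction.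

(* A rooted tree with r vertices labeled; [stable_tree] requires that the
   labels enumerate the leaves. *)
Record ltree (r : nat) := LTree {
  tree :> rtree;
  lab : 'I_r -> tree
}.

Definition stable_tree (r : nat) (T : ltree r) : Prop :=
  [/\ injective (@lab r T),
      forall v : T, ~~ interior v <-> exists i, lab T i = v
    & forall v : T, interior v -> (2 <= #|incoming v|)%N].

Record sliced_tree (r : nat) := SlicedTree {
  stree :> ltree r;
  stree_stable : stable_tree stree;
  s0 : stree -> stree;
  s1 : stree -> stree;
  s0_in : forall v, interior v -> s0 v \in incoming v;
  s1_in : forall v, interior v -> s1 v \in incoming v;
  s0_s1 : forall v, interior v -> s0 v != s1 v
}.

(* -------------------------------------------------------------------- *)
(** * Stable curves and the local models                                  *)

Section Moduli.
Variables (K : closedFieldType) (r : nat).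

(* Only the values [marking v u] with u in [incoming v] are meaningful. *)
Record curve := Curve {
  ctree : ltree r;
  marking : ctree -> ctree -> K
}.

Definition stable_curve (c : curve) : Prop :=
  stable_tree (ctree c) /\
  forall v : ctree c, {in incoming v &, injective (marking v)}.

Definition curve_iso (c d : curve) : Prop :=
  exists f : ctree c -> ctree d,
    [/\ bijective f,
        f (root (ctree c)) = root (ctree d),
        forall v, f (par v) = par (f v),
        forall i, f (lab (ctree c) i) = lab (ctree d) i
      & forall v, interior v -> exists a b : K, a != 0 /\
          {in incoming v, forall u, marking (f v) (f u) = a * marking v u + b}].

Definition iso_class (c : curve) : set curve := [set d | curve_iso c d].

Definition Mbar_points : set (set curve) := iso_class @` stable_curve.

Section LocalModel.
Variable T : sliced_tree r.
Implicit Types u v w : T.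

Definition is_xcoord (e : T * T) : bool :=
  interior e.1 && (e.2 \in incoming e.1 :\ s0 e.1 :\ s1 e.1).

Definition is_bcoord (v : T) : bool := interior v && (v != root T).

Definition mcoord : finType :=
  ({e : T * T | is_xcoord e} + {v : T | is_bcoord v})%type.

Local Notation poly := {mpoly K[#|mcoord|]}.

(* [bpoly v] is the coordinate b_v; its value 1 when v is the root or a leaf
   does not matter. *)
Definition bpoly (v : T) : poly :=
  if insub v is Some c then coordX K (inr c : mcoord) else 1.

(* The value of \tilde x_{v u} for u in [incoming v]. *)
Definition xedge (v u : T) : poly :=
  if u == s0 v then 0 else if u == s1 v then 1 else
  if insub (v, u) is Some c then coordX K (inl c : mcoord) else 0.

Definition xpoly (v u : T) : poly := xedge v (first_step v u).

Definition ppoly (v u : T) : poly :=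
  \sum_(w in (tpath v u :\ u)%SET)
    (xpoly w u * \prod_(z in (tpath v w :\ v)%SET) bpoly z).

Definition is_qpoly (i j : 'I_r) (q : poly) : Prop :=
  (exists a : T -> nat,
     ppoly (root T) (lab T i) - ppoly (root T) (lab T j)
       = q * \prod_(v | is_bcoord v) bpoly v ^+ a v) /\
  (forall v, is_bcoord v -> ~ exists g, q = bpoly v * g).

Definition qpoly (i j : 'I_r) : poly := xget 0 (is_qpoly i j).

Definition Yset : set (mcoord -> K) := [set y |
  (forall c, y (inl c) != 0 /\ y (inl c) != 1) /\
  (forall c d, (val c).1 = (val d).1 -> y (inl c) = y (inl d) -> c = d)].

Definition Xset : set (mcoord -> K) :=
  Yset `\` [set y | exists i j : 'I_r, (i < j)%N /\ peval (qpoly i j) y = 0].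

Section Chart.
Variable y : mcoord -> K.

(* The vertices of T', identified with vertices of T. *)
Definition kept (v : T) : bool :=
  [|| v == root T, ~~ interior v | peval (bpoly v) y == 0].

Fact kept_root : kept (root T). Proof. by rewrite /kept eqxx. Qed.

Fact kept_lab i : kept (lab T i).
Proof.
have [_ leafP _] := stree_stable T.
by rewrite /kept ((leafP _).2 (ex_intro _ i erefl)) orbT.
Qed.

Definition chart_tree : ltree r :=
  @LTree r (contraction kept_root)
    (fun i => enum_rank_in (kept_lab i) (lab T i)).

Definition chart_curve : curve :=
  @Curve chart_tree (fun v u : 'I_#|kept| =>
     peval (ppoly (enum_val v) (enum_val u)) y).

End Chart.

Definition phi (y : mcoord -> K) : set curve := iso_class (chart_curve y).

End LocalModel.

Definition Mbar : atlas K :=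
  @Atlas K (set curve) Mbar_points (sliced_tree r) mcoord Xset phi.

End Moduli.

(* Main.v *)
From mathcomp Require Import all_boot all_order all_algebra complex reals.
From mathcomp Require Import boolp classical_sets cardinality.
From mathcomp Require Import mpoly.
From mathcomp Require Import ring zify.
Require Import Defs.

(* A stable curve is determined by its coordinates f_jk(i) in the projective line:
   the position of the leaf i in the affine coordinate of the component separating
   the leaves j and k which puts j at 0 and k at 1, infinity if i is not above this
   component. The possible f are described by identities closed under passing to
   limits ([admissible]): the sets of leaves where f_jk is finite are nested or
   disjoint, and form the tree of the curve. A curve lies in the chart of T iff its
   tree is a contraction of T. There all f_jk(i) are quotients of polynomials in
   the chart coordinates, and conversely, if l(u) is the leaf reached from u along
   the slice s_0, then x_vu = f_jk(l(u)) and b_v = f_jk(l(s_1 v)) - f_jk(l(v)), with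
   j = l(w) and k = l(s_1 w) for w = v, resp. w the endpoint of the edge going out
   of v. So the transition maps are regular and the diagonal is closed.

   For universal closedness let b lie in the closure of the image of a closed
   set F. Chevalley's argument extends the evaluation at b to a place of the
   functions on F, here a maximal [specialization] given by Zorn's lemma. The
   limits of the f_jk(i) along it are admissible, hence define a curve m, and
   (m, b) is in F because F is closed in a chart around it. *)

Set Implicit Arguments.
Unset Strict Implicit.
Unset Printing Implicit Defensive.

Import GRing.Theory.

Local Open Scope ring_scope.
Local Open Scope classical_set_scope.

(** The functions on F are all maps from the points of F over a chart to K, a ring full of zero
    divisors, so the place cannot be a valuation ring of a function field. A maximal specialization
    amounts instead to an ultrafilter on these points together with a valuation ring, with residue
    field K, of the ultrapower of K: indicator functions get the value 0 or 1, and the residue field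
    does not grow because K is algebraically closed. Inverses are taken pointwise with 0^-1 = 0,
    which is why zero loci are split off in several places. The identities for the f_jk(i) must
    survive limits such as 0/0 or infinity. They are therefore equalities in the projective line,
    asserted only when numerator and denominator are not both 0, and two separate conditions govern
    the leaves at infinity. Characteristic 0 enters through the pairwise distinct points 0, 1, 2,
    ... of K. They give generic points on lines, a maximally degenerate curve in each chart and a
    smooth curve. *)

Lemma natr_inj (R : idomainType) : [pchar R] =i pred0 ->
  forall a b : nat, a%:R = b%:R :> R -> a = b.
Proof.
move=> char0 a b /eqP; wlog ab : a b / (a <= b)%N.
  by move=> W; case/orP: (leq_total a b) => ?; [|rewrite eq_sym => ?; symmetry];
     apply: W.
rewrite eq_sym -subr_eq0 -natrB // ((pcharf0P R).1 char0) subn_eq0 => ba.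
by apply/eqP; rewrite eqn_leq ab ba.
Qed.

(** * Zariski topology and regular functions *)

Section FunctionAlgebras.
Variable K : closedFieldType.

Definition fun_alg (X : Type) (S : set (X -> K)) : Prop :=
  [/\ forall c, S (fun=> c),
      forall f g, S f -> S g -> S (fun x => f x + g x)
    & forall f g, S f -> S g -> S (fun x => f x * g x)].

Lemma fun_algB X (S : set (X -> K)) f g :
  fun_alg S -> S f -> S g -> S (fun x => f x - g x).
Proof.
move=> [SC SD SM] Sf Sg.
rewrite (_ : (fun x => _) = (fun x => f x + (fun y => (-1) * g y) x)).
  by apply: SD => //; apply: (SM (fun=> -1)).
by apply: funext => x; rewrite mulN1r.
Qed.

(** A single induction on P serves three algebras: functions regular at a point, polynomial
    functions of a parameter on a line, and functions paired with their value under a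
    specialization. *)
Lemma fun_alg_peval (I : finType) (P : {mpoly K[#|I|]}) X (t : X -> I -> K)
    (S : set (X -> K)) :
  fun_alg S -> (forall i, S (fun x => t x i)) -> S (fun x => peval P (t x)).
Proof.
move=> [SC SD SM] St.
have Sprod (J : Type) (s : seq J) (F : J -> X -> K) : (forall j, S (F j)) ->
    S (fun x => \prod_(j <- s) F j x).
  move=> SF; elim: s => [|a s IHs].
    by rewrite (_ : (fun x => _) = fun=> 1) // funeqE => x; rewrite big_nil.
  rewrite (_ : (fun x => _) = fun x => F a x * \prod_(j <- s) F j x).
    exact: SM.
  by rewrite funeqE => x; rewrite big_cons.
have SX n (f : X -> K) : S f -> S (fun x => f x ^+ n).
  move=> Sf; elim: n => [|n IHn].
    by rewrite (_ : (fun x => _) = fun=> 1) // funeqE => x; rewrite expr0.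
  rewrite (_ : (fun x => _) = fun x => f x * f x ^+ n); first exact: SM.
  by rewrite funeqE => x; rewrite exprS.
rewrite (_ : (fun x => _) = fun x => \sum_(m <- msupp P)
    P@_m * \prod_(k <- enum 'I_#|I|) t x (enum_val k) ^+ m k); last first.
  rewrite funeqE => x; rewrite /peval mevalE; apply: eq_bigr => m _.
  by rewrite -big_enum.
elim: (msupp P) => [|m s IHs].
  by rewrite (_ : (fun x => _) = fun=> 0) // funeqE => x; rewrite big_nil.
rewrite (_ : (fun x => _) = fun x =>
  P@_m * \prod_(k <- enum 'I_#|I|) t x (enum_val k) ^+ m k +
  \sum_(m <- s) P@_m * \prod_(k <- enum 'I_#|I|) t x (enum_val k) ^+ m k).
  apply: SD => //; apply: SM => //.
  by apply: Sprod => k; apply: SX.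
by rewrite funeqE => x; rewrite big_cons.
Qed.

End FunctionAlgebras.

Section ZariskiTopology.
Variable K : closedFieldType.
Implicit Types I J : finType.

Lemma peval_coordX I (i : I) (v : I -> K) : peval (coordX K i) v = v i.
Proof. by rewrite /peval /coordX mevalXU enum_rankK. Qed.

Lemma pevalC I c (v : I -> K) : peval c%:MP v = c.
Proof. by rewrite /peval mevalC. Qed.

Lemma peval0 I (v : I -> K) : peval 0 v = 0.
Proof. by rewrite /peval raddf0. Qed.

Lemma peval1 I (v : I -> K) : peval 1 v = 1.
Proof. by rewrite /peval rmorph1. Qed.

Lemma pevalD I P Q (v : I -> K) : peval (P + Q) v = peval P v + peval Q v.
Proof. by rewrite /peval mevalD. Qed.

Lemma pevalB I P Q (v : I -> K) : peval (P - Q) v = peval P v - peval Q v.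
Proof. by rewrite /peval mevalB. Qed.

Lemma pevalM I P Q (v : I -> K) : peval (P * Q) v = peval P v * peval Q v.
Proof. by rewrite /peval mevalM. Qed.

Lemma peval_prod I (T : Type) (s : seq T) (p : pred T) F (v : I -> K) :
  peval (\prod_(i <- s | p i) F i) v = \prod_(i <- s | p i) peval (F i) v.
Proof. exact: (rmorph_prod (meval (fun k => v (enum_val k)))). Qed.

(* [A] contains a neighbourhood of [v] in [X], when [v] is in [X]. *)
Definition znear I (X : set (I -> K)) (v : I -> K) (A : set (I -> K)) : Prop :=
  exists2 P, peval P v != 0 & forall w, X w -> peval P w != 0 -> A w.

Section Near.
Variables (I : finType) (X : set (I -> K)) (v : I -> K).

Lemma znearT (A : set (I -> K)) : (forall w, X w -> A w) -> znear X v A.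
Proof.
by move=> XA; exists 1 => [|w Xw _]; rewrite ?peval1 ?oner_neq0 //; apply: XA.
Qed.

Lemma znearS (A B : set (I -> K)) :
  znear X v A -> (forall w, X w -> A w -> B w) -> znear X v B.
Proof. by move=> [P Pv PA] AB; exists P => // w Xw Pw; apply: AB => //; apply: PA. Qed.

Lemma znearI (A B : set (I -> K)) :
  znear X v A -> znear X v B -> znear X v (fun w => A w /\ B w).
Proof.
move=> [P Pv PA] [Q Qv QB]; exists (P * Q); rewrite ?pevalM ?mulf_neq0 // => w Xw.
by rewrite pevalM mulf_eq0 negb_or => /andP[? ?]; split; [apply: PA|apply: QB].
Qed.

Lemma znear_forall (T : finType) (A : T -> set (I -> K)) :
  (forall t, znear X v (A t)) -> znear X v (fun w => forall t, A t w).
Proof.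
move=> nA.
have {}nA t : exists P : {mpoly K[#|I|]}, peval P v != 0 /\
    forall w, X w -> peval P w != 0 -> A t w.
  by have [P] := nA t; exists P.
have [P PA] := choice nA.
exists (\prod_t P t) => [|w Xw]; rewrite peval_prod.
  by apply/(@prodf_neq0 K) => t _; case: (PA t).
move/(@prodf_neq0 K) => Pw t.
by case: (PA t) => _; apply => //; apply: Pw.
Qed.

Lemma znear_implyb (b : bool) (A : set (I -> K)) :
  (b -> znear X v A) -> znear X v (fun w => b -> A w).
Proof.
case: b => [/(_ isT) nA|_]; last by exists 1 => //; rewrite peval1 oner_neq0.
by apply: (znearS nA).
Qed.

Lemma znear_neq0 P : peval P v != 0 -> znear X v (fun w => peval P w != 0).
Proof. by exists P. Qed.

End Near.

Lemma zopenP I (O : set (I -> K)) :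
  zopen O <-> forall v, O v -> znear setT v O.
Proof.
split=> [[S OS] v Ov|nO].
  have [P SP Pv] : exists2 P, S P & peval P v != 0.
    apply: contrapT => nP; suff : (~` O) v by apply.
    rewrite OS => P SP; apply/eqP/negPn/negP => Pv.
    by apply: nP; exists P.
  exists P => // w _ Pw; apply: contrapT => nOw.
  have : (~` O) w by []; rewrite OS => /(_ P SP) Pw0.
  by rewrite Pw0 eqxx in Pw.
exists [set P | forall w, peval P w != 0 -> O w].
rewrite predeqE => v; split=> [nOv P PO|vz Ov].
  by apply/eqP/negPn/negP => Pv; apply: nOv; apply: PO.
have [P Pv PO] := nO v Ov.
suff Pv0 : peval P v = 0 by rewrite Pv0 eqxx in Pv.
by apply: vz => w Pw; apply: PO.
Qed.

Lemma zopen_inP I (X U : set (I -> K)) :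
  zopen_in X U <-> (forall v, U v -> X v) /\ forall v, U v -> znear X v U.
Proof.
split=> [[O /zopenP nO ->]|[UX nU]].
  split=> [v []|v [Xv Ov]] //.
  have [P Pv PO] := nO v Ov; exists P => // w Xw Pw; split => //; exact: PO.
(* The union of all principal open sets of affine space whose trace on X lies in U. *)
exists [set v | exists P, peval P v != 0 /\ forall w, X w -> peval P w != 0 -> U w].
  apply/zopenP => v [P [Pv PU]]; exists P => // w _ Pw; exists P; split => //.
rewrite predeqE => v; split=> [Uv|[Xv [P [Pv PU]]]]; last exact: PU.
by split; [apply: UX|have [P ? ?] := nU v Uv; exists P].
Qed.

(** The neighbourhood is the nonvanishing locus of the denominator itself. Sums and products then
    only multiply denominators, and a smaller neighbourhood is obtained by multiplying P and Q by
    the same polynomial. *)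
Definition reg_at I (X : set (I -> K)) v (f : (I -> K) -> K) : Prop :=
  exists P Q, peval Q v != 0 /\
    forall w, X w -> peval Q w != 0 -> f w = peval P w / peval Q w.

Lemma reg_at_alg I (X : set (I -> K)) v : fun_alg (reg_at X v).
Proof.
split=> [c|f g [P [Q [Qv fE]]] [P' [Q' [Q'v gE]]]|f g [P [Q [Qv fE]]] [P' [Q' [Q'v gE]]]].
- exists c%:MP, 1; rewrite peval1 oner_neq0; split=> // w _ _.
  by rewrite pevalC peval1 divr1.
- exists (P * Q' + P' * Q), (Q * Q'); rewrite pevalM mulf_neq0 //; split=> // w Xw.
  rewrite !pevalM mulf_eq0 negb_or => /andP[Qw Q'w].
  by rewrite fE // gE // pevalD !pevalM addf_div.
- exists (P * P'), (Q * Q'); rewrite pevalM mulf_neq0 //; split=> // w Xw.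
  rewrite !pevalM mulf_eq0 negb_or => /andP[Qw Q'w].
  by rewrite fE // gE // mulf_div.
Qed.

Lemma reg_at_peval I (X : set (I -> K)) v P : reg_at X v (peval P).
Proof.
exists P, 1; rewrite peval1 oner_neq0; split=> // w _ _.
by rewrite peval1 divr1.
Qed.

Lemma reg_at_eq I (X : set (I -> K)) v f g :
  znear X v (fun w => f w = g w) -> reg_at X v f -> reg_at X v g.
Proof.
move=> [R Rv fg] [P [Q [Qv fE]]]; exists (P * R), (Q * R).
rewrite pevalM mulf_neq0 //; split=> // w Xw.
rewrite !pevalM mulf_eq0 negb_or => /andP[Qw Rw].
by rewrite -fg // fE // -mulf_div divff // mulr1.
Qed.

Lemma reg_at_frac I (X : set (I -> K)) v P Q : peval Q v != 0 ->
  reg_at X v (fun w => peval P w / peval Q w).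
Proof. by move=> Qv; exists P, Q. Qed.

Lemma reg_at_sub I (X Y : set (I -> K)) v f : (forall w, X w -> Y w) ->
  reg_at Y v f -> reg_at X v f.
Proof. by move=> XY [P [Q [Qv fE]]]; exists P, Q; split=> // w /XY; apply: fE. Qed.

Lemma reg_at_neq0 I (X : set (I -> K)) v f : X v -> reg_at X v f -> f v != 0 ->
  znear X v (fun w => f w != 0).
Proof.
move=> Xv [P [Q [Qv fE]]]; rewrite fE // mulf_eq0 negb_or => /andP[Pv _].
exists (P * Q); rewrite ?pevalM ?mulf_neq0 // => w Xw.
rewrite pevalM mulf_eq0 negb_or => /andP[Pw Qw].
by rewrite fE // mulf_neq0 // invr_eq0.
Qed.

(** Continuity of regular maps; it carries neighbourhoods through transition maps, which reach the
    target Y only near v. *)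
Lemma reg_at_comp_near I J (X : set (I -> K)) v (t : (I -> K) -> J -> K)
    (Y : set (J -> K)) (B : set (J -> K)) : X v ->
  (forall j, reg_at X v (fun w => t w j)) ->
  znear X v (fun w => Y (t w)) -> znear Y (t v) B ->
  znear X v (fun w => B (t w)).
Proof.
move=> Xv rt nY [P Pv PB].
have rP : reg_at X v (fun w => peval P (t w)).
  exact: fun_alg_peval (reg_at_alg X v) rt.
apply: znearS (znearI nY (reg_at_neq0 Xv rP Pv)) _ => w _ [Yw Pw].
exact: PB.
Qed.

Lemma reg_at_regular_fun I (D : set (I -> K)) f :
  (forall v, D v -> reg_at D v f) -> regular_fun D f.
Proof.
move=> rf v Dv; have [P [Q [Qv fE]]] := rf v Dv.
exists [set w | peval Q w != 0], P, Q; split=> //; last by move=> w Dw Qw; rewrite -fE.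
by apply/zopenP => w; apply: znear_neq0.
Qed.

(* Two nonempty open subsets of affine space meet already on the line through
   a point of each. *)
Lemma znear_meet I (v w : I -> K) (A B : set (I -> K)) : [pchar K] =i pred0 ->
  znear setT v A -> znear setT w B -> exists u, A u /\ B u.
Proof.
move=> char0 [P Pv PA] [Q Qw QB].
pose L (t : K) i := (1 - t) * v i + t * w i.
have poly_alg : fun_alg [set f : K -> K | exists p : {poly K}, forall t, f t = p.[t]].
  split=> [c|f g [p fE] [q gE]|f g [p fE] [q gE]].
  - by exists c%:P => t; rewrite hornerC.
  - by exists (p + q) => t; rewrite hornerD fE gE.
  - by exists (p * q) => t; rewrite hornerM fE gE.
have polyL R : exists p : {poly K}, forall t, peval R (L t) = p.[t].
  apply: (fun_alg_peval R (t := L) poly_alg) => i.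
  exists ((v i)%:P + (w i - v i) *: 'X) => t.
  by rewrite hornerD hornerZ hornerC hornerX /L; ring.
have [p pE] := polyL P; have [q qE] := polyL Q.
have pq0 : p * q != 0.
  rewrite mulf_eq0; apply/norP; split.
    apply: contraNneq Pv => p0; have := pE 0; rewrite p0 horner0 => <-.
    by apply/eqP; congr peval; apply: funext => i; rewrite /L; ring.
  apply: contraNneq Qw => q0; have := qE 1; rewrite q0 horner0 => <-.
  by apply/eqP; congr peval; apply: funext => i; rewrite /L; ring.
(* In characteristic 0 the values n below the size of p * q are more distinct points than this
   nonzero polynomial has roots. *)
have [n pqn] : exists n, (p * q).[n%:R] != 0.
  apply: contrapT => nroot.
  pose s := [seq n%:R : K | n <- iota 0 (size (p * q))].
  have := @max_poly_roots _ (p * q) s pq0.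
  rewrite size_map size_iota ltnn; suff -> : all (poly.root (p * q)) s.
    suff -> : uniq s by move=> /(_ isT isT).
    by rewrite map_inj_uniq ?iota_uniq //; apply: natr_inj.
  apply/allP => x /mapP[n _ ->]; apply/eqP/eqP/negPn/negP => pn.
  by apply: nroot; exists n.
move: pqn; rewrite hornerM -pE -qE mulf_eq0 negb_or => /andP[Pn Qn].
by exists (L n%:R); split; [apply: PA|apply: QB].
Qed.

End ZariskiTopology.

(** * Maximal specializations *)

Section Specializations.
Variables (K : closedFieldType) (W : Type).
Implicit Types (H : set ((W -> K) * K)) (f g h u x : W -> K).

(* [H (f, a)] reads: the function f takes the value a at an ideal point. *)
Definition specialization H : Prop :=
  [/\ forall c, H (fun=> c, c),
      forall f g a b, H (f, a) -> H (g, b) -> H (fun w => f w + g w, a + b),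
      forall f g a b, H (f, a) -> H (g, b) -> H (fun w => f w * g w, a * b)
    & forall a, H (fun=> 0, a) -> a = 0].

Definition max_specialization H : Prop :=
  specialization H /\ forall H', specialization H' -> H `<=` H' -> H' `<=` H.

Lemma specialization_max H0 : specialization H0 ->
  exists H, max_specialization H /\ H0 `<=` H.
Proof.
move=> sH0.
pose P H := H = set0 \/ (H0 `<=` H /\ specialization H).
have [|H [PH Hmax]] := @Zorn_bigcup _ P.
  move=> F FP Ftot.
  have [[X0 FX0 X00]|Fempty] := pselect (exists2 X, F X & X !=set0); last first.
    left; rewrite -subset0 => z [X FX Xz]; apply: Fempty.
    by exists X => //; exists z.
  have FX X : F X -> X !=set0 -> H0 `<=` X /\ specialization X.
    by move=> /FP[->|] // [z []].
  have [H0X0 _] := FX _ FX0 X00.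
  right; split; first by move=> z /H0X0; exists X0.
  have dir z1 z2 : (\bigcup_(X in F) X) z1 -> (\bigcup_(X in F) X) z2 ->
      exists X, [/\ F X, specialization X, X z1 & X z2].
    move=> [X1 FX1 X1z] [X2 FX2 X2z].
    have [_ s1] := FX _ FX1 (ex_intro _ _ X1z).
    have [_ s2] := FX _ FX2 (ex_intro _ _ X2z).
    by have [/(_ _ X1z) X2z1|/(_ _ X2z) X1z2] := Ftot _ _ FX1 FX2;
      [exists X2|exists X1].
  split=> [c|f g a b|f g a b|a].
  - by exists X0 => //; apply: H0X0; case: sH0.
  - move=> Uf Ug; have [X [FX' [_ XD _ _] Xf Xg]] := dir _ _ Uf Ug.
    by exists X => //; apply: XD.
  - move=> Uf Ug; have [X [FX' [_ _ XM _] Xf Xg]] := dir _ _ Uf Ug.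
    by exists X => //; apply: XM.
  - by move=> Fa; have [X [_ [_ _ _ X0a] Xa _]] := dir _ _ Fa Fa; apply: X0a.
have [H_empty|[H0H sH]] := PH.
  exfalso; apply: (Hmax H0); last by right; split.
  rewrite H_empty; split; first exact: sub0set.
  by case: sH0 => sC _ _ _ /(_ _ (sC 0)).
exists H; split=> //; split=> // H' sH' HH'.
apply: contrapT => nH'H; apply: (Hmax H'); first by split.
by right; split=> // z /H0H; apply: HH'.
Qed.

Section Maximal.
Variable H : set ((W -> K) * K).
Hypothesis maxH : max_specialization H.

Lemma spec_cst c : H (fun=> c, c).
Proof. by case: maxH => -[]. Qed.

Let spC : forall c, H (fun=> c, c) := spec_cst.

Lemma specD f g a b : H (f, a) -> H (g, b) -> H (fun w => f w + g w, a + b).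
Proof. by case: maxH => -[_ sD _ _] _; apply: sD. Qed.

Lemma specM f g a b : H (f, a) -> H (g, b) -> H (fun w => f w * g w, a * b).
Proof. by case: maxH => -[_ _ sM _] _; apply: sM. Qed.

Lemma spec_zero a : H (fun=> 0, a) -> a = 0.
Proof. by case: maxH => -[_ _ _ s0] _; apply: s0. Qed.

Lemma specN f a : H (f, a) -> H (fun w => - f w, - a).
Proof.
move=> Hf; rewrite -mulN1r (_ : (fun w => _) = fun w => -1 * f w).
  by apply: specM.
by apply: funext => w; rewrite mulN1r.
Qed.

Lemma specB f g a b : H (f, a) -> H (g, b) -> H (fun w => f w - g w, a - b).
Proof. by move=> Hf /specN; apply: specD. Qed.

Lemma spec_sum (n : nat) (F : nat -> W -> K) (c : nat -> K) :
  (forall i, (i < n)%N -> H (F i, c i)) ->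
  H (fun w => \sum_(i < n) F i w, \sum_(i < n) c i).
Proof.
elim: n => [|n IHn] HF.
  rewrite big_ord0 (_ : (fun w => _) = fun=> 0) //.
  by apply: funext => w; rewrite big_ord0.
rewrite big_ord_recr (_ : (fun w => _) = fun w => \sum_(i < n) F i w + F n w).
  by apply: specD; [apply: IHn => i /ltnW; apply: HF|apply: HF].
by apply: funext => w; rewrite big_ord_recr.
Qed.

(** Localizing H at the functions of nonzero value gives a specialization again, so by maximality
    nothing new is added. *)
Lemma spec_localize f g a b : a != 0 -> H (f, a) ->
  H (fun w => f w * g w, a * b) -> H (g, b).
Proof.
move=> a0 Hf Hfg.
pose H' : set ((W -> K) * K) := [set z | exists h c,
  [/\ c != 0, H (h, c) & H (fun w => h w * z.1 w, c * z.2)]].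
have [_ Hmax] := maxH; apply: (Hmax H'); last by exists f, a.
  split=> [c|f1 f2 c d|f1 f2 c d|c].
  - exists (fun=> 1), 1.
    by split; [apply: oner_neq0|apply: spec_cst|apply: specM; apply: spec_cst].
  - move=> [h [e [e0 Hh /= Hhf]]] [k [s [s0 Hk /= Hkf]]].
    exists (fun w => h w * k w), (e * s); rewrite mulf_neq0 //.
    split=> //=; first exact: specM.
    have := specD (specM Hk Hhf) (specM Hh Hkf).
    by congr H; congr pair; [apply: funext => w|]; ring.
  - move=> [h [e [e0 Hh /= Hhf]]] [k [s [s0 Hk /= Hkf]]].
    exists (fun w => h w * k w), (e * s); rewrite mulf_neq0 //.
    split=> //=; first exact: specM.
    have := specM Hhf Hkf.
    by congr H; congr pair; [apply: funext => w|]; ring.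
  - move=> [h [e [e0 Hh /=]]].
    rewrite (_ : (fun w => _) = fun=> 0); last by apply: funext => w; rewrite mulr0.
    by move=> /spec_zero /eqP; rewrite mulf_eq0 (negPf e0) => /eqP.
move=> [h c] Hh; exists (fun=> 1), 1; rewrite oner_neq0; split=> //.
exact: specM.
Qed.

(* Families of polynomials with coefficients in the ring of specializable
   functions, together with their specialization. *)
Let Hpoly (q : W -> {poly K}) (p : {poly K}) : Prop :=
  (exists n, forall w, size (q w) <= n)%N /\ forall i, H (fun w => (q w)`_i, p`_i).

Let HpolyD q p q' p' : Hpoly q p -> Hpoly q' p' ->
  Hpoly (fun w => q w + q' w) (p + p').
Proof.
move=> [[n qn] Hq] [[n' qn'] Hq']; split.
  exists (maxn n n') => w; apply: leq_trans (size_polyD _ _) _.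
  by rewrite geq_max !leq_max qn qn' orbT.
move=> i; have := specD (Hq i) (Hq' i).
by congr H; congr pair; [apply: funext => w|]; rewrite coefD.
Qed.

Let HpolyM q p q' p' : Hpoly q p -> Hpoly q' p' ->
  Hpoly (fun w => q w * q' w) (p * p').
Proof.
move=> [[n qn] Hq] [[n' qn'] Hq']; split.
  exists (n + n')%N => w; apply: leq_trans (size_polyMleq _ _) _.
  by apply: leq_trans (leq_pred _) _; apply: leq_add.
move=> i; rewrite coefM (_ : (fun w => _) =
    fun w => \sum_(j < i.+1) (q w)`_j * (q' w)`_(i - j)); last first.
  by apply: funext => w; rewrite coefM.
apply: (@spec_sum i.+1 (fun j w => (q w)`_j * (q' w)`_(i - j))
  (fun j => p`_j * p'`_(i - j))) => j _.
exact: specM.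
Qed.

Let HpolyC p : Hpoly (fun=> p) p.
Proof. by split; [exists (size p)|move=> i; apply: spec_cst]. Qed.

Let HpolyCf f a : H (f, a) -> Hpoly (fun w => (f w)%:P) a%:P.
Proof.
move=> Hf; split; first by exists 1%N => w; apply: size_polyC_leq1.
move=> i; rewrite coefC (_ : (fun w => _) = fun w => if i == 0%N then f w else 0).
  by case: (i == 0)%N => //.
by apply: funext => w; rewrite coefC.
Qed.

(** The relations of x over the specializable functions, reduced to K: an ideal of K[X] whose common
    zeros are the candidates for the value of x. *)
Let rels x : set {poly K} :=
  [set p | exists q, Hpoly q p /\ forall w, (q w).[x w] = 0].

Let rels_lin x p p' s s' : rels x p -> rels x p' -> rels x (s * p + s' * p').
Proof.
move=> [q [Hq q0]] [q' [Hq' q'0]].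
exists (fun w => s * q w + s' * q' w); split.
  by apply: HpolyD; apply: HpolyM.
by move=> w; rewrite hornerD !hornerM q0 q'0 !mulr0 addr0.
Qed.

(** Extending H to the polynomials in x by sending x to a is consistent because the reduced
    relations vanish at a; maximality then puts the pair (x, a) in H. *)
Let rels_adjoin x a : (forall p, rels x p -> p.[a] = 0) -> H (x, a).
Proof.
move=> Ja.
pose H' : set ((W -> K) * K) := [set z | exists q p,
  [/\ Hpoly q p, z.1 = (fun w => (q w).[x w]) & z.2 = p.[a]]].
have [_ Hmax] := maxH; apply: (Hmax H'); last first.
- exists (fun=> 'X), 'X; rewrite hornerX; split=> //=.
  by apply: funext => w; rewrite hornerX.
- move=> [f b] Hf; exists (fun w => (f w)%:P), b%:P; rewrite hornerC; split=> //=.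
    exact: HpolyCf.
  by apply: funext => w; rewrite hornerC.
split=> [c|f g b c|f g b c|b].
- exists (fun=> c%:P), c%:P; rewrite hornerC; split=> //=.
  by apply: funext => w; rewrite hornerC.
- move=> [q [p [Hq /= -> ->]]] [q' [p' [Hq' /= -> ->]]].
  exists (fun w => q w + q' w), (p + p'); rewrite hornerD; split=> //=.
    exact: HpolyD.
  by apply: funext => w; rewrite hornerD.
- move=> [q [p [Hq /= -> ->]]] [q' [p' [Hq' /= -> ->]]].
  exists (fun w => q w * q' w), (p * p'); rewrite hornerM; split=> //=.
    exact: HpolyM.
  by apply: funext => w; rewrite hornerM.
move=> [q [p [Hq /= q0 ->]]]; apply: Ja; exists q; split=> // w.
by have <- := congr1 (fun f => f w) q0.
Qed.

(** The Nullstellensatz in one variable, by Euclidean division: a nonconstant p in the ideal has a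
    root a, some p' in the ideal does not vanish at a, and the remainder of p' modulo p is a smaller
    nonzero element. *)
Let rels_unit x : (forall a, ~ H (x, a)) -> rels x 1.
Proof.
move=> nH.
have nroot a : exists2 p, rels x p & p.[a] != 0.
  apply: contrapT => nex; apply: (nH a); apply: rels_adjoin => p px.
  by apply/eqP/negPn/negP => pa; apply: nex; exists p.
have [n [p []]] : exists n p, [/\ rels x p, p != 0 & size p = n].
  have [p px pa] := nroot 0; exists (size p), p; split=> //.
  by apply: contraNneq pa => ->; rewrite horner0.
elim/ltn_ind: n p => n IHn p px p0 pn.
have [s1|/closed_rootP[a pa]] := boolP (size p == 1%N).
  have /size_poly1P[c c0 pE] := s1.
  rewrite (_ : 1 = c^-1%:P * p + 0 * p); first exact: rels_lin.
  by rewrite pE mul0r addr0 -polyCM mulVf.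
have [p' p'x p'a] := nroot a.
apply: (IHn (size (p' %% p)) _ (p' %% p)) => //.
- by rewrite -pn ltn_modp.
- rewrite (_ : p' %% p = 1 * p' + (- (p' %/ p)) * p); first exact: rels_lin.
  by rewrite {2}(divp_eq p' p); ring.
apply: contraNneq p'a => mod0; rewrite (divp_eq p' p) mod0 addr0 hornerM.
by move/eqP: pa => ->; rewrite mulr0.
Qed.

(* If both 1 + m_1 x + ... + m_n x^n = 0 with all m_i specializing to 0 and x is
   integral, then dividing one relation by the other lowers the degrees. *)
Let descent x N : forall n m q p q' p', (n + m <= N)%N ->
  Hpoly q p -> Hpoly q' p' ->
  (forall w, size (q w) <= n.+1)%N -> (forall w, size (q' w) <= m.+1)%N ->
  p`_0 != 0 -> (forall i, (0 < i)%N -> p`_i = 0) -> p'`_m != 0 ->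
  (forall w, x w != 0 -> (q w).[x w] = 0) ->
  (forall w, x w != 0 -> (q' w).[x w] = 0) ->
  exists u a, [/\ H (u, a), a != 0 & forall w, x w != 0 -> u w = 0].
Proof.
elim: N => [|N IHN] n m q p q' p' nmN Hq Hq' qn q'm p0 pi p'm qx q'x.
all: have [n0|n_gt0] := posnP n;
  [exists (fun w => (q w)`_0), p`_0; split=> //; [by case: Hq|
     move=> w /qx; rewrite (@horner_coef_wide _ 1%N) -?n0 //;
     by rewrite n0 big_ord1 expr0 mulr1]|].
all: have [m0|m_gt0] := posnP m;
  [exists (fun w => (q' w)`_0), p'`_0; split=> //; [by case: Hq'|by move: p'm; rewrite m0|
     move=> w /q'x; rewrite (@horner_coef_wide _ 1%N) -?m0 //;
     by rewrite m0 big_ord1 expr0 mulr1]|].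
  by move: nmN n_gt0; rewrite leqn0 addn_eq0 => /andP[/eqP->].
have Hc i : H (fun w => (q w)`_i, p`_i) by case: Hq.
have Hc' i : H (fun w => (q' w)`_i, p'`_i) by case: Hq'.
have [mn|nm] := leqP m n.
  (* The terms of degree n cancel. As n > 0 the coefficient of degree n in p is 0, so the new value
     is a nonzero multiple of p and keeps its shape. *)
  pose r w := ((q' w)`_m)%:P * q w - (((q w)`_n)%:P * 'X^(n - m)) * q' w.
  pose s := (p'`_m)%:P * p - ((p`_n)%:P * 'X^(n - m)) * p'.
  have Hr : Hpoly r s.
    rewrite /s -mulNr -mulNr -polyCN.
    rewrite (_ : r = fun w => ((q' w)`_m)%:P * q w +
        (- (q w)`_n)%:P * 'X^(n - m) * q' w); last first.
      by apply: funext => w; rewrite /r polyCN !mulNr.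
    apply: HpolyD; first by apply: HpolyM => //; apply: HpolyCf.
    apply: HpolyM => //; apply: HpolyM; last exact: HpolyC.
    by apply: HpolyCf; apply: specN.
  have sE : s = (p'`_m)%:P * p.
    by rewrite /s pi // polyC0 !mul0r subr0.
  apply: (IHN n.-1 m r s q' p') => //.
  - by move: nmN n_gt0; lia.
  - move=> w; rewrite prednK //; apply/leq_sizeP => j.
    rewrite leq_eqVlt => /predU1P[<-|nj].
      rewrite /r coefB coefCM -mulrA coefCM coefXnM ltnNge leq_subr /= subKn //.
      by ring.
    rewrite /r coefB coefCM -mulrA coefCM coefXnM.
    rewrite (nth_default _ (leq_trans (qn w) nj)) mulr0 sub0r.
    case: ifP => [|_]; first by rewrite mulr0 oppr0.
    rewrite [(q' w)`_ _]nth_default ?mulr0 ?oppr0 //; apply: leq_trans (q'm w) _.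
    by move: nj mn; lia.
  - by rewrite sE coefCM mulf_neq0.
  - by move=> i i0; rewrite sE coefCM pi // mulr0.
  - by move=> w xw; rewrite /r hornerD hornerN !hornerM qx // q'x // !mulr0 subr0.
(* For n < m the constant terms cancel and X is divided out, which is legitimate where x does not
   vanish. The top coefficient keeps a nonzero value because p has none in degree m. *)
pose r w := ((q w)`_0)%:P * q' w - ((q' w)`_0)%:P * q w.
pose s := (p`_0)%:P * p' - (p'`_0)%:P * p.
have Hr : Hpoly r s.
  rewrite /s -mulNr -polyCN.
  rewrite (_ : r = fun w => ((q w)`_0)%:P * q' w + (- (q' w)`_0)%:P * q w); last first.
    by apply: funext => w; rewrite /r polyCN !mulNr.
  by apply: HpolyD; apply: HpolyM => //; apply: HpolyCf => //; apply: specN.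
have rm w : (size (r w) <= m.+1)%N.
  apply: leq_trans (size_polyD _ _) _; rewrite size_polyN geq_max.
  rewrite !mul_polyC; apply/andP; split.
    by apply: leq_trans (size_scale_leq _ _) _.
  apply: leq_trans (size_scale_leq _ _) _.
  by apply: leq_trans (qn w) _; rewrite ltnS ltnW.
have r0 w : (r w)`_0 = 0 by rewrite /r coefB !coefCM mulrC subrr.
have rE w : r w = drop_poly 1 (r w) * 'X.
  rewrite -{1}(poly_take_drop 1 (r w)) expr1 [X in X + _](_ : _ = 0) ?add0r //.
  by apply/polyP => i; rewrite coef_take_poly coef0; case: i => [|i]; rewrite ?r0.
apply: (IHN n m.-1 q p (fun w => drop_poly 1 (r w)) (drop_poly 1 s)) => //.
- by move: nmN m_gt0; lia.
- split; first by exists m => w; rewrite size_drop_poly; move: (rm w); lia.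
  move=> i; rewrite coef_drop_poly (_ : (fun w => _) = fun w => (r w)`_(i + 1)).
    by case: Hr.
  by apply: funext => w; rewrite coef_drop_poly.
- by move=> w; rewrite size_drop_poly; move: (rm w); lia.
- rewrite coef_drop_poly addn1 prednK // /s coefB !coefCM. rewrite (pi m) // mulr0 subr0.
  by rewrite mulf_neq0.
move=> w xw; have : (r w).[x w] = 0.
  by rewrite /r hornerD hornerN !hornerM qx // q'x // !mulr0 subr0.
rewrite [in X in X -> _]rE hornerM hornerX => /eqP.
by rewrite mulf_eq0 (negPf xw) orbF => /eqP.
Qed.

(** The valuation property. If x takes no value, its reduced relations contain 1; if 1/x does not
    take the value 0, a reduced relation of 1/x is nonzero at 0, and its reversal is a relation of x
    whose leading coefficient has nonzero value. [descent] combines the two. *)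
Lemma spec_dichotomy x : (exists a, H (x, a)) \/ H (fun w => (x w)^-1, 0).
Proof.
have [|nH] := pselect (exists a, H (x, a)); first by left.
have [|nHV] := pselect (H (fun w => (x w)^-1, 0)); first by right.
have [q [Hq qx]] : rels x 1 by apply: rels_unit => a Ha; apply: nH; exists a.
have [p' [q' [Hq' q'x]] p'0] : exists2 p, rels (fun w => (x w)^-1) p & p.[0] != 0.
  apply: contrapT => nex; apply: nHV; apply: rels_adjoin => p px.
  by apply/eqP/negPn/negP => pa; apply: nex; exists p.
have [[n qn] Hc] := Hq; have [[m q'm] Hc'] := Hq'.
(* Reversal amounts to multiplying the relation of 1/x by the power m of x; the leading coefficient
   gets the value of p' at 0. Since 0^-1 = 0, the relation is only kept where x is nonzero. *)
pose r w := \poly_(i < m.+1) (q' w)`_(m - i).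
pose s := \poly_(i < m.+1) p'`_(m - i).
have Hr : Hpoly r s.
  split; first by exists m.+1 => w; apply: size_poly.
  move=> i; rewrite coef_poly (_ : (fun w => _) =
    fun w => if (i < m.+1)%N then (q' w)`_(m - i) else 0); first by case: ifP.
  by apply: funext => w; rewrite coef_poly.
have [u [a [Hu a0 ux]]] :
    exists u a, [/\ H (u, a), a != 0 & forall w, x w != 0 -> u w = 0].
  apply: (@descent x (n + m) n m q 1 r s _ Hq Hr) => //.
  - by move=> w; apply: leq_trans (qn w) _.
  - by move=> w; apply: size_poly.
  - by rewrite coefC oner_neq0.
  - by case=> // i _; rewrite coefC.
  - by rewrite coef_poly ltnSn subnn -horner_coef0.
  move=> w xw; apply/eqP; move/eqP: (q'x w).
    rewrite (@horner_coef_wide _ m.+1 (q' w)) ?(leq_trans (q'm w)) //.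
    rewrite horner_poly => /eqP q0.
    have: x w ^+ m * (\sum_(i < m.+1) (q' w)`_i * (x w)^-1 ^+ i) = 0 by rewrite q0 mulr0.
    move=> /eqP; congr (_ == 0); rewrite mulr_sumr (reindex_inj rev_ord_inj) /=.
    apply: eq_bigr => i _; rewrite subSS mulrCA; congr (_ * _).
    have im : (i <= m)%N by rewrite -ltnS.
    rewrite exprVn -{1}(subnK im) [in LHS]addnC exprD -mulrA divff ?mulr1 //.
    by rewrite expf_neq0.
(* The product of u and x vanishes identically while u has nonzero value, so x takes the value 0
   after all. *)
left; exists 0; apply: (spec_localize a0 Hu).
rewrite mulr0 (_ : (fun w => _) = fun=> 0) //; apply: funext => w.
by have [->|/ux->] := eqVneq (x w) 0; rewrite ?mulr0 ?mul0r.
Qed.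

End Maximal.
End Specializations.

(* The point [p : q] of the projective line, [None] being infinity. *)
Definition proj (K : closedFieldType) (p q : K) : option K :=
  if q == 0 then None else Some (p / q).

Lemma proj_fin (K : closedFieldType) (p q : K) : q != 0 -> proj p q = Some (p / q).
Proof. by move=> q0; rewrite /proj (negPf q0). Qed.

Lemma proj_inf (K : closedFieldType) (p : K) : proj p 0 = None.
Proof. by rewrite /proj eqxx. Qed.

Lemma proj_scale (K : closedFieldType) (c p q : K) : c != 0 ->
  proj (c * p) (c * q) = proj p q.
Proof.
move=> c0; rewrite /proj mulf_eq0 (negPf c0) /=; case: eqP => // _.
by rewrite -mulf_div divff // mul1r.
Qed.

(* [f j k] is the affine coordinate on the component separating the leaves
   j and k for which j is at 0 and k at 1; the leaves which are not above this
   component are at infinity. *)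
Record admissible (K : closedFieldType) (I : finType)
    (f : I -> I -> I -> option K) : Prop := Admissible {
  adm_diag : forall j i, f j j i = None;
  adm0 : forall j k, j != k -> f j k j = Some 0;
  adm1 : forall j k, j != k -> f j k k = Some 1;
  adm_proj : forall j k l m i a b c, l != m ->
    f j k l = Some a -> f j k m = Some b -> f j k i = Some c ->
    (c - a != 0) || (b - a != 0) -> f l m i = proj (c - a) (b - a);
  adm_inf : forall j k l m i a b, l != m ->
    f j k l = Some a -> f j k m = Some b -> f j k i = None -> f l m i = None;
  adm_flip : forall j k i, j != k -> j != i -> f j k i = None -> f j i k = Some 0
}.

(** * Limits in the projective line along a maximal specialization *)

Section Limits.
Variables (K : closedFieldType) (W : Type) (H : set ((W -> K) * K)).
Hypothesis maxH : max_specialization H.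
Implicit Types (f h u x : W -> K) (g : W -> option K) (S : set W).

(** The sets S that carry the ideal point, certified by a function of nonzero value that vanishes
    off S. They form an ultrafilter, by [almost_ex], [almostI] and [almost_dec]. *)
Definition almost S : Prop :=
  exists u a, [/\ H (u, a), a != 0 & forall w, u w != 0 -> S w].

Lemma almostT S : (forall w, S w) -> almost S.
Proof.
by move=> ST; exists (fun=> 1), 1; split; [apply: (spec_cst maxH)|apply: oner_neq0|].
Qed.

Lemma almostS S S' : almost S -> (forall w, S w -> S' w) -> almost S'.
Proof. by move=> [u [a [Hu a0 uS]]] SS'; exists u, a; split=> // w /uS /SS'. Qed.

Lemma almostI S S' : almost S -> almost S' -> almost (fun w => S w /\ S' w).
Proof.
move=> [u [a [Hu a0 uS]]] [u' [a' [Hu' a'0 uS']]].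
exists (fun w => u w * u' w), (a * a'); split; first exact: (specM maxH).
  exact: mulf_neq0.
by move=> w; rewrite mulf_eq0 negb_or => /andP[/uS ? /uS'].
Qed.

Lemma almost_forall (T : finType) (S : T -> set W) :
  (forall t, almost (S t)) -> almost (fun w => forall t, S t w).
Proof.
move=> aS.
have : almost (fun w => forall t, t \in enum T -> S t w).
  elim: (enum T) => [|t s IHs]; first exact: almostT.
  apply: almostS (almostI (aS t) IHs) _ => w [St Ss] t'.
  by rewrite inE => /predU1P[->|/Ss].
by move=> /almostS; apply=> w + t; apply; rewrite mem_enum.
Qed.

Lemma almost_ex S : almost S -> exists w, S w.
Proof.
move=> [u [a [Hu a0 uS]]]; apply: contrapT => nS; move/eqP: a0; apply.
apply: (spec_zero maxH); rewrite (_ : (fun=> 0) = u) //.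
apply: funext => w; apply/esym/eqP/negPn/negP => uw; apply: nS.
by exists w; apply: uS.
Qed.

Lemma almost_neq0 h a : H (h, a) -> a != 0 -> almost (fun w => h w != 0).
Proof. by move=> Hh a0; exists h, a. Qed.

Lemma spec_almost h h' a : H (h, a) -> almost (fun w => h w = h' w) -> H (h', a).
Proof.
move=> Hh [u [b [Hu b0 uE]]]; apply: (spec_localize maxH b0 Hu).
rewrite (_ : (fun w => _) = fun w => u w * h w); first exact: (specM maxH).
apply: funext => w; have [->|/uE->//] := eqVneq (u w) 0.
by rewrite !mul0r.
Qed.

Lemma spec_unique h a b : H (h, a) -> H (h, b) -> a = b.
Proof.
move=> Ha Hb; apply/eqP; rewrite -subr_eq0; apply/eqP; apply: (spec_zero maxH).
rewrite (_ : (fun=> 0) = fun w => h w - h w); first exact: (specB maxH).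
by apply: funext => w; rewrite subrr.
Qed.

Lemma specV h a : H (h, a) -> a != 0 -> H (fun w => (h w)^-1, a^-1).
Proof.
move=> Hh a0; apply: (spec_localize maxH a0 Hh); rewrite divff //.
apply: spec_almost (spec_cst maxH 1) _; apply: almostS (almost_neq0 Hh a0) _ => w hw.
by rewrite divff.
Qed.

Lemma spec_div f h a b : H (f, a) -> H (h, b) -> b != 0 ->
  H (fun w => f w / h w, a / b).
Proof. by move=> Hf Hg b0; apply: (specM maxH) => //; apply: specV. Qed.

(** The indicator function x of S is its own pointwise inverse, so both cases of the dichotomy give
    it a value. Then x or 1 - x is the certificate. *)
Lemma almost_dec S : almost S \/ almost (~` S).
Proof.
pose x w : K := if `[< S w >] then 1 else 0.
have xV : (fun w => (x w)^-1) = x.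
  by apply: funext => w; rewrite /x; case: ifP; rewrite ?invr1 ?invr0.
have [a Hx] : exists a, H (x, a).
  by have [//|] := spec_dichotomy maxH x; rewrite xV; exists 0.
have [a0|a0] := eqVneq a 0.
  have := specB maxH (spec_cst maxH 1) Hx; rewrite a0 subr0 => Hx1.
  right; apply: almostS (almost_neq0 Hx1 (oner_neq0 _)) _.
  by move=> w; rewrite /x; case: asboolP => //; rewrite subrr eqxx.
left; apply: almostS (almost_neq0 Hx a0) _ => w.
by rewrite /x; case: asboolP => //; rewrite eqxx.
Qed.

(** Near infinity the local coordinate is the inverse h, which vanishes exactly where g itself is
    infinite. *)
Definition spec_lim (g : W -> option K) (a : option K) : Prop :=
  match a with
  | Some c => exists2 h, H (h, c) & almost (fun w => g w = Some (h w))
  | None => exists2 h, H (h, 0) & almost (fun w => g w = proj 1 (h w))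
  end.

(** Completeness of the projective line, the source of properness. *)
Lemma spec_lim_ex g : exists a, spec_lim g a.
Proof.
pose x w := odflt 0 (g w).
have [gfin|ginf] := almost_dec (fun w => g w != None); last first.
  exists None; exists (fun=> 0); first exact: (spec_cst maxH).
  apply: almostS ginf _ => w gw; rewrite proj_inf; apply/eqP/negPn/negP; exact: gw.
have {}gfin : almost (fun w => g w = Some (x w)).
  by apply: almostS gfin _ => w; rewrite /x; case: (g w).
have [[a Hx]|HxV] := spec_dichotomy maxH x; first by exists (Some a), x.
(* That x^-1 tends to 0 may only reflect the convention 0^-1 = 0; the limit is then 0 and not
   infinity. *)
have [x0|xn0] := almost_dec (fun w => x w = 0).
  exists (Some 0), x => //; apply: spec_almost (spec_cst maxH 0) _.
  by apply: almostS x0 _.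
exists None; exists (fun w => (x w)^-1) => //.
apply: almostS (almostI gfin xn0) _ => w [-> /eqP xw].
by rewrite proj_fin ?invr_eq0 // invrK mul1r.
Qed.

Lemma spec_lim_unique g a b : spec_lim g a -> spec_lim g b -> a = b.
Proof.
have fin_inf c : spec_lim g (Some c) -> spec_lim g None -> False.
  move=> [h Hh gh] [h' Hh' gh'].
  have /eqP : 1 = c * 0 :> K.
    apply: (@spec_unique (fun=> 1)); first exact: (spec_cst maxH).
    apply: spec_almost (specM maxH Hh Hh') _.
    apply: almostS (almostI gh gh') _ => w [->]; rewrite /proj.
    by case: eqVneq => // h'w [->]; rewrite div1r mulVf.
  by rewrite mulr0 oner_eq0.
case: a b => [a|] [b|] //; last first.
- by move=> gN /fin_inf; case.
- by move=> /fin_inf gS /gS.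
move=> [h Hh gh] [h' Hh' gh']; congr Some; apply: (@spec_unique h') => //.
apply: (spec_almost Hh); apply: almostS (almostI gh gh') _ => w [->].
by case.
Qed.

Lemma spec_lim_cst g a : (forall w, g w = a) -> spec_lim g a.
Proof.
move=> gE; case: a gE => [c|] gE; [exists (fun=> c)|exists (fun=> 0)];
  (try exact: (spec_cst maxH)); apply: almostT => w; rewrite gE //.
by rewrite proj_inf.
Qed.

Lemma spec_lim_proj f h a b : H (f, a) -> H (h, b) ->
  (a != 0) || (b != 0) -> spec_lim (fun w => proj (f w) (h w)) (proj a b).
Proof.
move=> Hf Hg; have [b0|b0 _] := eqVneq b 0; last first.
  rewrite proj_fin //; exists (fun w => f w / h w); first exact: spec_div.
  by apply: almostS (almost_neq0 Hg b0) _ => w gw; rewrite proj_fin.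
rewrite orbF b0 proj_inf => a0; exists (fun w => h w / f w).
  by rewrite -(mul0r a^-1) -b0; apply: spec_div.
apply: almostS (almost_neq0 Hf a0) _ => w fw; rewrite /proj mulf_eq0 invr_eq0.
by rewrite (negPf fw) orbF; case: eqP => // _; rewrite invf_div mul1r.
Qed.

Lemma spec_lim_almost g g' a : spec_lim g a -> almost (fun w => g w = g' w) ->
  spec_lim g' a.
Proof.
by move=> + gg'; case: a => [c|] [h Hh gh]; exists h => //;
  apply: almostS (almostI gh gg') _ => w [<-].
Qed.

(** Each identity equates quotients whose numerator and denominator do not both tend to 0, so limits
    may be taken on both sides. A leaf whose limit is infinite may be at finite positions before the
    limit; these are handled through their inverse h. *)
Lemma spec_lim_admissible (I : finType) (F : W -> I -> I -> I -> option K)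
    (F0 : I -> I -> I -> option K) :
  (forall w, admissible (F w)) ->
  (forall j k i, spec_lim (fun w => F w j k i) (F0 j k i)) -> admissible F0.
Proof.
move=> admF limF.
have lim_eq j k i a : spec_lim (fun w => F w j k i) a -> F0 j k i = a.
  exact: spec_lim_unique.
split.
- by move=> j i; apply: lim_eq; apply: spec_lim_cst => w; apply: adm_diag.
- by move=> j k jk; apply: lim_eq; apply: spec_lim_cst => w; apply: adm0.
- by move=> j k jk; apply: lim_eq; apply: spec_lim_cst => w; apply: adm1.
- move=> j k l m i a b c lm Fl Fm Fi abc; apply: lim_eq.
  have := limF j k l; rewrite Fl => -[hl Hl El].
  have := limF j k m; rewrite Fm => -[hm Hm Em].
  have := limF j k i; rewrite Fi => -[hi Hi Ei].
  have Hil := specB maxH Hi Hl; have Hml := specB maxH Hm Hl.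
  apply: spec_lim_almost (spec_lim_proj Hil Hml abc) _.
  have : almost (fun w => (hi w - hl w != 0) || (hm w - hl w != 0)).
    by case/orP: abc => [/(almost_neq0 Hil)|/(almost_neq0 Hml)] /almostS;
      apply=> w ->; rewrite ?orbT.
  move=> E; apply: almostS (almostI E (almostI El (almostI Em Ei))) _.
  move=> w [E' [El' [Em' Ei']]]; symmetry.
  exact: (adm_proj (admF w) lm El' Em' Ei').
- move=> j k l m i a b lm Fl Fm Fi; apply: lim_eq.
  have := limF j k l; rewrite Fl => -[hl Hl El].
  have := limF j k m; rewrite Fm => -[hm Hm Em].
  have := limF j k i; rewrite Fi => -[h Hh Ei].
  (* With i at position 1/h, its position in the coordinate normalized by l and m is (1 - h hl) / (h
     (hm - hl)): the numerator tends to 1, the denominator to 0. *)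
  have H1 : H (fun w => 1 - h w * hl w, 1).
    have := specB maxH (spec_cst maxH 1) (specM maxH Hh Hl).
    by rewrite mul0r subr0.
  have H2 : H (fun w => h w * (hm w - hl w), 0).
    rewrite -(mul0r (b - a)); apply: (specM maxH) => //; exact: (specB maxH).
  have := spec_lim_proj H1 H2; rewrite oner_neq0 proj_inf => /(_ isT) lim.
  apply: spec_lim_almost lim _.
  have E := almost_neq0 H1 (oner_neq0 _).
  apply: almostS (almostI E (almostI El (almostI Em Ei))) _.
  move=> w [E' [El' [Em' Ei']]]; symmetry; move: Ei'.
  have [hw|hw] := eqVneq (h w) 0.
    rewrite hw proj_inf !mul0r proj_inf => Ei'.
    exact: (adm_inf (admF w) lm El' Em' Ei').
  rewrite proj_fin // => Ei'.
  have hE : 1 / h w - hl w = (1 - h w * hl w) / h w.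
    by rewrite mulrBl -mulrA mulrCA divff // mulr1.
  rewrite (adm_proj (admF w) lm El' Em' Ei').
    by rewrite hE -(proj_scale _ _ hw) mulrC divfK.
  by rewrite hE mulf_neq0 // invr_eq0.
(* Where f_jk(i) is the finite point 1/h, the position f_ji(k) is its inverse h; where it is
   infinite, both h and f_ji(k) are 0. *)
- move=> j k i jk ji Fi; apply: lim_eq.
  have := limF j k i; rewrite Fi => -[h Hh Ei]; exists h => //.
  apply: almostS Ei _ => w; rewrite /proj; case: eqVneq => [->|hw] Ei.
    exact: (adm_flip (admF w)).
  rewrite (adm_proj (admF w) ji (adm0 (admF w) jk) Ei (adm1 (admF w) jk)).
    by rewrite !subr0 proj_fin div1r ?invr_eq0 // mul1r invrK.
  by rewrite subr0 oner_neq0.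
Qed.

End Limits.

(** * Stable trees *)

Section RootedTrees.
Variable T : rtree.
Implicit Types u v w : T.

Lemma subtree_refl v : v \in subtree v.
Proof. by rewrite inE connect0. Qed.

Lemma subtree_trans v u w : u \in subtree v -> v \in subtree w -> u \in subtree w.
Proof. by rewrite !inE; apply: connect_trans. Qed.

Lemma subtree_root v : v \in subtree (root T).
Proof. by rewrite inE par_reach. Qed.

Lemma subtree_iterP u v :
  reflect (exists n, iter n (@par T) u = v) (u \in subtree v).
Proof.
rewrite inE; apply: (iffP idP) => [/iter_findex <-|[n <-]]; first by eexists.
exact: fconnect_iter.
Qed.

Lemma subtree_chain u v w : u \in subtree v -> u \in subtree w ->
  v \in subtree w \/ w \in subtree v.
Proof.
move=> /subtree_iterP[n <-] /subtree_iterP[m <-].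
case: (leqP n m) => [/subnK<-|/ltnW/subnK<-]; rewrite iterD; [left|right];
by apply/subtree_iterP; eexists.
Qed.

Lemma subtree_par u v : u \in subtree v -> u != v -> par u \in subtree v.
Proof.
move=> /subtree_iterP[[|n] /= <-]; first by rewrite eqxx.
by move=> _; apply/subtree_iterP; exists n; rewrite -iterSr.
Qed.

Lemma par_fix u : par u = u -> u = root T.
Proof.
move=> pu; have /subtree_iterP[n <-] := subtree_root u.
by elim: n => //= n <-.
Qed.

Lemma incomingP u v : reflect (u <> root T /\ par u = v) (u \in incoming v).
Proof. by rewrite inE; apply: (iffP andP) => -[/eqP ? /eqP]. Qed.

Lemma incoming_subtree u v : u \in incoming v -> u \in subtree v.
Proof. by move=> /incomingP[_ <-]; apply/subtree_iterP; exists 1%N. Qed.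

Lemma incoming_neq u v : u \in incoming v -> u != v.
Proof.
by move=> /incomingP[uroot uv]; apply/eqP => uv'; apply/uroot/par_fix; rewrite uv.
Qed.

Lemma incoming_notin u v : u \in incoming v -> v \notin subtree u.
Proof.
move=> uv; apply/negP => vu; have /eqP := incoming_neq uv; apply.
by apply: subtree_anti => //; apply: incoming_subtree.
Qed.

Lemma subtree_child u v : u \in subtree v -> u != v ->
  exists2 w, w \in incoming v & u \in subtree w.
Proof.
move=> /subtree_iterP[n]; elim: n u => [|n IHn] u /=; first by move->; rewrite eqxx.
rewrite -iterS iterSr => puv uv.
have [pv|pv] := eqVneq (par u) v.
  exists u; last exact: subtree_refl.
  apply/incomingP; split=> // ur; move: uv; rewrite -pv ur par_root.
  by rewrite eqxx.
have [w wv pw] := IHn _ puv pv; exists w => //.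
by apply: subtree_trans pw; apply/subtree_iterP; exists 1%N.
Qed.

Lemma incoming_uniq u v w w' : w \in incoming v -> w' \in incoming v ->
  u \in subtree w -> u \in subtree w' -> w = w'.
Proof.
wlog: w w' / w \in subtree w'.
  move=> W wv w'v uw uw'; have [ww'|ww'] := subtree_chain uw uw'; first exact: W.
  by symmetry; apply: W.
move=> ww' wv w'v _ _; apply/eqP/negPn/negP => neq.
have := subtree_par ww' neq; move/incomingP: wv => [_ ->].
by apply/negP/incoming_notin.
Qed.

Lemma first_stepP v u : u \in subtree v -> u != v ->
  first_step v u \in incoming v /\ u \in subtree (first_step v u).
Proof.
move=> uv neq; rewrite /first_step; case: pickP => [w /andP[]//|nw].
by have [w wv uw] := subtree_child uv neq; have := nw w; rewrite wv uw.
Qed.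

Lemma first_stepE v u w : w \in incoming v -> u \in subtree w -> first_step v u = w.
Proof.
move=> wv uw; have uv : u \in subtree v.
  exact: subtree_trans uw (incoming_subtree wv).
have [|fv uf] := first_stepP uv.
  by apply: contraTneq uw => ->; apply: incoming_notin.
exact: incoming_uniq fv wv uf uw.
Qed.

Lemma interiorP v : reflect (exists u, u \in incoming v) (interior v).
Proof. exact: set0Pn. Qed.

Lemma subtree_interior u v : u \in subtree v -> u != v -> interior v.
Proof. by move=> uv /(subtree_child uv)[w wv _]; apply/interiorP; exists w. Qed.

Lemma subtree_leaf u v : ~~ interior v -> u \in subtree v -> u = v.
Proof.
by move=> vl uv; apply/eqP/negPn/negP => neq; move/negP: vl; apply;
  apply: subtree_interior neq.
Qed.

Lemma subtree_proper u v : u \in incoming v -> (#|subtree u| < #|subtree v|)%N.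
Proof.
move=> uv; apply/proper_card/properP; split.
  by apply/fintype.subsetP => w wu; apply: subtree_trans wu (incoming_subtree uv).
by exists v; rewrite ?subtree_refl // incoming_notin.
Qed.

Lemma tree_ind (P : T -> Prop) :
  (forall v, (forall u, u \in incoming v -> P u) -> P v) -> forall v, P v.
Proof.
move=> IH v; have [n] := ubnP #|subtree v|; elim: n v => // n IHn v.
rewrite ltnS => vn; apply: IH => u uv; apply: IHn.
exact: leq_trans (subtree_proper uv) vn.
Qed.

End RootedTrees.

(** * Meets and leaf sets in stable trees *)

Section StableTrees.
Variables (r : nat) (T : ltree r).
Hypothesis stT : stable_tree T.
Implicit Types (u v w : T) (i j k : 'I_r).

Lemma lab_inj : injective (@lab r T).
Proof. by case: stT. Qed.

Lemma lab_leaf i : ~~ interior (lab T i).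
Proof. by case: stT => _ leafP _; apply/leafP; exists i. Qed.

Lemma leaf_lab v : ~~ interior v -> exists i, lab T i = v.
Proof. by case: stT => _ leafP _; apply: (leafP v).1. Qed.

Lemma interior_neq_lab v i : interior v -> lab T i != v.
Proof. by move=> vi; apply: contraTneq vi => <-; apply: lab_leaf. Qed.

Lemma leaf_below v : exists i, lab T i \in subtree v.
Proof.
elim/tree_ind: v => v IH; have [/interiorP[u uv]|/leaf_lab[i <-]] := boolP (interior v).
  have [i iu] := IH u uv; exists i; exact: subtree_trans iu (incoming_subtree uv).
by exists i; apply: subtree_refl.
Qed.

Lemma lab_subtree_interior v i j : i != j ->
  lab T i \in subtree v -> lab T j \in subtree v -> interior v.
Proof.
move=> ij iv jv; apply: contraNT ij => vl.
by rewrite -(inj_eq lab_inj) (subtree_leaf vl iv) (subtree_leaf vl jv).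
Qed.

Definition is_meet v i j : bool :=
  [&& lab T i \in subtree v, lab T j \in subtree v
    & first_step v (lab T i) != first_step v (lab T j)].

Definition meet i j : T := odflt (root T) [pick v | is_meet v i j].

Lemma first_step_lab v i : interior v -> lab T i \in subtree v ->
  first_step v (lab T i) \in incoming v /\ lab T i \in subtree (first_step v (lab T i)).
Proof. by move=> vi iv; apply: first_stepP => //; apply: interior_neq_lab. Qed.

Lemma is_meet_ex i j : i != j -> exists v, is_meet v i j.
Proof.
move=> ij; suff: forall v, lab T i \in subtree v -> lab T j \in subtree v ->
    exists v, is_meet v i j by apply; apply: subtree_root.
elim/tree_ind => v IH iv jv; have vi := lab_subtree_interior ij iv jv.
have [eq_step|neq_step] := eqVneq (first_step v (lab T i)) (first_step v (lab T j)).
  have [fi ifi] := first_step_lab vi iv; have [fj jfj] := first_step_lab vi jv.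
  by apply: (IH _ fi) => //; rewrite eq_step.
by exists v; rewrite /is_meet iv jv.
Qed.

Lemma meetP i j : i != j -> is_meet (meet i j) i j.
Proof.
move=> /is_meet_ex[v vij]; rewrite /meet; case: pickP => //= /(_ v).
by rewrite vij.
Qed.

Lemma first_step_common v w i j : lab T i \in subtree w -> lab T j \in subtree w ->
  w \in subtree v -> w != v -> first_step v (lab T i) = first_step v (lab T j).
Proof.
move=> iw jw wv neq; have [u uv wu] := subtree_child wv neq.
by rewrite !(first_stepE uv) //; apply: subtree_trans wu.
Qed.

Lemma meet_subtree v i j : i != j -> lab T i \in subtree v -> lab T j \in subtree v ->
  meet i j \in subtree v.
Proof.
move=> ij iv jv; have /and3P[im jm neq_step] := meetP ij.
have [//|vm] := subtree_chain im iv.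
have [<-|neq] := eqVneq v (meet i j); first exact: subtree_refl.
by rewrite (first_step_common iv jv vm neq) eqxx in neq_step.
Qed.

Lemma is_meet_neq v i j : is_meet v i j -> i != j.
Proof. by case/and3P=> _ _; apply: contraNneq => ->. Qed.

Lemma meetE v i j : is_meet v i j -> meet i j = v.
Proof.
move=> vij; have ij := is_meet_neq vij; have /and3P[iv jv neq_step] := vij.
have /and3P[im jm _] := meetP ij.
have mv := meet_subtree ij iv jv; apply/eqP/negPn/negP => neq.
by rewrite (first_step_common im jm mv neq) eqxx in neq_step.
Qed.

Lemma meet_interior i j : i != j -> interior (meet i j).
Proof.
by move=> ij; have /and3P[im jm _] := meetP ij; apply: lab_subtree_interior im jm.
Qed.

Lemma meetl i j : i != j -> lab T i \in subtree (meet i j).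
Proof. by move=> /meetP/and3P[]. Qed.

Lemma meetr i j : i != j -> lab T j \in subtree (meet i j).
Proof. by move=> /meetP/and3P[]. Qed.

Lemma is_meet_children v w w' i j : w \in incoming v -> w' \in incoming v ->
  w != w' -> lab T i \in subtree w -> lab T j \in subtree w' -> is_meet v i j.
Proof.
move=> wv w'v ww' iw jw'.
apply/and3P; split; [exact: subtree_trans iw (incoming_subtree wv)|
  exact: subtree_trans jw' (incoming_subtree w'v)|].
by rewrite (first_stepE wv iw) (first_stepE w'v jw').
Qed.

Lemma other_child v w : interior v -> exists2 u, u \in incoming v & u != w.
Proof.
move=> vi; have [_ _ /(_ v vi) two] := stT.
have : (0 < #|incoming v :\ w|)%N.
  rewrite (cardsD1 w) in two.
  have [e|//] := posnP #|incoming v :\ w|.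
  by move: two; rewrite e addn0; case: (w \in _).
by case/card_gt0P=> u; rewrite in_setD1 => /andP[uw uv]; exists u.
Qed.

Lemma meet_other v i : interior v -> lab T i \in subtree v -> exists j, is_meet v i j.
Proof.
move=> vi iv; have [fi ifi] := first_step_lab vi iv.
have [u uv neq] := other_child (first_step v (lab T i)) vi.
have [j ju] := leaf_below u; exists j.
by apply: is_meet_children ifi ju => //; rewrite eq_sym.
Qed.

Lemma meet_ex v : interior v -> exists i j, is_meet v i j.
Proof. by move=> vi; have [i iv] := leaf_below v; exists i; apply: meet_other. Qed.

Definition leaves v : {set 'I_r} := [set i | lab T i \in subtree v]%SET.

Lemma leavesP v i : (i \in leaves v) = (lab T i \in subtree v).
Proof. by rewrite inE. Qed.

(** Stability makes vertices recoverable from their leaves: if v lay strictly inside the subtree of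
    u, another child of u would supply a leaf of u that is not a leaf of v. *)
Lemma leaves_subset u v : (u \in subtree v) = (leaves u \subset leaves v).
Proof.
apply/idP/fintype.subsetP => [uv i|sub].
  by rewrite !leavesP => iu; apply: subtree_trans uv.
have [i iu] := leaf_below u; have := sub i; rewrite !leavesP => /(_ iu) iv.
have [//|vu] := subtree_chain iu iv.
have [->|neq] := eqVneq v u; first exact: subtree_refl.
have ui := subtree_interior vu neq.
have [j /and3P[_ ju]] := meet_other ui iu.
have := sub j; rewrite !leavesP => /(_ ju) jv.
by rewrite (first_step_common iv jv vu neq) eqxx.
Qed.

Lemma leaves_inj : injective leaves.
Proof. by move=> u v uv; apply: subtree_anti; rewrite leaves_subset uv. Qed.

Lemma leaves_lab i : leaves (lab T i) = [set i]%SET.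
Proof.
apply/setP => j; rewrite !inE; apply/idP/eqP => [|->]; last exact: connect0.
have := @subtree_leaf T (lab T j) _ (lab_leaf i); rewrite inE => + ji => /(_ ji).
exact: lab_inj.
Qed.

Lemma meet_leaves i j v : i != j ->
  (meet i j \in subtree v) = (i \in leaves v) && (j \in leaves v).
Proof.
move=> ij; rewrite !leavesP; apply/idP/andP => [mv|[iv jv]].
  by split; apply: subtree_trans mv; [apply: meetl|apply: meetr].
exact: meet_subtree.
Qed.

End StableTrees.

(** * Isomorphism classes of stable curves and their coordinates *)

Section CurveCoordinates.
Variables (K : closedFieldType) (r : nat).
Implicit Types (c d : curve K r) (i j k l m : 'I_r).

Definition pos c (v : ctree c) i : K := marking v (first_step v (lab (ctree c) i)).

Definition coordinate c j k i : option K :=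
  if j == k then None else
  let v := meet (ctree c) j k in
  if lab (ctree c) i \in subtree v
  then Some ((pos v i - pos v j) / (pos v k - pos v j)) else None.

Section Stable.
Variable c : curve K r.
Hypothesis stc : stable_curve c.
Let stT : stable_tree (ctree c). Proof. by case: stc. Qed.
Local Notation T := (ctree c).
Implicit Types v : T.

Lemma pos_eq v i j : interior v -> lab T i \in subtree v -> lab T j \in subtree v ->
  (pos v i == pos v j) = (first_step v (lab T i) == first_step v (lab T j)).
Proof.
move=> vi iv jv; apply/eqP/eqP => [|e]; last by rewrite /pos e.
case: stc => _ inj; apply: inj.
  exact: (first_step_lab stT vi iv).1.
exact: (first_step_lab stT vi jv).1.
Qed.

Lemma is_meet_pos v i j : is_meet v i j =
  [&& interior v, lab T i \in subtree v, lab T j \in subtree v & pos v i != pos v j].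
Proof.
apply/idP/and4P => [vij|[vi iv jv]].
  have ij := is_meet_neq vij; have /and3P[iv jv neq] := vij.
  have vi := lab_subtree_interior stT ij iv jv.
  by split=> //; rewrite pos_eq.
by rewrite pos_eq // => neq; apply/and3P.
Qed.

Lemma leaves_coordinate i j k : i != j ->
  (k \in leaves (meet T i j)) = (coordinate c i j k != None).
Proof.
by move=> ij; rewrite leavesP /coordinate (negPf ij); case: ifP.
Qed.

(** f_jk(i) can be read off at any component that has the three leaves in its subtree and does not
    put them all at one point. If j and k coincide there but i does not, the meet of j and k is
    further from the root and misses i, hence infinity. *)
Lemma coordinate_proj v i j k : j != k -> lab T i \in subtree v ->
  lab T j \in subtree v -> lab T k \in subtree v ->
  (pos v i - pos v j != 0) || (pos v k - pos v j != 0) ->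
  coordinate c j k i = proj (pos v i - pos v j) (pos v k - pos v j).
Proof.
move=> jk iv jv kv neq; rewrite /coordinate (negPf jk).
have vi := lab_subtree_interior stT jk jv kv.
have [kj|kj] := eqVneq (pos v k) (pos v j); last first.
  have vjk : is_meet v j k by rewrite is_meet_pos vi jv kv eq_sym.
  by rewrite (meetE stT vjk) iv proj_fin // subr_eq0.
rewrite kj subrr proj_inf ifF //; apply/negP => im.
rewrite kj subrr eqxx orbF in neq.
have mv := meet_subtree stT jk jv kv.
have [mE|mneq] := eqVneq (meet T j k) v.
  have := meetP stT jk; rewrite mE is_meet_pos => /and4P[_ _ _].
  by rewrite kj eqxx.
have := first_step_common im (meetl stT jk) mv mneq.
by move/eqP; rewrite -pos_eq // -subr_eq0 (negPf neq).
Qed.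

Lemma coordinate_Some v j k i : is_meet v j k -> lab T i \in subtree v ->
  coordinate c j k i = Some ((pos v i - pos v j) / (pos v k - pos v j)).
Proof.
by move=> vjk iv; rewrite /coordinate (negPf (is_meet_neq vjk)) (meetE stT vjk) iv.
Qed.

Lemma coordinate_SomeE j k i a : coordinate c j k i = Some a ->
  exists v, [/\ is_meet v j k, lab T i \in subtree v
    & a = (pos v i - pos v j) / (pos v k - pos v j)].
Proof.
rewrite /coordinate; case: eqVneq => // jk; case: ifP => // im [<-].
by exists (meet T j k); split=> //; apply: meetP.
Qed.

Lemma coordinate_admissible : admissible (coordinate c).
Proof.
split.
- by move=> j i; rewrite /coordinate eqxx.
- move=> j k jk; rewrite (coordinate_Some (meetP stT jk) (meetl stT jk)).
  by rewrite subrr mul0r.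
- move=> j k jk; rewrite (coordinate_Some (meetP stT jk) (meetr stT jk)).
  rewrite divff // subr_eq0 eq_sym.
  by have := meetP stT jk; rewrite is_meet_pos => /and4P[].
- move=> j k l m i a b e lm /coordinate_SomeE[v [vjk lv ->]].
  move=> /coordinate_SomeE[v' [v'jk mv ->]] /coordinate_SomeE[v'' [v''jk iv ->]].
  move: mv iv; rewrite -(meetE stT v'jk) -(meetE stT v''jk) (meetE stT vjk) => mv iv.
  have kj : pos v k - pos v j != 0.
    by move: vjk; rewrite is_meet_pos => /and4P[_ _ _]; rewrite subr_eq0 eq_sym.
  have E x : (pos v x - pos v j) / (pos v k - pos v j) -
      (pos v l - pos v j) / (pos v k - pos v j) =
      (pos v k - pos v j)^-1 * (pos v x - pos v l) by rewrite -mulrBl; ring.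
  rewrite !E !mulf_eq0 invr_eq0 (negPf kj) /= => neq.
  by rewrite proj_scale ?invr_eq0 //; apply: coordinate_proj.
- move=> j k l m i a b lm /coordinate_SomeE[v [vjk lv _]].
  move=> /coordinate_SomeE[v' [v'jk mv _]].
  move: mv; rewrite -(meetE stT v'jk) (meetE stT vjk) => mv.
  rewrite /coordinate (negPf (is_meet_neq vjk)) (meetE stT vjk) (negPf lm).
  case: ifP => // iv _; rewrite ifF //; apply: contraFF iv => iml.
  exact: subtree_trans iml (meet_subtree stT lm lv mv).
(* If i is not in the subtree of the meet of j and k, this meet lies strictly inside the subtree of
   the meet of j and i. There j and k share a branch, so k is at 0. *)
- move=> j k i jk ji; rewrite {1}/coordinate (negPf jk); case: ifP => // im _.
  have /and3P[ji1 ji2 _] := meetP stT ji; have /and3P[jk1 jk2 _] := meetP stT jk.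
  have mm : meet T j k \in subtree (meet T j i).
    by have [//|] := subtree_chain jk1 ji1; move=> /(subtree_trans ji2); rewrite im.
  have mneq : meet T j k != meet T j i.
    by apply: contraFneq im => ->.
  rewrite (coordinate_Some (meetP stT ji) (subtree_trans jk2 mm)).
  by rewrite /pos (first_step_common jk2 jk1 mm mneq) subrr mul0r.
Qed.

End Stable.

Lemma iso_subtree c d (f : ctree c -> ctree d) :
  bijective f -> (forall v, f (par v) = par (f v)) ->
  forall u v, (f u \in subtree (f v)) = (u \in subtree v).
Proof.
move=> /bij_inj finj fpar u v.
have fiter n w : iter n (@par (ctree d)) (f w) = f (iter n (@par (ctree c)) w).
  by elim: n => //= n ->; rewrite fpar.
apply/subtree_iterP/subtree_iterP => -[n]; last by move=> <-; exists n.
by rewrite fiter => /finj; exists n.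
Qed.

Lemma iso_incoming c d (f : ctree c -> ctree d) :
  bijective f -> (forall v, f (par v) = par (f v)) ->
  f (root (ctree c)) = root (ctree d) ->
  forall u v, (f u \in incoming (f v)) = (u \in incoming v).
Proof.
move=> /bij_inj finj fpar froot u v; apply/incomingP/incomingP => -[uroot uv].
  by rewrite -fpar in uv; split; [move=> e; apply: uroot; rewrite e|exact: finj].
by rewrite -fpar uv; split=> // e; apply: uroot; apply: finj; rewrite froot.
Qed.

Lemma iso_coordinate c d : stable_curve c -> stable_curve d -> curve_iso c d ->
  coordinate c = coordinate d.
Proof.
move=> stc std [f [fbij froot fpar flab fmark]].
have [stT _] := stc; have [stT' _] := std.
have fsub := iso_subtree fbij fpar; have fin := iso_incoming fbij fpar froot.
have fstep v i : interior v -> lab (ctree c) i \in subtree v ->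
    f (first_step v (lab (ctree c) i)) = first_step (f v) (lab (ctree d) i).
  move=> vi iv; have [fs1 fs2] := first_step_lab stT vi iv; symmetry.
  by apply: first_stepE; rewrite ?fin // -flab fsub.
apply: funext => j; apply: funext => k; apply: funext => i.
have [->|jk] := eqVneq j k; first by rewrite /coordinate eqxx.
have vjk := meetP stT jk; set v := meet (ctree c) j k in vjk.
have /and3P[jv kv neq] := vjk; have vi := lab_subtree_interior stT jk jv kv.
have fvjk : is_meet (f v) j k.
  by rewrite /is_meet -!flab !fsub jv kv !flab -!fstep // (inj_eq (bij_inj fbij)).
have [iv|iv] := boolP (lab (ctree c) i \in subtree v); last first.
  rewrite /coordinate (negPf jk) (negPf iv) (meetE stT' fvjk) -flab fsub.
  by rewrite (negPf iv).
rewrite (coordinate_Some stc vjk iv) (coordinate_Some std fvjk) -?flab ?fsub //.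
have [a [b [a0 mE]]] := fmark v vi.
have posE l : lab (ctree c) l \in subtree v -> pos (f v) l = a * pos v l + b.
  move=> lv; rewrite /pos -fstep // mE //.
  exact: (first_step_lab stT vi lv).1.
rewrite !posE //; congr Some.
have E x y : a * x + b - (a * y + b) = a * (x - y) by ring.
by rewrite !E -mulf_div divff // mul1r.
Qed.

(** The leaf set of an interior vertex is the finiteness locus of a coordinate f_ij with i and j
    meeting there. *)
Lemma leaves_transfer c d : stable_curve c -> stable_curve d ->
  coordinate c = coordinate d ->
  forall v : ctree c, exists u : ctree d, leaves u = leaves v.
Proof.
move=> stc std cd v; have [stT _] := stc; have [stT' _] := std.
have [vi|/(leaf_lab stT)[i <-]] := boolP (interior v); last first.
  by exists (lab (ctree d) i); rewrite !leaves_lab.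
have [i [j vij]] := meet_ex stT vi; have ij := is_meet_neq vij.
exists (meet (ctree d) i j); apply/setP => k.
by rewrite leaves_coordinate // -cd -leaves_coordinate // (meetE stT vij).
Qed.

(** Vertices of the two trees are matched by their leaf sets, and inclusion of leaf sets determines
    the parents. *)
Lemma coordinate_iso c d : stable_curve c -> stable_curve d ->
  coordinate c = coordinate d -> curve_iso c d.
Proof.
move=> stc std cd; have [stT _] := stc; have [stT' _] := std.
have [f fL] := choice (leaves_transfer stc std cd).
have [g gL] := choice (leaves_transfer std stc (esym cd)).
have fg : cancel f g by move=> v; apply: (leaves_inj stT); rewrite gL fL.
have gf : cancel g f by move=> v; apply: (leaves_inj stT'); rewrite fL gL.
have fsub u v : (f u \in subtree (f v)) = (u \in subtree v).
  by rewrite !leaves_subset // !fL.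
have froot : f (root (ctree c)) = root (ctree d).
  apply: subtree_anti; first exact: subtree_root.
  by rewrite -(gf (root _)) fsub; apply: subtree_root.
have flab i : f (lab (ctree c) i) = lab (ctree d) i.
  by apply: (leaves_inj stT'); rewrite fL !leaves_lab.
have finc u v : u \in incoming v -> f u \in incoming (f v).
  move=> uv; have neq : f u != f v by rewrite (can_eq fg) incoming_neq.
  have fuv : f u \in subtree (f v) by rewrite fsub incoming_subtree.
  have [w wv uw] := subtree_child fuv neq.
  have : w \in subtree (f v) by apply: incoming_subtree.
  rewrite -(gf w) fsub => gwv; move: uw; rewrite -(gf w) fsub => ugw.
  have [gwu|neq'] := eqVneq u (g w); first by rewrite gwu gf.
  have := subtree_par ugw neq'; move/incomingP: (uv) => [_ ->] vgw.
  have : g w = v by apply: subtree_anti.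
  by move=> gwv'; have := incoming_neq wv; rewrite -gwv' gf eqxx.
exists f; split=> //; first by exists g.
  move=> v; have [->|vroot] := eqVneq v (root (ctree c)).
    by rewrite par_root froot par_root.
  have : v \in incoming (par v) by apply/incomingP; split=> //; apply/eqP.
  by move/finc/incomingP => [_ ->].
move=> v vi; have [j [k vjk]] := meet_ex stT vi; have jk := is_meet_neq vjk.
have fvsub i : (lab (ctree d) i \in subtree (f v)) = (lab (ctree c) i \in subtree v).
  by rewrite -flab fsub.
have fstep i : lab (ctree c) i \in subtree v ->
    first_step (f v) (lab (ctree d) i) = f (first_step v (lab (ctree c) i)).
  move=> iv; have [fs1 fs2] := first_step_lab stT vi iv.
  by apply: first_stepE; [apply: finc|rewrite -flab fsub].
have fvjk : is_meet (f v) j k.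
  have /and3P[jv kv neq] := vjk.
  by rewrite /is_meet !fvsub jv kv !fstep // (can_eq fg).
have neq0 (e : curve K r) (ste : stable_curve e) (u : ctree e) :
    is_meet u j k -> pos u k - pos u j != 0.
  by rewrite is_meet_pos // subr_eq0 eq_sym => /and4P[].
have D := neq0 c stc v vjk; have D' := neq0 d std (f v) fvjk.
(* The affine map is forced by the positions of the two leaves j and k that meet at v. *)
pose a := (pos (f v) k - pos (f v) j) / (pos v k - pos v j).
exists a, (pos (f v) j - a * pos v j); split.
  by rewrite mulf_neq0 // invr_eq0.
move=> u uv; have [i iu] := leaf_below stT u.
have iv := subtree_trans iu (incoming_subtree uv).
have -> : marking v u = pos v i by rewrite /pos (first_stepE uv iu).
have -> : marking (f v) (f u) = pos (f v) i by rewrite /pos fstep // (first_stepE uv iu).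
have : coordinate c j k i = coordinate d j k i by rewrite cd.
rewrite (coordinate_Some stc vjk iv) (coordinate_Some std fvjk) ?fvsub // => -[E].
apply/eqP; rewrite addrCA -mulrBr -subr_eq0 opprD addrA subr_eq0.
rewrite -[X in X == _](divfK D') -E /a; apply/eqP; ring.
Qed.

Lemma curve_iso_trans c d (e : curve K r) :
  curve_iso c d -> curve_iso d e -> curve_iso c e.
Proof.
move=> [f [fbij froot fpar flab fm]] [g [gbij groot gpar glab gm]].
exists (g \o f); split; first exact: bij_comp.
- by rewrite /= froot groot.
- by move=> v /=; rewrite fpar gpar.
- by move=> i /=; rewrite flab glab.
have fin := iso_incoming fbij fpar froot.
move=> v vi; have [a [b [a0 fE]]] := fm v vi.
have [|a' [b' [a'0 gE]]] := gm (f v).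
  by move/interiorP: vi => [u uv]; apply/interiorP; exists (f u); rewrite fin.
exists (a' * a), (a' * b + b'); rewrite mulf_neq0 //; split=> // u uv /=.
by rewrite gE ?fin // fE //; ring.
Qed.

Lemma iso_class_eq c d : stable_curve c -> stable_curve d ->
  iso_class c = iso_class d <-> coordinate c = coordinate d.
Proof.
move=> stc std; split=> [cd|cd].
  have : iso_class c d by rewrite cd; apply: coordinate_iso.
  exact: iso_coordinate.
rewrite predeqE => e; split; apply: curve_iso_trans; exact: coordinate_iso.
Qed.

End CurveCoordinates.

(** * Slices as normalizations of the component coordinates *)

Section Slices.
Variables (r : nat) (T : sliced_tree r).
Implicit Types v : T.
Let stT : stable_tree T := stree_stable T.

Definition s0_or_id v : T := if interior v then s0 v else v.

(** Each step from an interior vertex strictly shrinks the subtree, and leaves are fixed. Hence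
    [nvert T] steps always end at a leaf. *)
Lemma iter_s0_leaf v n : (#|subtree v| <= n)%N -> ~~ interior (iter n s0_or_id v).
Proof.
elim: n v => [|n IHn] v.
  by rewrite leqn0 cards_eq0 => /eqP e; have := subtree_refl v; rewrite e inE.
move=> vn; rewrite iterSr {2}/s0_or_id; case: ifP => [vi|/negbT vl].
  by apply: IHn; rewrite -ltnS; apply: leq_trans (subtree_proper (s0_in vi)) vn.
by elim: n {IHn vn} => //= n IHn; rewrite {1}/s0_or_id (negPf IHn).
Qed.

Lemma s0_leaf_ex v : exists i, lab T i = iter (nvert T) s0_or_id v.
Proof.
apply: (leaf_lab stT); apply: iter_s0_leaf.
by rewrite -[X in (_ <= X)%N]card_ord max_card.
Qed.

(* The label of the leaf reached from v by following the slice s0. *)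
Definition s0_leaf v : 'I_r := sval (cid (s0_leaf_ex v)).

Lemma lab_s0_leaf v : lab T (s0_leaf v) = iter (nvert T) s0_or_id v.
Proof. by rewrite /s0_leaf; case: cid. Qed.

Lemma s0_leaf_interior v : interior v -> s0_leaf (s0 v) = s0_leaf v.
Proof.
move=> vi; apply: (lab_inj stT); rewrite !lab_s0_leaf.
have -> : s0 v = s0_or_id v by rewrite /s0_or_id vi.
rewrite -iterSr iterS {1}/s0_or_id ifN // iter_s0_leaf //.
by rewrite -[X in (_ <= X)%N]card_ord max_card.
Qed.

Lemma s0_leaf_lab i : s0_leaf (lab T i) = i.
Proof.
apply: (lab_inj stT); rewrite lab_s0_leaf.
by elim: (nvert T) => //= n ->; rewrite /s0_or_id (negPf (lab_leaf stT i)).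
Qed.

Lemma s0_leaf_subtree v : lab T (s0_leaf v) \in subtree v.
Proof.
rewrite lab_s0_leaf; elim: (nvert T) => [|n IHn] /=; first exact: subtree_refl.
apply: subtree_trans IHn; rewrite {1}/s0_or_id; case: ifP => [vi|_].
  exact: incoming_subtree (s0_in vi).
exact: subtree_refl.
Qed.

Lemma slice_is_meet v : interior v -> is_meet v (s0_leaf v) (s0_leaf (s1 v)).
Proof.
move=> vi; rewrite -(s0_leaf_interior vi).
apply: is_meet_children (s0_in vi) (s1_in vi) (s0_s1 vi) _ _;
  exact: s0_leaf_subtree.
Qed.

Variables (K : closedFieldType).

(* The coordinate on the component v normalized by the slices: the leaf reached
   through [s0 v] is at 0, the one reached through [s1 v] is at 1. *)
Definition slice_coord (f : 'I_r -> 'I_r -> 'I_r -> option K) v i : option K :=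
  f (s0_leaf v) (s0_leaf (s1 v)) i.

(* The curve with coordinates f has a tree which is a contraction of T. *)
Definition compatible (f : 'I_r -> 'I_r -> 'I_r -> option K) : Prop :=
  forall i j, i != j -> let g := slice_coord f (meet T i j) in
  [&& g i != None, g j != None & g i != g j].

End Slices.

Lemma slice_ex r (T : ltree r) : stable_tree T -> exists S : sliced_tree r, stree S = T.
Proof.
move=> stT.
have ex2 (v : T) : exists p : T * T, interior v ->
    [/\ p.1 \in incoming v, p.2 \in incoming v & p.1 != p.2].
  have [/interiorP[u uv]|vl] := boolP (interior v); last by exists (v, v).
  have [|w wv neq] := other_child stT u (v := v); first by apply/interiorP; exists u.
  by exists (u, w) => _; split; rewrite // eq_sym.
have [p pP] := choice ex2.
have h0 v : interior v -> (p v).1 \in incoming v by case/pP.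
have h1 v : interior v -> (p v).2 \in incoming v by case/pP.
have h01 v : interior v -> (p v).1 != (p v).2 by case/pP.
by exists (@SlicedTree r T stT _ _ h0 h1 h01).
Qed.

(** * The tree of clusters of admissible coordinates *)

Section LaminarTree.
Variables (r : nat) (C : {set {set 'I_r}}).
Hypothesis CT : [set: 'I_r]%SET \in C.
Hypothesis C1 : forall i, [set i]%SET \in C.
Hypothesis C0 : finset.set0 \notin C.
Hypothesis lamC : forall A B i, A \in C -> B \in C -> i \in A -> i \in B ->
  (A \subset B) || (B \subset A).
Local Notation V := 'I_#|C|.
Implicit Types u v w : V.

Let S v : {set 'I_r} := enum_val v.
Let lroot : V := enum_rank_in CT finset.setT.
Let lpar v : V :=
  if v == lroot then lroot else [arg min_(w < lroot | S v \proper S w) #|S w|]%N.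

Let S_root : S lroot = finset.setT. Proof. by rewrite /S enum_rankK_in. Qed.

Let S_inj : injective S. Proof. exact: enum_val_inj. Qed.

Let S_ex A : A \in C -> exists v, S v = A.
Proof. by move=> CA; exists (enum_rank_in CA A); rewrite /S enum_rankK_in. Qed.

Let S_neq0 v : exists i, i \in S v.
Proof. by apply/set0Pn; apply: contraNneq C0 => <-; apply: enum_valP. Qed.

Let lpar_root : lpar lroot = lroot. Proof. by rewrite /lpar eqxx. Qed.

Let lparP v : v != lroot -> S v \proper S (lpar v) /\
  forall w, S v \proper S w -> S (lpar v) \subset S w.
Proof.
move=> vroot; rewrite /lpar (negPf vroot).
case: arg_minnP => [|u vu umin].
  rewrite S_root properT; apply: contraNneq vroot => e.
  by apply/eqP/S_inj; rewrite S_root.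
split=> // w vw; have [i iv] := S_neq0 v.
have iu : i \in S u by apply: (fintype.subsetP (proper_sub vu)).
have iw : i \in S w by apply: (fintype.subsetP (proper_sub vw)).
have /orP[//|wu] := lamC (enum_valP u) (enum_valP w) iu iw.
by have /eqP -> : S w == S u by rewrite eqEcard wu umin.
Qed.

Let lpar_subset v w : S v \subset S w -> fconnect lpar v w.
Proof.
have [n] := ubnP (#|S w| - #|S v|)%N; elim: n v => // n IHn v vn vw.
have [->|neq] := eqVneq v w; first exact: connect0.
have pvw : S v \proper S w by rewrite finset.properEneq vw andbT (inj_eq S_inj).
have vroot : v != lroot.
  by apply: contraTneq pvw => ->; rewrite S_root properE finset.subsetT andbF.
have [vp pmin] := lparP vroot; apply: connect_trans (fconnect1 _ v) _.
apply: IHn; last exact: pmin.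
have := proper_card vp; have := subset_leq_card (pmin w pvw).
by move: vn; lia.
Qed.

Let lpar_reach v : fconnect lpar v lroot.
Proof. by apply: lpar_subset; rewrite S_root finset.subsetT. Qed.

Let LT : rtree := RTree lpar_root lpar_reach.

Let lpar_connect v w : fconnect lpar v w -> S v \subset S w.
Proof.
move=> /iter_findex <-; elim: (findex _ _ _) => //= n IHn.
apply: fintype.subset_trans IHn _.
have [->|/lparP[/proper_sub]//] := eqVneq (iter n lpar v) lroot.
by rewrite lpar_root.
Qed.

Let llab i : V := enum_rank_in (C1 i) [set i]%SET.

Let S_lab i : S (llab i) = [set i]%SET. Proof. by rewrite /S enum_rankK_in. Qed.

Let LLT : ltree r := @LTree r LT llab.

Let subtree_S (u v : LLT) : (u \in subtree v) = (S u \subset S v).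
Proof. by rewrite inE; apply/idP/idP; [apply: lpar_connect|apply: lpar_subset]. Qed.

(** The parent of a member of C is the smallest member strictly containing it, unique because the
    members containing a given label form a chain. Stability holds because a label of v outside one
    child u lies in another child. *)
Lemma laminar_tree : exists T : ltree r,
  [/\ stable_tree T, forall v : T, leaves v \in C
    & forall A, A \in C -> exists v : T, leaves v = A].
Proof.
have leavesS (v : LLT) : leaves v = S v.
  by apply/setP => i; rewrite leavesP subtree_S S_lab finset.sub1set.
exists LLT; split; last first.
- by move=> A /S_ex[v vA]; exists v; rewrite leavesS.
- by move=> v; rewrite leavesS; apply: enum_valP.
split.
- by move=> i j e; apply: set1_inj; rewrite -!S_lab; congr S.
- move=> v; split=> [vl|[i <-]].
    have [i iv] := S_neq0 v; exists i; apply: subtree_leaf vl _.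
    by rewrite subtree_S S_lab finset.sub1set.
  apply/interiorP => -[u uv]; have := incoming_subtree uv; rewrite subtree_S S_lab.
  have [j ju] := S_neq0 u; move=> /fintype.subsetP ui.
  have := incoming_neq uv; rewrite -(inj_eq S_inj) S_lab => /eqP; apply.
  apply/setP => k; rewrite inE; apply/idP/eqP => [/ui/set1P//|->].
  by have /set1P <- := ui j ju.
move=> v /interiorP[u uv].
have uv' := incoming_subtree uv; rewrite subtree_S in uv'.
have : S u \proper S v.
  by rewrite finset.properEneq uv' andbT (inj_eq S_inj); exact: (incoming_neq uv).
move=> /properP[_ [i iv iu]].
have iv' : lab LLT i \in subtree v by rewrite subtree_S S_lab finset.sub1set.
have [|w wv iw] := subtree_child iv'.
  apply: contraNneq iu => e; have [k ku] := S_neq0 u.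
  have : k \in S v by apply: (fintype.subsetP uv').
  by rewrite -e S_lab => /set1P ki; rewrite -ki.
apply/card_gt1P; exists u, w; split=> //.
by apply: contraNneq iu => ->; rewrite -finset.sub1set -S_lab -subtree_S.
Qed.

End LaminarTree.

Section ClusterTree.
Variables (K : closedFieldType) (r : nat) (f : 'I_r -> 'I_r -> 'I_r -> option K).
Hypothesis admf : admissible f.
Implicit Types i j k l m : 'I_r.

Definition cluster j k : {set 'I_r} := [set i | f j k i != None]%SET.

Lemma clusterP j k i : reflect (exists a, f j k i = Some a) (i \in cluster j k).
Proof.
rewrite inE; case: (f j k i) => [a|]; apply: (iffP idP) => //; first by exists a.
by case.
Qed.

Lemma in_clusterl j k : j != k -> j \in cluster j k.
Proof. by move=> jk; rewrite inE (adm0 admf). Qed.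

Lemma in_clusterr j k : j != k -> k \in cluster j k.
Proof. by move=> jk; rewrite inE (adm1 admf). Qed.

Lemma cluster_subset j k l m : l != m -> l \in cluster j k -> m \in cluster j k ->
  cluster l m \subset cluster j k.
Proof.
move=> lm /clusterP[a fa] /clusterP[b fb]; apply/fintype.subsetP => i.
by rewrite !inE; apply: contraNneq => fi; rewrite (adm_inf admf lm fa fb fi).
Qed.

(** Any two leaves at distinct finite positions can serve as the points 0 and 1 of the same
    component. *)
Lemma cluster_eq j k l m a b : f j k l = Some a -> f j k m = Some b -> a != b ->
  cluster l m = cluster j k.
Proof.
move=> fa fb ab.
have lm : l != m.
  by apply: contraNneq ab => lm; move: fa; rewrite lm fb => -[->].
have lin : l \in cluster j k by apply/clusterP; exists a.
have min : m \in cluster j k by apply/clusterP; exists b.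
apply/eqP; rewrite finset.eqEsubset cluster_subset //=.
apply/fintype.subsetP => i /clusterP[c fc]; rewrite inE.
have ba : b - a != 0 by rewrite subr_eq0 eq_sym.
by rewrite (adm_proj admf lm fa fb fc) ?ba ?orbT // proj_fin.
Qed.

Lemma cluster_base j k i : j != k -> i \in cluster j k ->
  exists2 l, i != l & cluster i l = cluster j k.
Proof.
move=> jk /clusterP[a fa].
have [l [b fb ab]] : exists l, exists2 b, f j k l = Some b & a != b.
  have [->|a0] := eqVneq a 0; last by exists j, 0; rewrite // (adm0 admf).
  by exists k, 1; rewrite ?(adm1 admf) // eq_sym oner_eq0.
exists l; last exact: cluster_eq fa fb ab.
by apply: contraNneq ab => il; move: fa; rewrite il fb => -[->].
Qed.

(** Both clusters are rebased at the common leaf i, as [cluster i n] and [cluster i p]. If p is not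
    in the first, [adm_flip] puts n in the second. *)
Lemma cluster_laminar j k l m i : j != k -> l != m ->
  i \in cluster j k -> i \in cluster l m ->
  (cluster j k \subset cluster l m) || (cluster l m \subset cluster j k).
Proof.
move=> jk lm /(cluster_base jk)[n ni <-] /(cluster_base lm)[p pi <-].
have [pn|pn] := boolP (p \in cluster i n).
  by rewrite (@cluster_subset i n i p) ?orbT // in_clusterl.
rewrite (@cluster_subset i p i n) ?in_clusterl // inE.
move: pn; rewrite inE negbK => /eqP fnp.
by rewrite (adm_flip admf ni pi fnp).
Qed.

(** If x is missing from a largest cluster, that of j and k, then [cluster j x] shares j with it. By
    laminarity it is strictly larger, or contained in it, which would put x inside. *)
Lemma cluster_top : (2 <= r)%N ->
  exists2 jk, jk.1 != jk.2 & cluster jk.1 jk.2 = finset.setT.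
Proof.
move=> r2; pose x0 : 'I_r := Ordinal (ltnW r2); pose x1 : 'I_r := Ordinal r2.
pose P (jk : 'I_r * 'I_r) := jk.1 != jk.2.
case: (@arg_maxnP _ (x0, x1) P (fun jk => #|cluster jk.1 jk.2|)) => // -[j k] jk mx.
exists (j, k) => //; apply/setP => x /=; rewrite finset.in_setT; apply/idPn => xjk.
rewrite /P /= in jk mx.
have jx : j != x by apply: contraNneq xjk => <-; apply: in_clusterl.
have /orP[sub|sub] := cluster_laminar jk jx (in_clusterl jk) (in_clusterl jx).
  have /(mx (j, x)) /= := jx; apply/negP; rewrite -ltnNge; apply/proper_card/properP.
  by split=> //; exists x => //; apply: in_clusterr.
by move/negP: xjk; apply; apply: (fintype.subsetP sub); apply: in_clusterr.
Qed.

(** The tree of all clusters and singletons: the leaves at the meet of i and j are then exactly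
    [cluster i j], and any slices will do. *)
Lemma compatible_tree_ex : (2 <= r)%N -> exists T : sliced_tree r, compatible T f.
Proof.
move=> r2.
pose C := [set A | [exists i, A == [set i]] ||
  [exists jk : 'I_r * 'I_r, (jk.1 != jk.2) && (A == cluster jk.1 jk.2)]]%SET.
have inC A : reflect ((exists i, A = [set i]%SET) \/
    exists j k, j != k /\ A = cluster j k) (A \in C).
  rewrite inE; apply: (iffP orP) => -[].
  - by move=> /existsP[i /eqP]; left; exists i.
  - by move=> /existsP[[j k] /andP[/= jk /eqP ->]]; right; exists j, k.
  - by move=> [i ->]; left; apply/existsP; exists i.
  - by move=> [j [k [jk ->]]]; right; apply/existsP; exists (j, k); rewrite /= jk eqxx.
have [||||T [stT TC CTT]] := @laminar_tree r C.
- have [[j k] /= jk <-] := cluster_top r2; apply/inC; right; by exists j, k.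
- by move=> i; apply/inC; left; exists i.
- apply/inC => -[[i e]|[j [k [jk e]]]].
    by have := set11 i; rewrite -e inE.
  by have := in_clusterl jk; rewrite -e inE.
- move=> A B i /inC[[j ->]|[j [k [jk ->]]]] /inC[[l ->]|[l [m [lm ->]]]].
  + by move=> /set1P <- /set1P <-; rewrite fintype.subxx.
  + by move=> /set1P <- im; rewrite finset.sub1set im.
  + by move=> im /set1P <-; rewrite orbC finset.sub1set im.
  + exact: cluster_laminar.
have leavesm (i j : 'I_r) : i != j -> leaves (meet T i j) = cluster i j.
  move=> ij; have [|u uC] := CTT (cluster i j).
    by apply/inC; right; exists i, j.
  apply/eqP; rewrite finset.eqEsubset -uC -leaves_subset // meet_leaves // uC.
  rewrite in_clusterl // in_clusterr //=.
  have : i \in leaves (meet T i j) by rewrite leavesP meetl.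
  have : j \in leaves (meet T i j) by rewrite leavesP meetr.
  have /inC[[k ->]|[j' [k' [_ ->]]]] := TC (meet T i j).
    by move=> /set1P jk /set1P ik; rewrite jk ik eqxx in ij.
  by move=> ? ?; apply: cluster_subset.
have [S ST] := slice_ex stT; move: S ST TC CTT leavesm stT => S <- _ _ leavesm stS.
exists S => i j ij /=; set v := meet S i j.
have vm := slice_is_meet (meet_interior stS ij).
have ab := is_meet_neq vm; have lv := leavesm _ _ ab; rewrite (meetE stS vm) in lv.
rewrite -/v in vm ab lv *.
have : i \in leaves v by rewrite leavesP meetl.
have : j \in leaves v by rewrite leavesP meetr.
rewrite /slice_coord; move: (lv) => ->.
set a := s0_leaf v; set b := s0_leaf (s1 v).
move=> /clusterP[y fj] /clusterP[x fi]; rewrite fi fj /=.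
apply/eqP => -[xy].
(* If i and j had the same position, a base leaf l of v at another position would be infinite in
   f_ij, although it belongs to [cluster i j]. *)
have [l [z fl zx]] : exists l, exists2 z, f a b l = Some z & z - x != 0.
  have [x0|x0] := eqVneq x 0.
    by exists b, 1; rewrite ?(adm1 admf) // x0 subr0 oner_neq0.
  by exists a, 0; rewrite ?(adm0 admf) // sub0r oppr_eq0.
have := adm_proj admf ij fi fj fl; rewrite zx => /(_ isT).
rewrite -xy subrr proj_inf => fN.
have : l \in cluster i j.
  by rewrite -leavesm // -/v lv; apply/clusterP; exists z.
by rewrite inE fN.
Qed.

End ClusterTree.

(** * The polynomials of the local models *)

Section VariableDivision.
Variables (n : nat) (R : idomainType) (k : 'I_n).
Implicit Types p q : {mpoly R[n]}.

Definition subst0 q : {mpoly R[n]} :=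
  q \mPo [tuple (if i == k then 0 else 'X_i : {mpoly R[n]}) | i < n].

Lemma subst0X i : subst0 'X_i = if i == k then 0 else 'X_i.
Proof.
rewrite /subst0 comp_mpolyXU (nth_map i) ?size_tuple ?card_ord //.
by rewrite -tnth_nth tnth_ord_tuple.
Qed.

Lemma subst0_div q : exists g, q = subst0 q + 'X_k * g.
Proof.
pose D q := exists g, q = subst0 q + 'X_k * g.
have D1 : D 1 by exists 0; rewrite /subst0 rmorph1 mulr0 addr0.
have DM p p' : D p -> D p' -> D (p * p').
  move=> [g pE] [g' p'E]; exists (subst0 p * g' + subst0 p' * g + 'X_k * g * g').
  rewrite /subst0 rmorphM -/(subst0 p) -/(subst0 p') {1}pE {1}p'E; ring.
have DD p p' : D p -> D p' -> D (p + p').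
  move=> [g pE] [g' p'E]; exists (g + g').
  rewrite /subst0 rmorphD -/(subst0 p) -/(subst0 p') {1}pE {1}p'E; ring.
have DX i : D 'X_i.
  rewrite /D subst0X; case: eqVneq => [->|_]; first by exists 1; rewrite add0r mulr1.
  by exists 0; rewrite mulr0 addr0.
rewrite -/(D q); elim/mpolyind: q => [|c m p _ _ IH].
  by exists 0; rewrite /subst0 rmorph0 mulr0 addr0.
apply: DD => //; rewrite -mul_mpolyC; apply: (DM).
  by exists 0; rewrite /subst0 comp_mpolyC mulr0 addr0.
rewrite mpolyXE_id; apply: (big_ind D D1 DM) => i _.
by elim: (m i) => [|e IHe]; rewrite ?expr0 ?exprS //; apply: DM.
Qed.

(** The variable X_k is prime, being a generator of the kernel of [subst0], and a nonzero p that is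
    fixed by [subst0] is not a multiple of it. *)
Lemma subst0_fix_mulX p q g : subst0 p = p -> p != 0 -> p * q = 'X_k * g ->
  exists g', q = 'X_k * g'.
Proof.
move=> pp p0 /(congr1 subst0).
have subst0M : {morph subst0 : p q / p * q} by move=> ? ?; apply: rmorphM.
rewrite !subst0M pp subst0X eqxx mul0r => /eqP.
rewrite mulf_eq0 (negPf p0) /= => /eqP q0.
by have [g' ->] := subst0_div q; exists g'; rewrite q0 add0r.
Qed.

End VariableDivision.

Section LocalModel.
Variables (K : closedFieldType) (r : nat) (T : sliced_tree r).
Implicit Types u v w z : T.
Implicit Types i j : 'I_r.
Let stT : stable_tree T := stree_stable T.

Definition bprod v w : {mpoly K[#|mcoord T|]} :=
  \prod_(z in (tpath v w :\ v)%SET) bpoly K z.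

Lemma tpathP v u w : (w \in tpath v u) = (w \in subtree v) && (u \in subtree w).
Proof. by rewrite inE. Qed.

Lemma tpathxx v : tpath v v = [set v]%SET.
Proof.
apply/setP => w; rewrite tpathP !inE; apply/andP/eqP => [[wv vw]|->].
  by apply: subtree_anti; rewrite inE.
by rewrite connect0.
Qed.

Lemma tpath_child v c u : c \in incoming v -> u \in subtree c ->
  (tpath v u :\ v)%SET = tpath c u.
Proof.
move=> cv uc; apply/setP => w; rewrite in_setD1 !tpathP.
apply/idP/idP => [/and3P[neq wv uw]|/andP[wc uw]].
  rewrite uw andbT; have [d dv wd] := subtree_child wv neq.
  by rewrite (incoming_uniq cv dv uc (subtree_trans uw wd)).
rewrite uw (subtree_trans wc (incoming_subtree cv)) !andbT.
by apply: contraTneq wc => ->; apply: incoming_notin.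
Qed.

Lemma tpath_refl v u : u \in subtree v -> v \in tpath v u.
Proof. by move=> uv; rewrite tpathP subtree_refl. Qed.

Lemma bprodxx v : bprod v v = 1.
Proof. by rewrite /bprod tpathxx finset.setDv big_set0. Qed.

Lemma bprod_child v c w : c \in incoming v -> w \in subtree c ->
  bprod v w = bpoly K c * bprod c w.
Proof.
move=> cv wc; rewrite /bprod (tpath_child cv wc).
by rewrite (big_setD1 c) ?tpath_refl.
Qed.

Lemma ppolyxx v : ppoly K v v = 0.
Proof. by rewrite /ppoly tpathxx finset.setDv big_set0. Qed.

Lemma ppoly_child v c u : c \in incoming v -> u \in subtree c ->
  ppoly K v u = xedge K v c + bpoly K c * ppoly K c u.
Proof.
move=> cv uc; have uv := subtree_trans uc (incoming_subtree cv).
have vu : v != u by apply: contraTneq uc => <-; apply: incoming_notin.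
rewrite /ppoly (big_setD1 v) /=; last by rewrite in_setD1 vu tpath_refl.
rewrite tpathxx finset.setDv big_set0 mulr1 /xpoly (first_stepE cv uc); congr (_ + _).
rewrite mulr_sumr (_ : ((tpath v u :\ u) :\ v)%SET = (tpath c u :\ u)%SET); last first.
  by rewrite -(tpath_child cv uc); apply/setP => w; rewrite !in_setD1 andbCA.
apply: eq_bigr => w; rewrite in_setD1 tpathP => /and3P[_ wc _].
by rewrite -/(bprod v w) (bprod_child cv wc) /bprod; ring.
Qed.

(** The coordinate on w passes to the one on v by an affine map of scale [bprod v w], the product of
    the smoothing parameters on the path. *)
Lemma ppoly_split v w u : w \in subtree v -> u \in subtree w ->
  ppoly K v u = ppoly K v w + bprod v w * ppoly K w u.
Proof.
elim/tree_ind: v => v IH wv uw.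
have [->|neq] := eqVneq w v; first by rewrite ppolyxx bprodxx add0r mul1r.
have [c cv wc] := subtree_child wv neq; have uc := subtree_trans uw wc.
by rewrite !(ppoly_child cv) // (IH c) // (bprod_child cv wc); ring.
Qed.

Lemma ppoly_sub_split v w u u' : w \in subtree v -> u \in subtree w ->
  u' \in subtree w ->
  ppoly K v u - ppoly K v u' = bprod v w * (ppoly K w u - ppoly K w u').
Proof. by move=> wv uw u'w; rewrite (ppoly_split wv uw) (ppoly_split wv u'w); ring. Qed.

Lemma bpolyE v (vb : is_bcoord v) :
  bpoly K v = coordX K (inr (Sub v vb) : mcoord T).
Proof. by rewrite /bpoly insubT. Qed.

Lemma bpoly_neq0 v : bpoly K v != 0.
Proof.
have [vb|/negPf vb] := boolP (is_bcoord v); last first.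
  by rewrite /bpoly insubF // oner_eq0.
apply/eqP => /(congr1 (fun p => peval p (fun=> 1))).
by rewrite bpolyE peval_coordX peval0 => /eqP; rewrite oner_eq0.
Qed.

Lemma path_bcoord w z : interior w -> z \in (tpath (root T) w :\ root T)%SET ->
  is_bcoord z.
Proof.
move=> wi; rewrite in_setD1 tpathP => /and3P[zr _ wz]; rewrite /is_bcoord zr andbT.
by have [<-//|] := eqVneq w z; apply: subtree_interior.
Qed.

Lemma bprod_root w : interior w -> bprod (root T) w =
  \prod_(v | is_bcoord v) bpoly K v ^+ (v \in (tpath (root T) w :\ root T)%SET).
Proof.
move=> wi; rewrite /bprod [RHS](bigID (mem (tpath (root T) w :\ root T)%SET)) /=.
rewrite [X in _ * X]big1 ?mulr1.
  rewrite [RHS](eq_bigl (fun v => v \in (tpath (root T) w :\ root T)%SET)).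
    by apply: eq_bigr => v ->; rewrite expr1.
  move=> v; apply/andP/idP => [[]//|vw]; split=> //.
  exact: path_bcoord vw.
by move=> v /andP[_ /negPf ->]; rewrite expr0.
Qed.

(** As no b_v divides q or q', both exponents of b_v are its multiplicity in the difference of the
    p's: after cancelling a common power, the factors other than q do not involve b_v. *)
Lemma is_qpoly_unique i j q q' :
  is_qpoly i j q -> is_qpoly (K := K) (T := T) i j q' -> q = q'.
Proof.
move=> [[a aE] qb] [[a' a'E] q'b].
have exp_le (q1 q2 : {mpoly K[#|mcoord T|]}) (a1 a2 : T -> nat) :
    (forall v, is_bcoord v -> ~ exists g, q2 = bpoly K v * g) ->
    q1 * \prod_(v | is_bcoord v) bpoly K v ^+ a1 v =
    q2 * \prod_(v | is_bcoord v) bpoly K v ^+ a2 v ->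
    forall v, is_bcoord v -> (a1 v <= a2 v)%N.
  move=> q2b e v vb; rewrite leqNgt; apply/negP => lt.
  apply: (q2b v vb).
  have bv0 : bpoly K v ^+ a2 v != 0 by rewrite expf_neq0 // bpoly_neq0.
  move: e; rewrite (bigD1 v) //= [in RHS](bigD1 v) //=.
  set M1 := \prod_(_ | _) _; set M2 := \prod_(_ | _) _.
  rewrite -(subnK lt) -addSnnS addnC exprD => e.
  have {}e : M2 * q2 = bpoly K v * (bpoly K v ^+ (a1 v - (a2 v).+1) * M1 * q1).
    apply: (mulfI bv0); rewrite [LHS](_ : _ = q2 * (bpoly K v ^+ a2 v * M2)).
      by rewrite -e exprS; ring.
    by ring.
  rewrite (bpolyE vb) in e *; apply: subst0_fix_mulX e.
    rewrite /M2 /subst0 rmorph_prod; apply: eq_bigr => u /andP[ub uv].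
    rewrite rmorphXn; congr (_ ^+ _); rewrite bpolyE /= -/(subst0 _ _) subst0X.
    by rewrite (inj_eq enum_rank_inj) (inj_eq inr_inj) -(inj_eq val_inj) (negPf uv).
  apply/(@prodf_neq0 {mpoly K[#|mcoord T|]}) => u _.
  by rewrite expf_neq0 // bpoly_neq0.
have e : q * \prod_(v | is_bcoord v) bpoly K v ^+ a v =
    q' * \prod_(v | is_bcoord v) bpoly K v ^+ a' v by rewrite -aE a'E.
have aa' v : is_bcoord v -> a v = a' v.
  move=> vb; apply/eqP; rewrite eqn_leq (exp_le q q' a a') //.
  by rewrite (exp_le q' q a' a).
have M0 : \prod_(v | is_bcoord v) bpoly K v ^+ a v != 0.
  apply/(@prodf_neq0 {mpoly K[#|mcoord T|]}) => u _.
  by rewrite expf_neq0 // bpoly_neq0.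
apply: (mulIf M0); rewrite e; congr (_ * _).
by apply: eq_bigr => v vb; rewrite aa'.
Qed.

Definition xval (y : mcoord T -> K) v u : K := peval (xedge K v u) y.
Definition bval (y : mcoord T -> K) v : K := peval (bpoly K v) y.
Definition pval (y : mcoord T -> K) v u : K := peval (ppoly K v u) y.

Lemma pval_child y v c u : c \in incoming v -> u \in subtree c ->
  pval y v u = xval y v c + bval y c * pval y c u.
Proof. by move=> cv uc; rewrite /pval (ppoly_child cv uc) pevalD pevalM. Qed.

Lemma pvalxx y v : pval y v v = 0.
Proof. by rewrite /pval ppolyxx peval0. Qed.

Lemma bvalE y v (vb : is_bcoord v) : bval y v = y (inr (Sub v vb)).
Proof. by rewrite /bval bpolyE peval_coordX. Qed.

Lemma xval_s0 y v : xval y v (s0 v) = 0.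
Proof. by rewrite /xval /xedge eqxx peval0. Qed.

Lemma xval_s1 y v : interior v -> xval y v (s1 v) = 1.
Proof.
move=> vi; rewrite /xval /xedge eqxx eq_sym (negPf (s0_s1 vi)) peval1.
by [].
Qed.

Lemma xvalE y (e : {e : T * T | is_xcoord e}) :
  xval y (val e).1 (val e).2 = y (inl e).
Proof.
case: e => -[v u] /= e; have := e; rewrite /is_xcoord /= !inE => /and4P[_ u1 u0 _].
by rewrite /xval /xedge (negPf u0) (negPf u1) insubT peval_coordX.
Qed.

Lemma is_xcoordE v u : interior v -> u \in incoming v -> u != s0 v -> u != s1 v ->
  is_xcoord (v, u).
Proof. by move=> vi uv u0 u1; rewrite /is_xcoord /= vi in_setD1 in_setD1 u0 u1. Qed.

Lemma xval_inj y v : Yset y -> {in incoming v &, injective (xval y v)}.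
Proof.
move=> [y01 yinj] u w uv wv; have vi : interior v by apply/interiorP; exists u.
have cases u' : u' \in incoming v -> [\/ u' = s0 v, u' = s1 v |
    exists e : {e : T * T | is_xcoord e}, val e = (v, u')].
  move=> u'v; have [->|n0] := eqVneq u' (s0 v); first by constructor 1.
  have [->|n1] := eqVneq u' (s1 v); first by constructor 2.
  by constructor 3; exists (Sub (v, u') (is_xcoordE vi u'v n0 n1)).
have xE u' (e : {e : T * T | is_xcoord e}) : val e = (v, u') ->
    xval y v u' = y (inl e).
  by move=> eE; rewrite -xvalE eE.
case: (cases u uv) => [->|->|[e eE]]; case: (cases w wv) => [->|->|[e' e'E]] //.
- by rewrite xval_s0 xval_s1 // => /esym/eqP; rewrite oner_eq0.
- rewrite xval_s0 (xE _ _ e'E) => /esym/eqP.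
  by have [/negPf->] := y01 e'.
- by rewrite xval_s0 xval_s1 // => /eqP; rewrite oner_eq0.
- rewrite xval_s1 // (xE _ _ e'E) => /esym/eqP.
  by have [_ /negPf->] := y01 e'.
- by rewrite xval_s0 (xE _ _ eE) => /eqP; have [/negPf->] := y01 e.
- by rewrite xval_s1 // (xE _ _ eE) => /eqP; have [_ /negPf->] := y01 e.
rewrite (xE _ _ eE) (xE _ _ e'E) => /yinj; rewrite eE e'E => /(_ erefl) ee'.
by move: eE; rewrite ee' e'E => -[].
Qed.

Hypothesis char0 : [pchar K] =i pred0.

(* The most degenerate curve of the chart. *)
Lemma Yset_b0_ex :
  exists2 y : mcoord T -> K, Yset y & forall v, is_bcoord v -> bval y v = 0.
Proof.
(* The shift by 2 keeps the distinct values away from the reserved positions 0 and 1. *)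
exists (fun c : mcoord T =>
    match c with inl e => (enum_rank e).+2%:R | inr _ => 0 end); last first.
  by move=> v vb; rewrite bvalE.
split=> [c|c d _ /(natr_inj char0) [] /val_inj /enum_rank_inj //].
by split; apply/eqP; [move/(natr_inj char0 (b := 0%N))|move/(natr_inj char0 (b := 1%N))].
Qed.

(** The factor split off is the product of the b's from the root to the meet. The rest has no factor
    b_v, since where all b's vanish it is the difference of the positions of two distinct children
    of the meet. *)
Lemma qpolyE i j : i != j ->
  qpoly K T i j = ppoly K (meet T i j) (lab T i) - ppoly K (meet T i j) (lab T j).
Proof.
move=> ij; set w := meet T i j.
have wi : interior w := meet_interior stT ij.
have wij := meetP stT ij; rewrite -/w in wij; have /and3P[iw jw neq] := wij.
suff Hw : is_qpoly i j (ppoly K w (lab T i) - ppoly K w (lab T j)).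
  by apply: (@xget_unique _ 0 (is_qpoly i j) _ Hw) => q Hq; apply: is_qpoly_unique Hq Hw.
split.
  exists (fun v => v \in (tpath (root T) w :\ root T)%SET).
  by rewrite -bprod_root // (ppoly_sub_split (subtree_root w)) // mulrC.
move=> v vb [g /(congr1 (fun p => peval p))].
have [y Yy yb] := Yset_b0_ex.
move=> /(congr1 (fun h => h y)); rewrite pevalB pevalM -/(pval _ _ _) -/(pval _ _ _).
rewrite -/(bval y v) (yb v vb) mul0r.
have p_first l : lab T l \in subtree w ->
    pval y w (lab T l) = xval y w (first_step w (lab T l)).
  move=> lw; have [fw lf] := first_step_lab stT wi lw.
  rewrite (pval_child _ fw lf); set c := first_step w (lab T l) in fw lf *.
  have [ci|cl] := boolP (interior c).
    rewrite yb ?mul0r ?addr0 // /is_bcoord ci.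
    by apply/eqP; case/incomingP: fw.
  by rewrite (subtree_leaf cl lf) pvalxx mulr0 addr0.
rewrite !p_first // => /eqP; rewrite subr_eq0 => /eqP.
move/(xval_inj Yy) => e; move/eqP: neq; apply; apply: e.
  exact: (first_step_lab stT wi iw).1.
exact: (first_step_lab stT wi jw).1.
Qed.

Lemma XsetP y : Xset y <-> Yset y /\ forall i j, i != j ->
  pval y (meet T i j) (lab T i) != pval y (meet T i j) (lab T j).
Proof.
have qE i j : i != j -> peval (qpoly K T i j) y =
    pval y (meet T i j) (lab T i) - pval y (meet T i j) (lab T j).
  by move=> ij; rewrite qpolyE // pevalB.
split=> [[Yy nq]|[Yy p_neq]]; split=> //.
  move=> i j ij; rewrite -subr_eq0 -qE //; apply/eqP => q0.
  have [lt|lt|/val_inj e] := ltngtP i j; last by rewrite e eqxx in ij.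
    by apply: nq; exists i, j.
  apply: nq; exists j, i; split=> //; rewrite qpolyE; last by rewrite eq_sym.
  have ji : meet T j i = meet T i j.
    apply: (meetE stT); have /and3P[? ? ?] := meetP stT ij.
    by apply/and3P; split=> //; rewrite eq_sym.
  by rewrite ji -opprB -qpolyE // /peval mevalN -/(peval _ _) q0 oppr0.
move=> [i [j [lt q0]]]; have ij : i != j by rewrite neq_ltn lt.
by have := p_neq i j ij; rewrite -subr_eq0 -qE // q0 eqxx.
Qed.

End LocalModel.

(** * The curves of a chart *)

Section ContractedTrees.
Variables (T : rtree) (keep : pred T) (keep_root : keep (root T)).
Local Notation T' := (contraction keep_root).
Implicit Types (u v w : T').
Local Notation e := (@enum_val T keep).

Lemma contr_root_val : e (root T') = root T.
Proof. exact: enum_rankK_in. Qed.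

Lemma contr_keep v : keep (e v).
Proof. exact: (enum_valP v). Qed.

Lemma keepE (z : T) : keep z -> exists v, e v = z.
Proof. by move=> kz; exists (enum_rank_in kz z); rewrite enum_rankK_in. Qed.

(** The default in [contr_par] is never reached off the root: a kept vertex with smallest subtree
    strictly containing that of u has no kept vertex in between. *)
Lemma contr_par_step u v : u != root T' ->
  par u = v -> e u \in contr_incoming keep (e v).
Proof.
move=> ur <- /=; rewrite /contr_par; case: pickP => [w //|nopick].
pose P (w : T') := (e u \in subtree (e w)) && (w != u).
have Pr : P (root T').
  by rewrite /P eq_sym ur contr_root_val subtree_root.
case: (@arg_minnP _ (root T') P (fun w => #|subtree (e w)|)) => // w /andP[uw wu] wmin.
have := nopick w; rewrite /contr_incoming inE in_setD1 uw contr_keep.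
rewrite (inj_eq enum_val_inj) eq_sym wu /= => /negbT /negP; case; apply/forall_inP => z.
rewrite !in_setD1 inE => /and3P[zu zw /andP[zw' uz]].
apply/negP => /keepE[z' z'E]; have := wmin z'.
rewrite /P z'E uz -(inj_eq enum_val_inj) z'E zu.
move=> /(_ isT); apply/negP; rewrite -ltnNge; apply/proper_card/properP; split.
  by apply/fintype.subsetP => x xz; apply: subtree_trans xz zw'.
exists (e w); first exact: subtree_refl.
by apply/negP => wz; move/eqP: zw; apply; apply: subtree_anti.
Qed.

Lemma contr_subtree u v : (u \in subtree v) = (e u \in subtree (e v)).
Proof.
apply/idP/idP.
  move=> /subtree_iterP[n <-]; elim: n => [|n IHn]; first exact: subtree_refl.
  rewrite iterS; set w := iter n _ _ in IHn *.
  apply: subtree_trans IHn _; have [->|wr] := eqVneq w (root T').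
    by rewrite par_root subtree_refl.
  have := contr_par_step wr erefl; rewrite inE in_setD1 => /andP[/andP[_ ?] _].
  by [].
have [n] := ubnP (#|subtree (e v)| - #|subtree (e u)|)%N; elim: n u => // n IHn u un uv.
have [->|neq] := eqVneq u v; first exact: subtree_refl.
have ur : u != root T'.
  apply: contraNneq neq => ur; apply/eqP/enum_val_inj; apply: subtree_anti => //.
  by rewrite ur contr_root_val subtree_root.
have := contr_par_step ur erefl; set w := par u => uw.
have uw' : u \in subtree w by apply/subtree_iterP; exists 1%N.
apply: subtree_trans uw' _; move: uw; rewrite inE in_setD1.
move=> /andP[/andP[neq' uw] /andP[_ /forall_inP no_keep]].
have wv : e w \in subtree (e v).
  have [//|vw] := subtree_chain uw uv.
  have [->|vw'] := eqVneq v w; first exact: subtree_refl.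
  have := no_keep (e v); rewrite contr_keep !in_setD1 inE vw uv.
  by rewrite !(inj_eq enum_val_inj) eq_sym neq vw' => /(_ isT).
apply: IHn => //.
have : (#|subtree (e u)| < #|subtree (e w)|)%N.
  apply/proper_card/properP; split.
    by apply/fintype.subsetP => x xz; apply: subtree_trans xz uw.
  exists (e w); first exact: subtree_refl.
  by apply/negP => wu; move/eqP: neq'; apply; apply: subtree_anti.
have : (#|subtree (e w)| <= #|subtree (e v)|)%N.
  apply: subset_leq_card.
  by apply/fintype.subsetP => x xz; apply: subtree_trans xz wv.
by move: un; lia.
Qed.

(** The vertex into which z is merged by the contraction. *)
Lemma contr_lowest (z : T) : exists v, z \in subtree (e v) /\
  forall x, x \in subtree (e v) -> z \in subtree x -> keep x -> x = e v.
Proof.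
pose P (w : T') := z \in subtree (e w).
have Pr : P (root T') by rewrite /P contr_root_val subtree_root.
case: (@arg_minnP _ (root T') P (fun w => #|subtree (e w)|)) => // w zw wmin.
exists w; split=> // x xw zx /keepE[x' x'E].
have := wmin x'; rewrite /P x'E => /(_ zx) le; apply: subtree_anti => //.
apply: contraLR le => wx; rewrite -ltnNge; apply/proper_card/properP; split.
  by apply/fintype.subsetP => y yx; apply: subtree_trans yx xw.
by exists (e w); first exact: subtree_refl.
Qed.

End ContractedTrees.

Section ChartCurves.
Variables (K : closedFieldType) (r : nat) (T : sliced_tree r).
Hypothesis char0 : [pchar K] =i pred0.
Implicit Types z w : T.
Let stT : stable_tree T := stree_stable T.

Section Point.
Variable y : mcoord T -> K.
Hypothesis Xy : Xset y.
Local Notation c := (chart_curve y).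
Local Notation T' := (chart_tree y).
Local Notation e := (@enum_val T (kept y)).
Implicit Types u v : ctree c.

Let pq_neq i j : i != j ->
  pval y (meet T i j) (lab T i) != pval y (meet T i j) (lab T j).
Proof. by case/(XsetP char0): Xy => _; apply. Qed.

Let e_lab i : e (lab T' i) = lab T i.
Proof. by rewrite /= enum_rankK_in //; apply: kept_lab. Qed.

Let sub_e u v : (u \in subtree v) = (e u \in subtree (e v)).
Proof. exact: contr_subtree. Qed.

Let lab_sub i v : (lab T' i \in subtree v) = (lab T i \in subtree (e v)).
Proof. by rewrite sub_e e_lab. Qed.

Let e_inj : injective e. Proof. exact: enum_val_inj. Qed.

Let chart_leaf v : ~~ interior v <-> exists i, lab T' i = v.
Proof.
split=> [vl|[i <-]].
  have [i iv] := leaf_below stT (e v); exists i; apply: subtree_leaf vl _.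
  by rewrite lab_sub.
apply/interiorP => -[u ui]; have := incoming_neq ui; rewrite -(inj_eq e_inj) e_lab.
have := incoming_subtree ui; rewrite sub_e e_lab => /(subtree_leaf (lab_leaf stT i)) ->.
by rewrite eqxx.
Qed.

Let first_step_chart v i : interior v -> lab T i \in subtree (e v) ->
  let u := first_step v (lab T' i) in u \in incoming v /\ lab T i \in subtree (e u).
Proof.
move=> vi; rewrite -lab_sub => iv /=.
have [|fu iu] := first_stepP iv; last by rewrite -lab_sub.
by apply: contraTneq vi => <-; apply/chart_leaf; exists i.
Qed.

Let interior_e v : interior v -> interior (e v).
Proof.
move=> /interiorP[u uv]; apply: (@subtree_interior _ (e u)).
  by rewrite -sub_e incoming_subtree.
by rewrite (inj_eq e_inj); exact: (incoming_neq uv).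
Qed.

Lemma chart_tree_stable : stable_tree T'.
Proof.
split; first by move=> i j /(congr1 e); rewrite !e_lab => /(lab_inj stT).
  exact: chart_leaf.
move=> v vi; have [i [j ij]] := meet_ex stT (interior_e vi).
have /and3P[iv jv _] := ij; have ij' := is_meet_neq ij.
have [ui iu] := first_step_chart vi iv; have [uj ju] := first_step_chart vi jv.
apply/card_gt1P; exists (first_step v (lab T' i)), (first_step v (lab T' j)).
split=> //; apply/eqP => e_ij; rewrite -e_ij in ju.
have := meet_subtree stT ij' iu ju; rewrite (meetE stT ij) -sub_e.
by apply/negP/incoming_notin.
Qed.

Lemma bval_bprod z w : peval (bprod K z w) y =
  \prod_(x in (tpath z w :\ z)%SET) bval y x.
Proof. exact: peval_prod. Qed.

Lemma pval_split z w (u : T) : w \in subtree z -> u \in subtree w ->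
  pval y z u = pval y z w + peval (bprod K z w) y * pval y w u.
Proof. by move=> wz uw; rewrite /pval (ppoly_split K wz uw) pevalD pevalM. Qed.

Let bval_child u v : u \in incoming v -> interior (e u) -> bval y (e u) = 0.
Proof.
move=> /incomingP[ur _] ui; have := contr_keep u; rewrite /kept ui /=.
case/orP=> [/eqP er|/eqP//]; case: ur; apply: e_inj; rewrite er.
by rewrite (contr_root_val (kept_root y)).
Qed.

(* Below a node the coordinates do not change since its smoothing parameter
   vanishes. *)
Let pval_child_lab u v i : u \in incoming v -> lab T i \in subtree (e u) ->
  pval y (e v) (e u) = pval y (e v) (lab T i).
Proof.
move=> uv iu; have euv : e u \in subtree (e v) by rewrite -sub_e incoming_subtree.
rewrite (pval_split euv iu).
have [ui|ul] := boolP (interior (e u)); last first.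
  by rewrite (subtree_leaf ul iu) pvalxx mulr0 addr0.
rewrite bval_bprod (bigD1 (e u)) /=.
  by rewrite (bval_child uv ui) !mul0r addr0.
rewrite in_setD1 tpathP euv subtree_refl !andbT (inj_eq e_inj).
exact: (incoming_neq uv).
Qed.

Lemma chart_pos v i : interior v -> lab T i \in subtree (e v) ->
  pos (c := c) v i = pval y (e v) (lab T i).
Proof.
move=> vi iv; have [uv iu] := first_step_chart vi iv.
by rewrite -(pval_child_lab uv iu).
Qed.

Lemma chart_curve_stable : stable_curve c.
Proof.
split; first exact: chart_tree_stable.
move=> v u u' uv u'v.
have [i iu] := leaf_below stT (e u); have [j ju] := leaf_below stT (e u').
have -> : marking v u = pval y (e v) (lab T i) by rewrite -(pval_child_lab uv iu).
have -> : marking v u' = pval y (e v) (lab T j) by rewrite -(pval_child_lab u'v ju).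
move=> pij; apply/eqP/negPn/negP => neq.
have euv : e u \in subtree (e v) by rewrite -sub_e incoming_subtree.
have eu'v : e u' \in subtree (e v) by rewrite -sub_e incoming_subtree.
have iv := subtree_trans iu euv; have jv := subtree_trans ju eu'v.
have ij : i != j.
  apply: contraNneq neq => ij; rewrite -ij in ju.
  by apply/eqP; apply: (incoming_uniq (u := lab T' i) uv u'v); rewrite lab_sub.
have mv := meet_subtree stT ij iv jv.
move: pij; rewrite (pval_split mv (meetl stT ij)) (pval_split mv (meetr stT ij)).
move/addrI; have := pq_neq ij; set B := peval _ _ => pq.
have [B0|B0] := eqVneq B 0; last by move/(mulfI B0)/eqP; rewrite (negPf pq).
(* A vanishing b_z strictly after v makes z a vertex of the contraction. It lies in the subtree of a
   single child of v, which then contains both i and j and equals both u and u'. *)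
move: B0; rewrite /B bval_bprod => /eqP/prodf_eq0[z].
rewrite in_setD1 tpathP => /and3P[zv zev mz] bz0 _.
have [z' z'E] : exists z' : ctree c, e z' = z.
  apply: (keepE (kept_root y)); apply/or3P; constructor 3; exact: bz0.
have [||d dv zd] := @subtree_child _ z' v; first by rewrite sub_e z'E.
  by rewrite -(inj_eq e_inj) z'E.
have sub_d l : lab T l \in subtree (meet T i j) -> lab T' l \in subtree d.
  by move=> lm; apply: subtree_trans zd; rewrite lab_sub z'E; apply: subtree_trans mz.
move/eqP: neq; apply.
rewrite (incoming_uniq (u := lab T' i) uv dv) ?lab_sub // -?lab_sub ?sub_d ?meetl //.
by rewrite (incoming_uniq (u := lab T' j) u'v dv) // ?lab_sub // -lab_sub sub_d ?meetr.
Qed.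

(** A contracted vertex w serves as well: all b's between w and the vertex it is merged into are
    nonzero, so the two coordinates differ by an invertible affine map. *)
Lemma chart_coordinate w i j k : j != k -> lab T i \in subtree w ->
  lab T j \in subtree w -> lab T k \in subtree w ->
  let p l := pval y w (lab T l) in
  (p i - p j != 0) || (p k - p j != 0) ->
  coordinate c j k i = proj (p i - p j) (p k - p j).
Proof.
move=> jk iw jw kw p neq.
have [v [wv low]] := contr_lowest (kept_root y) w.
have sub_v l : lab T l \in subtree w -> lab T' l \in subtree v.
  by move=> lw; rewrite lab_sub; apply: subtree_trans wv.
have vi := lab_subtree_interior chart_tree_stable jk (sub_v _ jw) (sub_v _ kw).
pose B := peval (bprod K (e v) w) y.
have B0 : B != 0.
  rewrite /B bval_bprod; apply/prodf_neq0 => z; rewrite in_setD1 tpathP.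
  move=> /and3P[zv zev wz]; apply: contraNneq zv => bz0; apply/eqP/low => //.
  by apply/or3P; constructor 3; apply/eqP.
have posE l : lab T l \in subtree w ->
    pos (c := c) v l = pval y (e v) w + B * p l.
  by move=> lw; rewrite chart_pos -?lab_sub ?sub_v // (pval_split wv lw).
have E a b : lab T a \in subtree w -> lab T b \in subtree w ->
    pos (c := c) v a - pos (c := c) v b = B * (p a - p b).
  by move=> aw bw; rewrite !posE //; ring.
rewrite (coordinate_proj chart_curve_stable (v := v) jk) ?sub_v //.
  by rewrite !E // proj_scale.
by rewrite !E // !mulf_eq0 (negPf B0).
Qed.

End Point.
End ChartCurves.

(** * Chart coordinates recovered from the f_jk(i) *)

Section ChartInverse.
Variables (K : closedFieldType) (r : nat) (T : sliced_tree r).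
Hypothesis char0 : [pchar K] =i pred0.
Implicit Types (v w z : T) (i j k : 'I_r) (y : mcoord T -> K).
Let stT : stable_tree T := stree_stable T.

Definition chart_coord y : 'I_r -> 'I_r -> 'I_r -> option K :=
  coordinate (chart_curve y).

Lemma pval_s0_leaf y v : pval y v (lab T (s0_leaf v)) = 0.
Proof.
elim/tree_ind: v => v IH; have [vi|vl] := boolP (interior v); last first.
  by rewrite (subtree_leaf vl (s0_leaf_subtree v)) pvalxx.
have s0v := s0_in vi.
rewrite -(s0_leaf_interior vi) (pval_child y s0v (s0_leaf_subtree _)).
by rewrite IH // mulr0 addr0 xval_s0.
Qed.

Lemma pval_child_leaf y v w : w \in incoming v ->
  pval y v (lab T (s0_leaf w)) = xval y v w.
Proof.
by move=> wv; rewrite (pval_child y wv (s0_leaf_subtree _)) pval_s0_leaf mulr0 addr0.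
Qed.

Lemma pval_s1_leaf y v : interior v -> pval y v (lab T (s0_leaf (s1 v))) = 1.
Proof. by move=> vi; rewrite pval_child_leaf ?xval_s1 ?s1_in. Qed.

Lemma slice_chart_coord y v i : Xset y -> interior v -> lab T i \in subtree v ->
  slice_coord (chart_coord y) v i = Some (pval y v (lab T i)).
Proof.
move=> Xy vi iv; have vm := slice_is_meet vi; have /and3P[av bv _] := vm.
rewrite /slice_coord /chart_coord (chart_coordinate char0 Xy (is_meet_neq vm) iv av bv).
  by rewrite pval_s0_leaf pval_s1_leaf // !subr0 proj_fin ?oner_neq0 // divr1.
by rewrite pval_s0_leaf pval_s1_leaf // !subr0 oner_neq0 orbT.
Qed.

Lemma chart_coord_compatible y : Xset y -> compatible T (chart_coord y).
Proof.
move=> Xy i j ij /=; have vi := meet_interior stT ij.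
rewrite !slice_chart_coord ?meetl ?meetr //=.
have /(XsetP char0)[_ /(_ i j ij)] := Xy.
by apply: contraNneq => -[->].
Qed.

Definition chart_inv (f : 'I_r -> 'I_r -> 'I_r -> option K) (c : mcoord T) : K :=
  let g v i := odflt 0 (slice_coord f v i) in
  match c with
  | inl e => g (val e).1 (s0_leaf (val e).2)
  | inr v => g (par (val v)) (s0_leaf (s1 (val v))) - g (par (val v)) (s0_leaf (val v))
  end.

Lemma is_bcoordP v : is_bcoord v -> interior v /\ v \in incoming (par v).
Proof. by case/andP=> vi vr; split=> //; apply/incomingP; split=> //; apply/eqP. Qed.

Lemma xcoord_leaf (e : {e : T * T | is_xcoord e}) :
  [/\ interior (val e).1, (val e).2 \in incoming (val e).1
    & lab T (s0_leaf (val e).2) \in subtree (val e).1].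
Proof.
have /andP[vi] := valP e; rewrite 2!in_setD1 => /and3P[_ _ uv]; split=> //.
exact: subtree_trans (s0_leaf_subtree _) (incoming_subtree uv).
Qed.

Lemma bcoord_leaves v : is_bcoord v -> [/\ interior (par v),
  lab T (s0_leaf v) \in subtree (par v)
  & lab T (s0_leaf (s1 v)) \in subtree (par v)].
Proof.
move=> /is_bcoordP[vi vpar]; split; first by apply/interiorP; exists v.
  exact: subtree_trans (s0_leaf_subtree v) (incoming_subtree vpar).
apply: subtree_trans (s0_leaf_subtree _) _.
exact: subtree_trans (incoming_subtree (s1_in vi)) (incoming_subtree vpar).
Qed.

Lemma chart_coordK y : Xset y -> chart_inv (chart_coord y) = y.
Proof.
move=> Xy; apply: funext => -[e|[v vb]] /=.
  have [vi uv iv] := xcoord_leaf e.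
  by rewrite slice_chart_coord //= pval_child_leaf // xvalE.
have [vi vpar] := is_bcoordP vb; have [pi iv jv] := bcoord_leaves vb.
have s1v := subtree_trans (s0_leaf_subtree (s1 v)) (incoming_subtree (s1_in vi)).
have s0v := s0_leaf_subtree v.
rewrite !slice_chart_coord //= !(pval_child y vpar) //.
by rewrite pval_s0_leaf pval_s1_leaf // bvalE; ring.
Qed.

Section Inverse.
Variable f : 'I_r -> 'I_r -> 'I_r -> option K.
Hypotheses (admf : admissible f) (compf : compatible T f).

Lemma slice_coord_fin v i : interior v -> lab T i \in subtree v ->
  slice_coord f v i = Some (odflt 0 (slice_coord f v i)).
Proof.
move=> vi iv; have [j vij] := meet_other stT vi iv.
have /= := compf (is_meet_neq vij); rewrite (meetE stT vij) => /and3P[+ _ _].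
by case: slice_coord.
Qed.

Lemma slice_coord_neq i j : i != j ->
  slice_coord f (meet T i j) i != slice_coord f (meet T i j) j.
Proof. by move=> /compf /= /and3P[]. Qed.

Lemma slice_coord_neq0 v i j : is_meet v i j ->
  odflt 0 (slice_coord f v i) - odflt 0 (slice_coord f v j) != 0.
Proof.
move=> vij; have ij := is_meet_neq vij; have /and3P[iv jv _] := vij.
have vi := lab_subtree_interior stT ij iv jv.
have := slice_coord_neq ij; rewrite (meetE stT vij) subr_eq0.
apply: contraNneq => e.
by rewrite (slice_coord_fin vi iv) (slice_coord_fin vi jv) e.
Qed.

(** Induction along [pval_child]. If the child u has its base leaves at a and b in the coordinate of
    v, then b_u = b - a, and [adm_proj] says that i is at a + (b - a) f_u(i). *)
Lemma pval_chart_inv v i : interior v -> lab T i \in subtree v ->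
  pval (chart_inv f) v (lab T i) = odflt 0 (slice_coord f v i).
Proof.
elim/tree_ind: v => v IH vi iv; have [uv iu] := first_step_lab stT vi iv.
set u := first_step v (lab T i) in uv iu *.
have vm := slice_is_meet vi; have ab := is_meet_neq vm.
have xE : xval (chart_inv f) v u = odflt 0 (slice_coord f v (s0_leaf u)).
  have [u0|u0] := eqVneq u (s0 v).
    by rewrite u0 xval_s0 s0_leaf_interior // /slice_coord (adm0 admf ab).
  have [u1|u1] := eqVneq u (s1 v).
    by rewrite u1 xval_s1 // /slice_coord (adm1 admf ab).
  have xc := is_xcoordE vi uv u0 u1.
  by rewrite (xvalE _ (Sub (v, u) xc : {e : T * T | is_xcoord e})).
rewrite (pval_child _ uv iu) xE.
have [uint|uleaf] := boolP (interior u); last first.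
  rewrite -(subtree_leaf uleaf iu) pvalxx mulr0 addr0 s0_leaf_lab.
  by [].
rewrite (IH u) //.
have ub : is_bcoord u by rewrite /is_bcoord uint; apply/eqP; case/incomingP: uv.
have -> : bval (chart_inv f) u = odflt 0 (slice_coord f v (s0_leaf (s1 u))) -
    odflt 0 (slice_coord f v (s0_leaf u)).
  by rewrite (bvalE _ ub) /=; have /incomingP[_ ->] := uv.
have um := slice_is_meet uint; have /and3P[cu du _] := um.
have sub_v l : lab T l \in subtree u -> lab T l \in subtree v.
  by move=> /subtree_trans; apply; apply: incoming_subtree.
have fin l : lab T l \in subtree u ->
    slice_coord f v l = Some (odflt 0 (slice_coord f v l)).
  by move=> lu; apply: slice_coord_fin => //; apply: sub_v.
move: (fin _ iu) (fin _ cu) (fin _ du).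
set a := odflt 0 (slice_coord f v (s0_leaf u)).
set b := odflt 0 (slice_coord f v (s0_leaf (s1 u))).
set x := odflt 0 (slice_coord f v i) => fi fa fb.
(* At a node b_u = 0 the whole subtree of u may sit at the point a, where [adm_proj] gives no
   information. *)
have [/andP[/eqP xa /eqP ba]|neq] := boolP ((x - a == 0) && (b - a == 0)).
  by rewrite ba mul0r addr0; apply/eqP; rewrite eq_sym -subr_eq0 xa.
rewrite negb_and in neq.
have := adm_proj admf (is_meet_neq um) fa fb fi neq.
rewrite -/(slice_coord f u i) (slice_coord_fin uint iu) /proj.
by case: eqVneq => // ba0 [->]; rewrite mulrC divfK // addrC subrK.
Qed.

Lemma chart_inv_Xset : Xset (chart_inv f).
Proof.
have leaf_neq v w w' : w \in incoming v -> w' \in incoming v -> w != w' ->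
    odflt 0 (slice_coord f v (s0_leaf w)) != odflt 0 (slice_coord f v (s0_leaf w')).
  move=> wv w'v ww'; rewrite -subr_eq0; apply: slice_coord_neq0.
  by apply: is_meet_children wv w'v ww' _ _; apply: s0_leaf_subtree.
have e_in (e : {e : T * T | is_xcoord e}) : [/\ interior (val e).1,
    (val e).2 \in incoming (val e).1, (val e).2 != s0 (val e).1
    & (val e).2 != s1 (val e).1].
  by have /andP[vi] := valP e; rewrite 2!in_setD1 => /and3P[? ? ?].
apply/(XsetP char0); split; last first.
  move=> i j ij; have vi := meet_interior stT ij.
  rewrite !pval_chart_inv ?meetl ?meetr //.
  by rewrite -subr_eq0; apply: slice_coord_neq0; apply: meetP.
split=> [e|e e' ee'] /=.
  have [vi uv u0 u1] := e_in e; have ab := is_meet_neq (slice_is_meet vi).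
  have := leaf_neq _ _ _ uv (s0_in vi) u0; have := leaf_neq _ _ _ uv (s1_in vi) u1.
  rewrite (s0_leaf_interior vi) /slice_coord (adm0 admf ab) (adm1 admf ab).
  by [].
have [_ uv _ _] := e_in e; have [_ u'v _ _] := e_in e'.
rewrite -ee' in u'v * => E; apply/val_inj; apply: injective_projections => //.
by apply/eqP/negPn/negP => /(leaf_neq _ _ _ uv u'v); rewrite E eqxx.
Qed.

(** Both sides are the same quotient at a vertex where the three leaves are not all at one point:
    the meet of j and k or, if i is outside its subtree, the meet of i and j, whose subtree then
    contains k. *)
Lemma chart_invK : chart_coord (chart_inv f) = f.
Proof.
have Xf := chart_inv_Xset.
apply: funext => j; apply: funext => k; apply: funext => i.
have [->|jk] := eqVneq j k.
  by rewrite /chart_coord /coordinate eqxx (adm_diag admf).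
have main w : lab T i \in subtree w -> lab T j \in subtree w ->
    lab T k \in subtree w ->
    let g l := odflt 0 (slice_coord f w l) in
    (g i - g j != 0) || (g k - g j != 0) -> chart_coord (chart_inv f) j k i = f j k i.
  move=> iw jw kw g neq; have wi := lab_subtree_interior stT jk jw kw.
  have fin l : lab T l \in subtree w -> slice_coord f w l = Some (g l).
    exact: slice_coord_fin.
  rewrite (adm_proj admf jk (fin _ jw) (fin _ kw) (fin _ iw) neq).
  rewrite /chart_coord (chart_coordinate char0 Xf jk iw jw kw);
    by rewrite !pval_chart_inv.
have vm := meetP stT jk; have /and3P[jv kv _] := vm.
have [iv|iv] := boolP (lab T i \in subtree (meet T j k)).
  apply: (main _ iv jv kv); rewrite orbC -opprB oppr_eq0.
  by rewrite (slice_coord_neq0 vm).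
have ij : i != j by apply: contraNneq iv => ->.
have wm := meetP stT ij; have /and3P[iw jw _] := wm.
have kw : lab T k \in subtree (meet T i j).
  have [mw|wv] := subtree_chain jv jw; first exact: subtree_trans mw.
  by rewrite (subtree_trans iw wv) in iv.
by apply: (main _ iw jw kw); rewrite (slice_coord_neq0 wm).
Qed.

End Inverse.
(** The vertex w used for f_jk(i) is chosen from i, j, k and T alone, so one pair of polynomials
    without common zero on X_T serves all points of the chart. *)
Lemma chart_coord_polys j k i : j != k -> exists P Q : {mpoly K[#|mcoord T|]},
  forall y, Xset y -> ((peval P y != 0) || (peval Q y != 0)) /\
    chart_coord y j k i = proj (peval P y) (peval Q y).
Proof.
move=> jk.
have main w : lab T i \in subtree w -> lab T j \in subtree w ->
    lab T k \in subtree w -> is_meet w j k || is_meet w i j ->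
    exists P Q : {mpoly K[#|mcoord T|]},
    forall y, Xset y -> ((peval P y != 0) || (peval Q y != 0)) /\
      chart_coord y j k i = proj (peval P y) (peval Q y).
  move=> iw jw kw wm.
  exists (ppoly K w (lab T i) - ppoly K w (lab T j)).
  exists (ppoly K w (lab T k) - ppoly K w (lab T j)) => y Xy.
  rewrite !pevalB -!/(pval y w _); have [_ pneq] := (XsetP char0 y).1 Xy.
  have neq : (pval y w (lab T i) - pval y w (lab T j) != 0) ||
      (pval y w (lab T k) - pval y w (lab T j) != 0).
    case/orP: wm => m; have := pneq _ _ (is_meet_neq m); rewrite (meetE stT m).
      by rewrite eq_sym !subr_eq0 => ->; rewrite orbT.
    by rewrite !subr_eq0 => ->.
  split=> //; exact: chart_coordinate.
have vm := meetP stT jk; have /and3P[jv kv _] := vm.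
have [iv|iv] := boolP (lab T i \in subtree (meet T j k)).
  by apply: (main _ iv jv kv); rewrite vm.
have ij : i != j by apply: contraNneq iv => ->.
have wm := meetP stT ij; have /and3P[iw jw _] := wm.
have kw : lab T k \in subtree (meet T i j).
  have [mw|wv] := subtree_chain jv jw; first exact: subtree_trans mw.
  by rewrite (subtree_trans iw wv) in iv.
by apply: (main _ iw jw kw); rewrite wm orbT.
Qed.

End ChartInverse.

(** * The atlas of the moduli space *)

Lemma proj_eq (K : closedFieldType) (p q p' q' : K) :
  (p != 0) || (q != 0) -> (p' != 0) || (q' != 0) ->
  (proj p q == proj p' q') = (p * q' - p' * q == 0).
Proof.
rewrite /proj subr_eq0.
case: (eqVneq q 0) => [->|q0]; case: (eqVneq q' 0) => [->|q'0];
  rewrite ?orbF ?mulr0 ?eqxx //=.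
- by move=> p0 _; apply/esym/negbTE/mulf_neq0.
- by move=> _ p'0; apply/esym/negbTE; rewrite eq_sym; apply: mulf_neq0.
move=> _ _; apply/eqP/eqP => [[e]|e].
  by rewrite -[p](divfK q0) e mulrAC divfK.
congr Some; apply: (mulIf q0); rewrite divfK //; apply: (mulIf q'0).
by rewrite e mulrAC divfK.
Qed.

Lemma spec_peval (K : closedFieldType) (W : Type) (H : set ((W -> K) * K))
    (I : finType) (P : {mpoly K[#|I|]}) (t : W -> I -> K) (v : I -> K) :
  max_specialization H -> (forall i, H (fun x => t x i, v i)) ->
  H (fun x => peval P (t x), peval P v).
Proof.
move=> maxH Ht.
(* [None] plays the ideal point: a function on [option W] packs a function on W with its value
   there. *)
pose S : set (option W -> K) := [set g : option W -> K | H (fun x => g (Some x), g None)].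
apply: (@fun_alg_peval K I P (option W) (fun x => oapp t v x) S) => //.
split=> [c|f g|f g]; first exact: spec_cst.
  exact: specD.
exact: specM.
Qed.

Section ModuliSpace.
Variables (K : closedFieldType) (r : nat).
Hypothesis char0 : [pchar K] =i pred0.
Implicit Types (T S : sliced_tree r) (i j k : 'I_r).
Local Notation M := (Mbar K r).

Definition point_coord (m : set (curve K r)) : 'I_r -> 'I_r -> 'I_r -> option K :=
  if pselect (exists c, stable_curve c /\ iso_class c = m) is left e
  then coordinate (sval (cid e)) else fun _ _ _ => None.

Lemma point_coord_class c : stable_curve c -> point_coord (iso_class c) = coordinate c.
Proof.
move=> stc; rewrite /point_coord; case: pselect => [e|[]]; last by exists c.
by case: cid => d [std dE] /=; apply/iso_class_eq.
Qed.

Lemma point_coord_inj m m' : carrier M m -> carrier M m' ->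
  point_coord m = point_coord m' -> m = m'.
Proof.
move=> [c stc <-] [d std <-]; rewrite !point_coord_class //.
by move/(iso_class_eq stc std).
Qed.

Lemma point_coord_admissible m : carrier M m -> admissible (point_coord m).
Proof.
by move=> [c stc <-]; rewrite point_coord_class //; apply: coordinate_admissible.
Qed.

Lemma phi_carrier T (y : mcoord T -> K) : Xset y -> carrier M (phi y).
Proof. by move=> Xy; exists (chart_curve y) => //; apply: chart_curve_stable. Qed.

Lemma point_coord_phi T (y : mcoord T -> K) : Xset y ->
  point_coord (phi y) = chart_coord y.
Proof. by move=> Xy; apply: point_coord_class; apply: chart_curve_stable. Qed.

Lemma phi_chart_inv T m : carrier M m -> compatible T (point_coord m) ->
  Xset (@chart_inv K r T (point_coord m)) /\ phi (@chart_inv K r T (point_coord m)) = m.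
Proof.
move=> Mm Tm; have admm := point_coord_admissible Mm.
have Xm := chart_inv_Xset char0 admm Tm; split=> //.
apply: point_coord_inj => //; first exact: phi_carrier.
by rewrite point_coord_phi // chart_invK.
Qed.

Lemma in_chartP T m : carrier M m ->
  ((@phi K r T) @` (@Xset K r T)) m <-> compatible T (point_coord m).
Proof.
move=> Mm; split=> [[y Xy <-]|Tm].
  by rewrite point_coord_phi //; apply: chart_coord_compatible.
have [Xm mE] := phi_chart_inv Mm Tm.
by exists (@chart_inv K r T (point_coord m)).
Qed.

Lemma chart_inv_phi T S (y : mcoord T -> K) : Xset y -> compatible S (chart_coord y) ->
  Xset (@chart_inv K r S (chart_coord y)) /\
  phi (@chart_inv K r S (chart_coord y)) = phi y.
Proof.
by move=> Xy; rewrite -point_coord_phi // => /phi_chart_inv; apply; apply: phi_carrier.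
Qed.

(** * Regularity of the transition maps and openness of the charts *)

Section Regularity.
Variables (T : sliced_tree r) (y : mcoord T -> K).
Hypothesis Xy : Xset y.
Let X : set (mcoord T -> K) := @Xset K r T.

Lemma chart_coord_reg j k i : chart_coord y j k i != None ->
  znear X y (fun w => chart_coord w j k i != None) /\
  reg_at X y (fun w => odflt 0 (chart_coord w j k i)).
Proof.
have [->|jk] := eqVneq j k; first by rewrite /chart_coord /coordinate eqxx.
have [P [Q PQ]] := chart_coord_polys T char0 i jk.
have [_ ->] := PQ _ Xy; rewrite /proj; case: (eqVneq (peval Q y) 0) => // Q0 _.
have nE : znear X y (fun w => peval Q w != 0) by apply: znear_neq0.
split.
  apply: znearS nE _ => w Xw Qw; have [_ ->] := PQ _ Xw.
  by rewrite proj_fin.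
apply: reg_at_eq (reg_at_frac X P Q0); apply: znearS nE _ => w Xw Qw.
by have [_ ->] := PQ _ Xw; rewrite proj_fin.
Qed.

Lemma compatible_near S : compatible S (chart_coord y) ->
  znear X y (fun w => compatible S (chart_coord w)).
Proof.
move=> Sy; apply: znear_forall => i; apply: znear_forall => j.
apply: znear_implyb => ij; have /= /and3P[fi fj neq] := Sy i j ij.
have [ni ri] := chart_coord_reg fi; have [nj rj] := chart_coord_reg fj.
have rij := fun_algB (reg_at_alg X y) ri rj.
have ij0 : odflt 0 (slice_coord (chart_coord y) (meet S i j) i) -
    odflt 0 (slice_coord (chart_coord y) (meet S i j) j) != 0.
  rewrite subr_eq0; apply: contraNneq neq; move: fi fj.
  by case: slice_coord => // a; case: slice_coord => //= b _ _ ->.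
have nij := reg_at_neq0 Xy rij ij0.
apply: znearS (znearI ni (znearI nj nij)) _ => w Xw [/= wi [wj wij]].
apply/and3P; split=> //; apply: contraNneq wij => e.
by rewrite -/(slice_coord _ _ i) -/(slice_coord _ _ j) e subrr.
Qed.

Lemma transition_reg S : compatible S (chart_coord y) ->
  forall c, reg_at X y (fun w => @chart_inv K r S (chart_coord w) c).
Proof.
move=> Sy; have reg v i : interior v -> lab S i \in subtree v ->
    reg_at X y (fun w => odflt 0 (slice_coord (chart_coord w) v i)).
  move=> vi iv; apply: (chart_coord_reg _).2.
  by have := slice_coord_fin Sy vi iv; rewrite /slice_coord => ->.
case=> [e|[v vb]] /=; first by have [vi _ iv] := xcoord_leaf e; apply: reg.
have [pi iv jv] := bcoord_leaves vb.
by apply: fun_algB; [exact: reg_at_alg|apply: reg|apply: reg].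
Qed.

End Regularity.

Lemma Xset_zopen T : zopen (@Xset K r T).
Proof.
pose D (c : mcoord T) (a : K) : {mpoly K[#|mcoord T|]} := coordX K c - a%:MP.
have DE c a w : peval (D c a) w = w c - a by rewrite pevalB peval_coordX pevalC.
apply/zopenP => y Xy; have /(XsetP char0)[[y01 yinj] yq] := Xy.
have n1 a : (forall e, y (inl e) != a) ->
    znear setT y (fun w => forall e, w (inl e) != a).
  move=> ya; apply: znear_forall => e; exists (D (inl e) a).
    by rewrite DE subr_eq0.
  by move=> w _; rewrite DE subr_eq0.
have n2 : znear setT y (fun w => forall e e', (val e).1 = (val e').1 ->
    w (inl e) = w (inl e') -> e = e').
  apply: znear_forall => e; apply: znear_forall => e'.
  have [->|ee'] := eqVneq e e'; first exact: znearT.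
  have [v_eq|v_neq] := eqVneq (val e).1 (val e').1; last first.
    by apply: znearT => w _ v_eq; rewrite v_eq eqxx in v_neq.
  exists (coordX K (inl e) - coordX K (inl e')).
    rewrite pevalB !peval_coordX subr_eq0.
    by apply: contraNneq ee' => /yinj ->.
  move=> w _; rewrite pevalB !peval_coordX subr_eq0 => we _ we'.
  by rewrite we' eqxx in we.
have n3 : znear setT y (fun w => forall i j, i != j ->
    pval w (meet T i j) (lab T i) != pval w (meet T i j) (lab T j)).
  apply: znear_forall => i; apply: znear_forall => j; apply: znear_implyb => ij.
  exists (ppoly K (meet T i j) (lab T i) - ppoly K (meet T i j) (lab T j)).
    by rewrite pevalB subr_eq0; apply: yq.
  by move=> w _; rewrite pevalB subr_eq0.
have na := n1 0 (fun e => (y01 e).1); have nb := n1 1 (fun e => (y01 e).2).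
apply: znearS (znearI (znearI na nb) (znearI n2 n3)) _.
move=> w _ [[w0 w1] [winj wq]]; apply/(XsetP char0); split=> //.
Qed.

Lemma overlapE T S (y : mcoord T -> K) : @overlap _ M T S y <->
  Xset y /\ compatible S (chart_coord y).
Proof.
split=> [[Xy Sy]|[Xy Sy]]; split=> //.
  by rewrite -point_coord_phi //; apply/(in_chartP S (phi_carrier Xy)).
by apply/(in_chartP S (phi_carrier Xy)); rewrite point_coord_phi.
Qed.

Lemma phi_inj T (v w : mcoord T -> K) : Xset v -> Xset w -> phi v = phi w -> v = w.
Proof.
move=> Xv Xw /(congr1 point_coord); rewrite !point_coord_phi // => e.
by rewrite -(chart_coordK char0 Xv) e chart_coordK.
Qed.

(** Seen in the chart of S, the image of U consists of the points compatible with T whose transition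
    to T lands in U; both conditions persist nearby. *)
Lemma phi_open T (U : set (mcoord T -> K)) : zopen_in (@Xset K r T) U ->
  @aopen _ M (@phi K r T @` U).
Proof.
move=> /zopen_inP[UX nU]; split.
  by move=> _ [y Uy <-]; apply/phi_carrier/UX.
move=> S; apply/zopen_inP; split=> [y []//|y [Xy [u Uu uy]]].
have Xu := UX _ Uu.
have cy : chart_coord y = chart_coord u by rewrite -!point_coord_phi // uy.
have Ty : compatible T (chart_coord y) by rewrite cy; apply: chart_coord_compatible.
have uE : @chart_inv K r T (chart_coord y) = u by rewrite cy chart_coordK.
have nX : znear (@Xset K r S) y (fun w => Xset (@chart_inv K r T (chart_coord w))).
  by apply: znearS (compatible_near Xy Ty) _ => w Xw /(chart_inv_phi Xw)[].
have nUy : znear (@Xset K r S) y (fun w => U (@chart_inv K r T (chart_coord w))).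
  by apply: reg_at_comp_near nX _ => //; [apply: transition_reg|rewrite uE; apply: nU].
apply: znearS (znearI (compatible_near Xy Ty) nUy) _ => w Xw [Tw Uw]; split=> //.
by exists (@chart_inv K r T (chart_coord w)) => //; case: (chart_inv_phi Xw Tw).
Qed.

(** * The moduli space as a smooth proper variety *)

Hypothesis r2 : (2 <= r)%N.

Lemma Mbar_prevariety : prevariety M.
Proof.
split.
- move=> T; exists setT, (@Xset K r T); split; last by rewrite setTI.
    exists set0; rewrite predeqE => v; split=> // _ P [].
  exact: Xset_zopen.
- exact: phi_carrier.
- move=> m Mm; have [T Tm] := compatible_tree_ex (point_coord_admissible Mm) r2.
  by exists T; apply/in_chartP.
- by move=> T; split; [exact: phi_inj|exact: phi_open].
move=> T S; exists (fun w => @chart_inv K r S (chart_coord w)); split.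
  split=> [v /overlapE[Xv Sv]|c]; first by case: (chart_inv_phi Xv Sv).
  apply: reg_at_regular_fun => v /overlapE[Xv Sv].
  apply: (reg_at_sub (Y := @Xset K r T)); first by move=> w /overlapE[].
  exact: transition_reg.
by move=> v /overlapE[Xv Sv]; case: (chart_inv_phi Xv Sv).
Qed.

Lemma Mbar_smooth : is_smooth M.
Proof.
(* X_T is open in affine space, so no equation is required. *)
move=> T v Xv; exists 0%N, (fun=> 0), (@Xset K r T).
split; [exact: Xset_zopen|by []| |by rewrite flatmx0 mxrank0].
rewrite setIid; apply/seteqP; split=> [w Xw|w []//].
by split=> // P [[]].
Qed.

(** Off the diagonal some f_jk(i) takes distinct values P : Q and P' : Q' in the projective line.
    The locus where P Q' - P' Q is nonzero is a neighbourhood missing the diagonal. *)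
Lemma Mbar_separated : separated M.
Proof.
split; first by move=> [m m'] [/= Mm <-].
split; first by move=> z [].
move=> [T S]; apply/zopen_inP; split=> [v []//|v [[/= Xv Yv] [_ nv]]].
have cneq : chart_coord (v \o inl) <> chart_coord (v \o inr).
  move=> e; apply: nv; split; first exact: phi_carrier.
  by apply: point_coord_inj; rewrite ?point_coord_phi //; apply: phi_carrier.
have [j [k [i ne]]] : exists j k i,
    chart_coord (v \o inl) j k i != chart_coord (v \o inr) j k i.
  apply: contrapT => nex; apply: cneq; do 3![apply: funext => ?].
  by apply/eqP/negPn/negP => ne; apply: nex; do 3!eexists; exact: ne.
have jk : j != k by apply: contraNneq ne => ->; rewrite /chart_coord /coordinate eqxx.
have [P [Q PQ]] := chart_coord_polys T char0 i jk.
have [P' [Q' PQ']] := chart_coord_polys S char0 i jk.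
pose X := @dom _ (prod_atlas M M) (T, S).
have regl R : reg_at X v (fun w => peval R (w \o inl)).
  apply: fun_alg_peval; first exact: reg_at_alg.
  move=> c; apply: reg_at_eq (reg_at_peval X v (coordX K (inl c))).
  by apply: znearT => w _; rewrite peval_coordX.
have regr R : reg_at X v (fun w => peval R (w \o inr)).
  apply: fun_alg_peval; first exact: reg_at_alg.
  move=> c; apply: reg_at_eq (reg_at_peval X v (coordX K (inr c))).
  by apply: znearT => w _; rewrite peval_coordX.
have [_ _ regM] := reg_at_alg X v.
have regD := fun_algB (reg_at_alg X v)
  (regM _ _ (regl P) (regr Q')) (regM _ _ (regr P') (regl Q)).
have /= nD := reg_at_neq0 (f := fun w => peval P (w \o inl) * peval Q' (w \o inr) -
  peval P' (w \o inr) * peval Q (w \o inl)) _ regD.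
have [n1 E1] := PQ _ Xv; have [n2 E2] := PQ' _ Yv.
rewrite E1 E2 proj_eq // in ne.
apply: znearS (nD _ ne) _; first by split.
move=> w [/= Xw Yw] Dw; split=> //; split; first by split; apply: phi_carrier.
move=> [_ /= e]; move/eqP: Dw; apply; apply/eqP.
have [m1 F1] := PQ _ Xw; have [m2 F2] := PQ' _ Yw.
by rewrite -proj_eq // -F1 -F2 -!point_coord_phi // e.
Qed.

(** This pattern decides which trees are compatible with f and has finitely many values. Choosing
    one tree per pattern replaces a count of the sliced trees. *)
Definition coord_type (f : 'I_r -> 'I_r -> 'I_r -> option K) :
    {ffun 'I_r * 'I_r * 'I_r * 'I_r -> bool * bool} :=
  [ffun p => (f p.1.1.1 p.1.1.2 p.1.2 != None,
              f p.1.1.1 p.1.1.2 p.1.2 != f p.1.1.1 p.1.1.2 p.2)].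

Lemma compatible_coord_type T f g : coord_type f = coord_type g ->
  compatible T f -> compatible T g.
Proof.
move=> fg Tf i j ij; have /= := Tf i j ij; rewrite /slice_coord.
set a := s0_leaf _; set b := s0_leaf _.
have := congr1 (fun h : {ffun _ -> _} => h (a, b, i, j)) fg.
have := congr1 (fun h : {ffun _ -> _} => h (a, b, j, j)) fg.
by rewrite !ffunE /= => -[-> _] [-> ->].
Qed.

(** These are the coordinates of the smooth curve with marked points z, whose single component
    separates all leaves. *)
Lemma admissible_config (z : 'I_r -> K) : injective z ->
  admissible (fun j k i => if j == k then None else Some ((z i - z j) / (z k - z j))).
Proof.
move=> zinj.
have z0 j k : j != k -> z k - z j != 0.
  by move=> jk; rewrite subr_eq0 (inj_eq zinj) eq_sym.
split.
- by move=> j i; rewrite eqxx.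
- by move=> j k jk; rewrite (negPf jk) subrr mul0r.
- by move=> j k jk; rewrite (negPf jk) divff // z0.
- move=> j k l m i a b c lm; case: eqVneq => // jk [<-] [<-] [<-] _.
  have E x : (z x - z j) / (z k - z j) - (z l - z j) / (z k - z j) =
      (z k - z j)^-1 * (z x - z l) by rewrite -mulrBl; ring.
  by rewrite !E proj_scale ?invr_eq0 ?z0 // (negPf lm) proj_fin // z0.
- by move=> j k l m i a b lm; case: eqVneq.
- by move=> j k i jk; rewrite (negPf jk).
Qed.

Lemma admissible_ex : exists f : 'I_r -> 'I_r -> 'I_r -> option K, admissible f.
Proof.
have zinj : injective (fun i : 'I_r => (i : nat)%:R : K).
  by move=> i j /(natr_inj char0)/val_inj.
by eexists; apply: admissible_config zinj.
Qed.

Lemma Mbar_finite_type : finite_type M.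
Proof.
have [f0 adm0] := admissible_ex; have [T0 _] := compatible_tree_ex adm0 r2.
have [Tt TtP] : {Tt : {ffun 'I_r * 'I_r * 'I_r * 'I_r -> bool * bool} -> sliced_tree r &
    forall t f, admissible f -> coord_type f = t -> compatible (Tt t) f}.
  apply: (@choice _ _ (fun t T => forall f, admissible f -> coord_type f = t ->
    compatible T f)) => t.
  have [[f [admf <-]]|nf] := pselect (exists f, admissible f /\ coord_type f = t).
    have [T Tf] := compatible_tree_ex admf r2; exists T => g _ gf.
    exact: compatible_coord_type Tf.
  by exists T0 => f admf ft; case: nf; exists f.
exists (range Tt); first exact: finite_image.
move=> m Mm; have admm := point_coord_admissible Mm.
exists (Tt (coord_type (point_coord m))) => //.
by apply/in_chartP => //; apply: TtP.
Qed.

(* The curves on which no b vanishes are the smooth ones: they lie in every chart. *)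
Lemma smooth_compatible T S (y : mcoord T -> K) : Xset y ->
  (forall v, is_bcoord v -> bval y v != 0) -> compatible S (chart_coord y).
Proof.
move=> Xy b0; have stT := stree_stable T.
have [_ pneq] := (XsetP char0 y).1 Xy.
pose z i := pval y (root T) (lab T i).
have zinj i j : i != j -> z i - z j != 0.
  move=> ij; rewrite subr_eq0 /z.
  have rm := subtree_root (meet T i j).
  rewrite (pval_split y rm (meetl stT ij)) (pval_split y rm (meetr stT ij)).
  rewrite (inj_eq (addrI _)) (inj_eq (mulfI _)) ?pneq // bval_bprod.
  apply/prodf_neq0 => v vm; apply: b0.
  exact: path_bcoord (meet_interior stT ij) vm.
have cE j k i : j != k -> chart_coord y j k i = Some ((z i - z j) / (z k - z j)).
  move=> jk; rewrite /chart_coord (chart_coordinate char0 Xy (w := root T) jk);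
    rewrite ?subtree_root //.
    by rewrite proj_fin // zinj // eq_sym.
  by rewrite [X in _ || X]zinj ?orbT // eq_sym.
move=> i j ij; have stS := stree_stable S.
have ab := is_meet_neq (slice_is_meet (meet_interior stS ij)).
rewrite /= /slice_coord !cE //=; apply/eqP => -[].
move/mulIf; rewrite invr_eq0 zinj 1?eq_sym // => /(_ isT)/addIr e.
by have := zinj i j ij; rewrite e subrr eqxx.
Qed.

(** Each X_T is open in affine space, so nonempty open subsets of it meet. A point outside F moves
    within its chart to a smooth curve outside F, which also lies in the chart of a point outside G;
    there the two complements meet. *)
Lemma Mbar_irreducible : irreducible M.
Proof.
have cover m (Mm : carrier M m) : exists T (y : mcoord T -> K), Xset y /\ phi y = m.
  have [T Tm] := compatible_tree_ex (point_coord_admissible Mm) r2.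
  by exists T, (@chart_inv K r T (point_coord m)); apply: phi_chart_inv.
split.
  have [f admf] := admissible_ex; have [T Tf] := compatible_tree_ex admf r2.
  exists (phi (@chart_inv K r T f)); apply: phi_carrier.
  exact: chart_inv_Xset.
move=> F G [_ [_ oF]] [_ [_ oG]] FG; apply: contrapT.
move=> /not_orP[/existsNP[m1 /not_implyP[Mm1 Fm1]] /existsNP[m2 /not_implyP[Mm2 Gm2]]].
have near_open T (y : mcoord T -> K) (E : set (pt M)) :
    (forall S, zopen_in (@Xset K r S)
      (@Xset K r S `&` (@phi K r S @^-1` (carrier M `\` E)))) ->
    Xset y -> ~ E (phi y) -> znear setT y (fun w => Xset w /\ ~ E (phi w)).
  move=> oE Xy nEy.
  have /zopen_inP[_ /(_ y) [|P Py PE]] := oE T.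
    by split=> //; split=> //; apply: phi_carrier.
  have nX := (zopenP _).1 (Xset_zopen T) y Xy.
  have nP : znear setT y (fun w => peval P w != 0) by apply: znear_neq0.
  apply: znearS (znearI nX nP) _ => w _ [Xw Pw]; split=> //.
  by have [_ []] := PE w Xw Pw.
have [T1 [y1 [Xy1 y1m]]] := cover _ Mm1; have [T2 [y2 [Xy2 y2m]]] := cover _ Mm2.
have n1 := near_open T1 y1 F oF Xy1; rewrite y1m in n1; have {}n1 := n1 Fm1.
have n2 := near_open T2 y2 G oG Xy2; rewrite y2m in n2; have {}n2 := n2 Gm2.
(* Only the b's are constrained here; the point with all coordinates 1 shows that this open subset
   of affine space is nonempty. *)
have nb : znear setT (fun=> 1) (fun w : mcoord T1 -> K =>
    forall v, is_bcoord v -> bval w v != 0).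
  apply: znear_forall => v; apply: znear_implyb => vb; exists (bpoly K v) => //.
  by rewrite -/(bval _ v) (bvalE _ vb) oner_neq0.
have [u [[Xu Fu] bu]] := znear_meet char0 n1 nb.
have Tu := smooth_compatible T2 Xu bu.
have [Xu2 u2E] := chart_inv_phi Xu Tu.
have n3 := near_open T2 _ F oF Xu2; rewrite u2E in n3; have {}n3 := n3 Fu.
have [w [[Xw Fw] [_ Gw]]] := znear_meet char0 n3 n2.
by case: (FG _ (phi_carrier Xw)).
Qed.

Lemma Mbar_universally_closed : universally_closed M.
Proof.
move=> B [_ chartB _ _ _] F [FM [_ oF]]; split.
  by move=> b [[m b'] /FM[_ Bb'] <-].
split; first by move=> b [].
move=> k; apply/zopen_inP; split=> [v []//|v0 [/= Dv0 [_ nv0]]].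
apply: contrapT => nnear; apply: nv0.
(* v0 lies in the closure of the image of F, so a polynomial vanishing on the image vanishes at v0.
   This makes evaluation at v0 a specialization. *)
have dense P : peval P v0 != 0 -> exists v m,
    [/\ dom k v, F (m, chart k v) & peval P v != 0].
  move=> Pv0; apply: contrapT => nex; apply: nnear; exists P => // w Dw Pw.
  split=> //; split; first exact: chartB.
  by move=> [[m b] /= Fm bE]; apply: nex; exists w, m; rewrite -bE.
pose W := {x : (coords k -> K) * pt M | dom k x.1 /\ F (x.2, chart k x.1)}.
pose H0 : set ((W -> K) * K) := [set z : (W -> K) * K | exists P,
  z.1 = (fun x : W => peval P (sval x).1) /\ z.2 = peval P v0].
have sH0 : specialization H0.
  split=> [c|f g a b [P [/= -> ->]] [Q [/= -> ->]]|
    f g a b [P [/= -> ->]] [Q [/= -> ->]]|a].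
  - by exists c%:MP; rewrite pevalC; split=> //=; apply: funext => x; rewrite pevalC.
  - by exists (P + Q); rewrite pevalD; split=> //=; apply: funext => x; rewrite pevalD.
  - by exists (P * Q); rewrite pevalM; split=> //=; apply: funext => x; rewrite pevalM.
  move=> [P [/= P0 ->]]; apply/eqP/negPn/negP => /dense[v [m [Dv Fm Pv]]].
  pose x : W := exist _ (v, m) (conj Dv Fm).
  by have := congr1 (fun h => h x) P0; rewrite /= => Pv0; rewrite -Pv0 eqxx in Pv.
have [H [maxH H0H]] := specialization_max sH0.
pose f (x : W) := point_coord (sval x).2.
have Mx (x : W) : carrier M (sval x).2 by have [_ /FM[]] := svalP x.
have admf x : admissible (f x) by apply/point_coord_admissible/Mx.
have [f0 f0P] : exists f0 : 'I_r -> 'I_r -> 'I_r -> option K,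
    forall j k i, spec_lim H (fun x => f x j k i) (f0 j k i).
  have lim (p : 'I_r * 'I_r * 'I_r) : exists a,
      spec_lim H (fun x => f x p.1.1 p.1.2 p.2) a by apply: spec_lim_ex.
  have [g gP] := choice lim; exists (fun j k i => g (j, k, i)) => j l i.
  exact: (gP (j, l, i)).
have adm0 : admissible f0 by apply: spec_lim_admissible admf f0P.
(* The chart is adapted to the limit f0. The conditions for lying in it are open, so almost all
   points of F satisfy them. *)
have [T Tf0] := compatible_tree_ex adm0 r2; have stT := stree_stable T.
have X0 := chart_inv_Xset char0 adm0 Tf0; set y0 := chart_inv f0 in X0.
have Hcoord v i : interior v -> lab T i \in subtree v ->
    H (fun x => odflt 0 (slice_coord (f x) v i), odflt 0 (slice_coord f0 v i)) /\
    almost H (fun x => slice_coord (f x) v i != None).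
  move=> vi iv; have := f0P (s0_leaf v) (s0_leaf (s1 v)) i.
  rewrite -/(slice_coord f0 v i) (slice_coord_fin Tf0 vi iv) => -[h Hh hE]; split.
    by apply: (spec_almost maxH Hh); apply: almostS hE _ => x; rewrite /slice_coord => ->.
  by apply: almostS hE _ => x; rewrite /slice_coord => ->.
have compT : almost H (fun x => compatible T (f x)).
  apply: almost_forall => // i; apply: almost_forall => // j.
  have [->|ij] := eqVneq i j; first by apply: almostT => // x; rewrite eqxx.
  have vi := meet_interior stT ij.
  have [Hi fi] := Hcoord _ _ vi (meetl stT ij).
  have [Hj fj] := Hcoord _ _ vi (meetr stT ij).
  have nij := almost_neq0 (specB maxH Hi Hj) (slice_coord_neq0 Tf0 (meetP stT ij)).
  apply: almostS (almostI maxH fi (almostI maxH fj nij)) _ => x [/= xi [xj xij]] _.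
  by apply/and3P; split=> //; apply: contraNneq xij => ->; rewrite subrr.
have Hy (c : mcoord T) : H (fun x => @chart_inv K r T (f x) c, y0 c).
  case: c => [e|[v vb]] /=.
    by have [vi _ iv] := xcoord_leaf e; apply: (Hcoord _ _ vi iv).1.
  have [pi iv jv] := bcoord_leaves vb.
  by apply: (specB maxH); [apply: (Hcoord _ _ pi jv).1|apply: (Hcoord _ _ pi iv).1].
pose glue (y : mcoord T -> K) (v : coords k -> K) (c : mcoord T + coords k) :=
  match c with inl c => y c | inr c => v c end.
have [Fy0|nFy0] := pselect (F (phi y0, chart k v0)).
  by exists (phi y0, chart k v0).
(* Otherwise a polynomial P, nonzero at the limit point, cuts out a neighbourhood missing F. Its
   value along the specialization is nonzero, so some point of F lies in this neighbourhood. *)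
have /zopen_inP[_ /(_ (glue y0 v0)) [|P Pv PF]] := oF (T, k).
  by split=> //=; split=> //=; split=> //=; [apply: phi_carrier|apply: chartB].
have HP : H (fun x => peval P (glue (chart_inv (f x)) (sval x).1), peval P (glue y0 v0)).
  apply: (spec_peval P maxH) => -[c|c]; first exact: Hy.
  apply: H0H; exists (coordX K c); rewrite peval_coordX; split=> //=.
  by apply: funext => x; rewrite peval_coordX.
have [x [Tx Px]] := almost_ex maxH (almostI maxH compT (almost_neq0 HP Pv)).
have [Xx xE] := phi_chart_inv (Mx x) Tx.
have [Dx Fx] := svalP x.
have [|_ [_]] := PF (glue (chart_inv (f x)) (sval x).1) _ Px; first by split.
by case; rewrite /= [X in F (X, _)]xE.
Qed.

End ModuliSpace.

Theorem theorem2p1 (R : realType) (r : nat) (hr : (2 <= r)%N) :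
  [/\ is_variety (Mbar R[i] r),
      is_smooth (Mbar R[i] r)
    & is_proper (Mbar R[i] r)].
Proof.
have char0 : [pchar R[i]] =i pred0 := Num.Theory.pchar_num R[i].
split.
- split; [exact: Mbar_prevariety|exact: Mbar_irreducible|exact: Mbar_separated].
- exact: Mbar_smooth.
- split; [exact: Mbar_separated|exact: Mbar_finite_type|].
  exact: Mbar_universally_closed.
Qed.
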